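(* Let $\lambda>0$. For any fixed $p$, $L$ and $n_\ell$, the difference between the terms $$(\mathsf{III})=\frac{\sigma^2}{n_{L+1}}\operatorname{tr}\big(\Lambda^{(L+1)}(\widetilde\Lambda^{(L+1)}+\lambda I)^{-1}\big)\quad\text{and}\quad(\mathsf{III}')=\frac{\sigma^2}{n_{L+1}}\operatorname{tr}\big(\check{\Lambda}^{(L+1)}(\widehat\Lambda^{(L+1)}+\lambda I)^{-1}\big)$$ is given by $$\frac{-\lambda\sigma^2}{n_{L+1}}\operatorname{tr}\Big(\Omega^{1/2}\Sigma^{(L+1)}\hat\Omega^{1/2}\big(\widehat\Lambda^{(L+1)}+\lambda I\big)^{-1}\hat\Omega^{1/2}\big(\hat\Omega^{-1}-\Omega^{-1}\big)\hat\Omega^{1/2}\big(\widehat\Lambda^{(L+1)}+\lambda I\big)^{-1}\Big).$$ Furthermore, suppose that (A) $\|\hat\Omega-\Omega\|\to0$ in probability as $L,n_\ell,p\to\infty$; $\|\Omega\|$ is bounded away from $0$ and infinity by some absolute constant for any $p$; and the condition number $\|\Omega^{-1}\|\|\Omega\|$ is bounded by a universal constant $c_\Omega$ for any $p$; (B) $H_{\Lambda^{(L+1)}}$ converges in distribution to a limiting distribution $H_\Lambda$ as $L\to\infty$, and the support of $H_\Lambda$ is contained in a compact interval bounded uniformly (over $L$) away from $0$ and $\infty$. Then, as $L,n_{L+1},p\to\infty$ such that for each fixed $L$, $p/n_{L+1}\to\gamma_{L+1}$, while $\lim_{L\to\infty}\gamma_{L+1}=\gamma_*\in(1,\infty)$,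 $$R_\lambda(\hat\Omega\mid X^{(L+1)})\xrightarrow{p}\frac{1}{\lambda\gamma_*s(-\lambda)+(1-\gamma_* )}\left[\sigma^2+\Big(\frac{\lambda}{\gamma_*}-\sigma^2\Big)\frac{\lambda^2\gamma_*s'(-\lambda)+(1-\gamma_* )}{\gamma_*\lambda s(-\lambda)+(1-\gamma_* )}\right],$$ where $s(z)$ is the solution to the equation $$s(z)=\int_{-\infty}^{+\infty}\{\tau[1-\gamma_*-\gamma_*zs(z)]-z\}^{-1}dH_\Lambda(\tau).$$
   Context: Test task (index $L+1$; matrices depend on $p$, and test-task quantities may depend on $L$): $X^{(L+1)}=Z^{(L+1)}(\Sigma^{(L+1)})^{1/2}\in\mathbb R^{n_{L+1}\times p}$, where $Z^{(L+1)}$ has i.i.d. entries with mean $0$, variance $1$ and $12$th moment bounded by a constant $c_{\rm m}$, and $\Sigma^{(L+1)}$ is deterministic positive definite with operator norm bounded by a constant $\bar c_{\rm op}$ (both constants uniform in $p$ and $L$). $y^{(L+1)}=X^{(L+1)}\bar\beta^{(L+1)}+\varepsilon^{(L+1)}$, with $\mathbb E\bar\beta^{(L+1)}=0$, $\mathbb E\bar\beta^{(L+1)}\bar\beta^{(L+1)\top}=\frac1p\Omega$ ($\Omega$ positive definite), $\varepsilon^{(L+1)}$ of mean $0$ and covariance $\sigma^2I$, and $X^{(L+1)},\bar\beta^{(L+1)},\varepsilon^{(L+1)}$ independent. $\hat\Omega$ is a positive definite estimator of $\Omega$ computed from the data of $L$ training tasks (sample sizes $n_1,\dots,n_L$) and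 is independent of all test-task quantities. Notation: $\hat\Sigma^{(L+1)}=\frac1{n_{L+1}}X^{(L+1)\top}X^{(L+1)}$, $\Lambda^{(L+1)}=\Omega^{1/2}\Sigma^{(L+1)}\Omega^{1/2}$, $\widetilde\Lambda^{(L+1)}=\Omega^{1/2}\hat\Sigma^{(L+1)}\Omega^{1/2}$, $\check{\Lambda}^{(L+1)}=\hat\Omega^{1/2}\Sigma^{(L+1)}\hat\Omega^{1/2}$, $\widehat\Lambda^{(L+1)}=\hat\Omega^{1/2}\hat\Sigma^{(L+1)}\hat\Omega^{1/2}$; $\|\cdot\|$ is the operator norm. Spectral assumption: for each $L$, as $n_{L+1},p\to\infty$ the empirical spectral distribution of $\Lambda^{(L+1)}$ converges in distribution to a distribution $H_{\Lambda^{(L+1)}}$ supported in a compact interval bounded away from $0$ and $\infty$. Generalized ridge estimator: $\beta_\lambda(A)=(X^{(L+1)\top}X^{(L+1)}+n_{L+1}\lambda A^{-1})^{-1}X^{(L+1)\top}y^{(L+1)}$ for positive definite $A$. Predictive risk: $R_\lambda(A\mid X^{(L+1)})=\mathbb E[(x_{\rm new}^\top\beta_\lambda(A)-y_{\rm new})^2\mid X^{(L+1)}]$ (with $\hat\Omega$ treated as fixed when $A=\hat\Omega$), where $(x_{\rm new},y_{\rm new})$ is an independent test example from the test task ($x_{\rm new}$ distributed as a row of $X^{(L+1)}$, $y_{\rm new}=x_{\rm new}^\top\bar\beta^{(L+1)}+\varepsilon_{\rm new}$, $\varepsilon_{\rm new}$ independent with mean $0$, variance $\sigma^2$). $(\mathsf{III})$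 and $(\mathsf{III}')$ are the last variance terms in the expressions of $R_\lambda(\Omega\mid X^{(L+1)})$ and $R_\lambda(\hat\Omega\mid X^{(L+1)})$ respectively.
   Formalization: Both displays fail as printed (p=1; λ→∞). In the trace the last Ω̂^{1/2}(Λ̂+λI)^{-1} becomes Ω^{1/2}(Λ̃+λI)^{-1}; in the risk limit the last fraction F becomes 1−F. For z<0, s is the solution with 1−γ*−γ*zs(z)>0, and p→∞ is taken before L→∞. *)

(* Defs.v *)
From HB Require Import structures.
From mathcomp Require Import all_boot all_order all_algebra.
From mathcomp Require Import all_classical all_reals all_analysis.

Set Implicit Arguments.
Unset Strict Implicit.
Unset Printing Implicit Defensive.

Import Order.TTheory GRing.Theory Num.Theory.
Import numFieldTopology.Exports numFieldNormedType.Exports.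

Local Open Scope classical_set_scope.
Local Open Scope ring_scope.

(******************************************************************************)
(* Real matrices.                                                             *)
(******************************************************************************)

Section RealMatrices.
Context {R : realType}.

Definition posdefmx p (A : 'M[R]_p) : Prop :=
  A^T = A /\ forall v : 'cV[R]_p, v != 0 -> 0 < (v^T *m A *m v) 0 0.

Definition possemidefmx p (A : 'M[R]_p) : Prop :=
  A^T = A /\ forall v : 'cV[R]_p, 0 <= (v^T *m A *m v) 0 0.

(* A^{1/2}: the unique positive semidefinite square root of a positive        *)
(* semidefinite A (junk value 0 when A has none).                             *)
Definition mxsqrt p (A : 'M[R]_p) : 'M[R]_p :=
  xget 0 [set B | possemidefmx B /\ B *m B = A].

(* The norm `|v| that the library puts on matrices is the sup norm.           *)
Definition enorm p (v : 'cV[R]_p) : R := Num.sqrt (\sum_i v i 0 ^+ 2).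

Definition opnorm p (A : 'M[R]_p) : R :=
  sup [set enorm (A *m v) | v in [set v : 'cV[R]_p | enorm v <= 1]].

(* The eigenvalues of A with multiplicity, for A with a split characteristic  *)
(* polynomial (in particular for A symmetric).                                *)
Definition eigenvalues p (A : 'M[R]_p) : seq R :=
  xget [::] [set s | char_poly A = \prod_(a <- s) ('X - a%:P)].

Definition esd_cdf p (A : 'M[R]_p) (x : R) : R :=
  (count (fun a => a <= x) (eigenvalues A))%:R / p%:R.

End RealMatrices.

(******************************************************************************)
(* Probability.                                                               *)
(******************************************************************************)

Section Probability.
Context {R : realType} {d : measure_display} {T : measurableType d}.
Variable P : probability T R.

Definition measurable_mx m n : set (set 'M[R]_(m, n)) :=
  <<s [set A | exists i j, exists2 B : set R, measurable B &
                 A = [set M : 'M[R]_(m, n) | B (M i j)]] >>.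

Definition sigma_rv (V : T -> R) : set (set T) :=
  preimage_set_system setT V measurable.

Definition sigma_mx m n (V : T -> 'M[R]_(m, n)) : set (set T) :=
  preimage_set_system setT V (@measurable_mx m n).

Definition random_mx m n (V : T -> 'M[R]_(m, n)) : Prop :=
  sigma_mx V `<=` measurable.

Definition same_law m n (V W : T -> 'M[R]_(m, n)) : Prop :=
  forall B, measurable_mx B -> P (V @^-1` B) = P (W @^-1` B).

(* For sigma-algebras F i the full product rule contains the product rules of *)
(* the subfamilies, since setT belongs to every F i.                          *)
Definition mutually_independent (I : finType) (F : I -> set (set T)) : Prop :=
  forall B : I -> set T, (forall i, F i (B i)) ->
    P (\bigcap_i B i) = (\prod_i P (B i))%E.

Definition iid_entries m n (V : T -> 'M[R]_(m, n)) : Prop :=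
  mutually_independent
    (fun ij : 'I_m * 'I_n => sigma_rv (fun w => V w ij.1 ij.2)) /\
  forall i j i' j' (B : set R), measurable B ->
    P [set w | B (V w i j)] = P [set w | B (V w i' j')].

(* g is a version of E[f | F], for f nonnegative (not necessarily integrable) *)
(* and F a sub-sigma-algebra of the measurable sets.                          *)
Definition is_cond_expectation (F : set (set T)) (f g : T -> R) : Prop :=
  [/\ sigma_rv g `<=` F,
      {ae P, forall w, 0 <= g w} &
      forall A, F A ->
        (\int[P]_(w in A) (g w)%:E = \int[P]_(w in A) (f w)%:E)%E].

(* Convergence in probability to c when, for each fixed L, p tends to infinity*)
(* (and the sample sizes with it), and then L tends to infinity; that is,     *)
(* lim_L limsup_p P(|V_{L,p} - c| >= eta) = 0 for every eta > 0.              *)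
Definition cvg_in_prob_pL (V : nat -> nat -> T -> R) (c : R) : Prop :=
  forall eta delta : R, 0 < eta -> 0 < delta ->
    \forall L \near \oo, \forall p \near \oo,
      (P [set w | (eta <= `|V L p w - c|)%R] < delta%:E)%E.

End Probability.

Section ConvergenceInDistribution.
Context {R : realType}.

Definition law_cdf (H : probability (measurableTypeR R) R) (x : R) : R :=
  fine (H `]-oo, x]%classic).

Definition cvg_in_distribution (F : nat -> R -> R) (G : R -> R) : Prop :=
  forall x, {for x, continuous G} -> F k x @[k --> \oo] --> G x.

End ConvergenceInDistribution.

(******************************************************************************)
(* Generalized ridge regression.                                              *)
(******************************************************************************)

Section Ridge.
Context {R : realType}.
Variables (n p : nat).

Definition sample_cov (X : 'M[R]_(n, p)) : 'M[R]_p := n%:R^-1 *: (X^T *m X).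

(* Lambda = twist Omega Sigma,        tilde Lambda = twist Omega hatSigma,    *)
(* check Lambda = twist hatOmega Sigma, hat Lambda = twist hatOmega hatSigma. *)
Definition twist (A S : 'M[R]_p) : 'M[R]_p := mxsqrt A *m S *m mxsqrt A.

Definition resolvent (lambda : R) (A S : 'M[R]_p) : 'M[R]_p :=
  invmx (twist A S + lambda%:M).

(* (III) is the case A = Omega, (III') the case A = hatOmega.                 *)
Definition variance_term (sigma lambda : R) (Sigma : 'M[R]_p)
    (X : 'M[R]_(n, p)) (A : 'M[R]_p) : R :=
  sigma ^+ 2 / n%:R *
    \tr (twist A Sigma *m resolvent lambda A (sample_cov X)).

Definition gridge (lambda : R) (X : 'M[R]_(n, p)) (y : 'cV[R]_n)
    (A : 'M[R]_p) : 'cV[R]_p :=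
  invmx (X^T *m X + (n%:R * lambda) *: invmx A) *m X^T *m y.

(* Squared prediction error of the estimator on the example (x, y), where the *)
(* training responses are X b + e and the new response is x^T b + e'.         *)
Definition prediction_loss (lambda : R) (X : 'M[R]_(n, p)) (b : 'cV[R]_p)
    (e : 'cV[R]_n) (x : 'cV[R]_p) (e' : R) (A : 'M[R]_p) : R :=
  ((x^T *m gridge lambda X (X *m b + e) A) 0 0
     - ((x^T *m b) 0 0 + e')) ^+ 2.

End Ridge.

Section TestTask.
Context {R : realType} {d : measure_display} {T : measurableType d}.
Variables (P : probability T R) (n p : nat).

(* The test design X = Z Sigma^{1/2}.                                         *)
Definition design (Sigma : 'M[R]_p) (Z : T -> 'M[R]_(n, p))
    : T -> 'M[R]_(n, p) :=
  fun w => Z w *m mxsqrt Sigma.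

Record test_task_model (cm cop sigma : R) (Sigma Omega : 'M[R]_p)
    (Z : T -> 'M[R]_(n, p)) (beta : T -> 'cV[R]_p) (eps : T -> 'cV[R]_n)
    (xnew : T -> 'cV[R]_p) (epsnew : T -> R) (Omegahat : T -> 'M[R]_p)
    : Prop := TestTaskModel {
  Sigma_posdef : posdefmx Sigma;
  Sigma_opnorm : opnorm Sigma <= cop;
  Omega_posdef : posdefmx Omega;
  Omegahat_posdef : forall w, posdefmx (Omegahat w);
  Z_random : random_mx Z;
  beta_random : random_mx beta;
  eps_random : random_mx eps;
  xnew_random : random_mx xnew;
  epsnew_random : sigma_rv epsnew `<=` measurable;
  Omegahat_random : random_mx Omegahat;
  Z_iid : iid_entries P Z;
  Z_mean : forall i j, ('E_P[fun w => Z w i j] = 0)%E;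
  Z_variance : forall i j, ('E_P[fun w => (Z w i j ^+ 2)%R] = 1)%E;
  Z_moment12 : forall i j, ('E_P[fun w => (Z w i j ^+ 12)%R] <= cm%:E)%E;
  beta_mean : forall i, ('E_P[fun w => beta w i ord0] = 0)%E;
  beta_cov : forall i j,
    ('E_P[fun w => (beta w i ord0 * beta w j ord0)%R]
       = (Omega i j / p%:R)%R%:E)%E;
  eps_mean : forall i, ('E_P[fun w => eps w i ord0] = 0)%E;
  eps_cov : forall i j,
    ('E_P[fun w => (eps w i ord0 * eps w j ord0)%R]
       = (sigma ^+ 2 *+ (i == j))%R%:E)%E;
  epsnew_mean : ('E_P[epsnew] = 0)%E;
  epsnew_variance : ('E_P[fun w => (epsnew w ^+ 2)%R] = (sigma ^+ 2)%R%:E)%E;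
  xnew_law : forall i,
    same_law P xnew (fun w => (row i (design Sigma Z w))^T);
  test_task_independent : mutually_independent P (fun k : 'I_6 =>
    nth set0 [:: sigma_mx (design Sigma Z); sigma_mx beta; sigma_mx eps;
                 sigma_mx xnew; sigma_rv epsnew; sigma_mx Omegahat] k)
}.

(* risk is (a version of) the predictive risk R_lambda(hatOmega | X), where   *)
(* hatOmega is treated as fixed: hatOmega is independent of the test task, so *)
(* this is the conditional expectation given both X and hatOmega.             *)
Definition is_predictive_risk (lambda : R) (Sigma : 'M[R]_p)
    (Z : T -> 'M[R]_(n, p)) (beta : T -> 'cV[R]_p) (eps : T -> 'cV[R]_n)
    (xnew : T -> 'cV[R]_p) (epsnew : T -> R) (Omegahat : T -> 'M[R]_p)
    (risk : T -> R) : Prop :=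
  is_cond_expectation P
    <<s sigma_mx (design Sigma Z) `|` sigma_mx Omegahat >>
    (fun w => prediction_loss lambda (design Sigma Z w) (beta w) (eps w)
                (xnew w) (epsnew w) (Omegahat w))
    risk.

(* Omegahat is a (measurable) function of the data of the L training tasks.   *)
Definition computed_from (L : nat) (m : 'I_L -> nat)
    (Xtr : forall l, T -> 'M[R]_(m l, p)) (ytr : forall l, T -> 'cV[R]_(m l))
    (Omegahat : T -> 'M[R]_p) : Prop :=
  sigma_mx Omegahat
    `<=` <<s \bigcup_l (sigma_mx (Xtr l) `|` sigma_mx (ytr l)) >>.

End TestTask.

(******************************************************************************)
(* The limiting risk.                                                         *)
(******************************************************************************)

Section Limit.
Context {R : realType}.

(* s solves the Marchenko-Pastur equation with aspect ratio g and population  *)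
(* law H on the negative half-line.  For g > 1 the equation alone has several *)
(* real roots at a given z < 0; the Stieltjes transform is the one for which  *)
(* the companion transform v(z) = g s(z) - (1 - g) / z is positive, i.e.      *)
(* 1 - g - g z s(z) = - z v(z) > 0 (the trace on z < 0 of the usual condition *)
(* that both s and v map the upper half-plane to itself).                     *)
Definition mp_solution (g : R) (H : probability (measurableTypeR R) R)
    (s : R -> R) : Prop :=
  forall z, z < 0 ->
    0 < 1 - g - g * z * s z /\
    ((s z)%:E
       = \int[H]_tau ((tau * (1 - g - g * z * s z) - z)^-1)%R%:E)%E.

(* With v the companion transform of s, dn = lambda v(-lambda) and            *)
(* nm = lambda^2 v'(-lambda): this is                                         *)
(*   1/(lambda v) [sigma^2 + (lambda/g - sigma^2) (1 - lambda v'/v)].         *)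
(* The factor 1 - nm / dn comes from                                          *)
(*   tr(Lambda (tilde Lambda + lambda)^-1) / n -> 1/(lambda v(-lambda)) - 1   *)
(* and its derivative in lambda.  With nm / dn in its place, as the formula   *)
(* is sometimes printed, the risk would be unbounded as lambda -> +oo.        *)
Definition risk_limit (lambda sigma g : R) (s : R -> R) : R :=
  let dn := lambda * g * s (- lambda) + (1 - g) in
  let nm := lambda ^+ 2 * g * derive1 s (- lambda) + (1 - g) in
  dn^-1 * (sigma ^+ 2 + (lambda / g - sigma ^+ 2) * (1 - nm / dn)).

End Limit.

(* Main.v *)
Require Import Defs.
From HB Require Import structures.
From mathcomp Require Import all_boot all_order all_algebra.
From mathcomp Require Import all_classical all_reals all_analysis.
From mathcomp Require Import measurable_realfun ring lra complex.
Import Order.TTheory GRing.Theory Num.Theory.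
Import numFieldTopology.Exports numFieldNormedType.Exports.
Local Open Scope classical_set_scope.
Local Open Scope ring_scope.

Set Implicit Arguments.
Unset Strict Implicit.
Unset Printing Implicit Defensive.

(* Conditionally on the design X and on Omegahat, the prediction error is a
   bilinear form in the independent vectors (xnew, 1) and (beta, eps, epsnew),
   so the predictive risk is almost surely an explicit trace formula.  This
   formula is Lipschitz in Omegahat, uniformly in the dimension, so one may take
   Omegahat = Omega.  Then it is an affine function of
   phi(l) = tr(Sigma Q(l)) / n and of phi'(l), where
   Q(l) = (hatSigma + l Omega^-1)^-1.  Removing one row of X at a time and using
   the concentration of quadratic forms in a row, phi(l) nearly solves
   t = tr(Sigma (Sigma / (1 + t) + l Omega^-1)^-1) / n; this equation is stable,
   and its right-hand side is a linear statistic of the spectrum of Lambda, so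
   that phi(l) tends to the solution of the limiting equation, which is
   1 / (l v(-l)) - 1 with v the companion transform of s.  The derivative phi' is
   recovered from difference quotients, the second derivative of phi being
   bounded. *)

(** * Symmetric and positive matrices *)

Section SymmetricMatrices.
Context {R : realType}.

(** Conjugation by the square root turns the resolvent of A^{1/2} hatSigma A^{1/2} into (hatSigma +
    l A^-1)^-1, so A enters only through its inverse, and the difference of two such resolvents is a
    product. Traces are bounded by p times an operator norm; dividing by n leaves the bounded factor
    p / n. The random phi is compared directly with the limit t, not with the solution of a
    finite-dimensional equation: t is inserted in a deterministic resolvent, and the error with
    which it solves the equation in dimension p is what the convergence of spectra sends to 0. On
    the negative half-line all quantities are real and positive, and positivity replaces complex
    analysis: it gives the contraction factor sbar / (sbar + rho) < 1, and it selects the right root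
    of the limiting equation as the one with t >= 0. The probabilistic input of the comparison is a
    mean square of order 1 / n, hence one exceptional set given by Markov's inequality. The limit
    involves s', while [mp_solution] is only a pointwise equation; the derivative is extracted from
    that equation. *)

Definition dotv p (u v : 'cV[R]_p) : R := \sum_i u i 0 * v i 0.

Lemma dotvE p (u v : 'cV[R]_p) : dotv u v = (u^T *m v) 0 0.
Proof. by rewrite mxE; apply: eq_bigr => i _; rewrite mxE. Qed.

Lemma dotvC p (u v : 'cV[R]_p) : dotv u v = dotv v u.
Proof. by apply: eq_bigr => i _; rewrite mulrC. Qed.

Lemma dotvDl p (u v w : 'cV[R]_p) : dotv (u + v) w = dotv u w + dotv v w.
Proof. by rewrite -big_split; apply: eq_bigr => i _; rewrite mxE mulrDl. Qed.

Lemma dotvZl p a (u w : 'cV[R]_p) : dotv (a *: u) w = a * dotv u w.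
Proof. by rewrite mulr_sumr; apply: eq_bigr => i _; rewrite mxE mulrA. Qed.

Lemma dotvNl p (u w : 'cV[R]_p) : dotv (- u) w = - dotv u w.
Proof. by rewrite -scaleN1r dotvZl mulN1r. Qed.

Lemma dotvBl p (u v w : 'cV[R]_p) : dotv (u - v) w = dotv u w - dotv v w.
Proof. by rewrite dotvDl dotvNl. Qed.

Lemma dotvDr p (u v w : 'cV[R]_p) : dotv w (u + v) = dotv w u + dotv w v.
Proof. by rewrite !(dotvC w) dotvDl. Qed.

Lemma dotvZr p a (u w : 'cV[R]_p) : dotv w (a *: u) = a * dotv w u.
Proof. by rewrite !(dotvC w) dotvZl. Qed.

Lemma dotvBr p (u v w : 'cV[R]_p) : dotv w (u - v) = dotv w u - dotv w v.
Proof. by rewrite !(dotvC w) dotvBl. Qed.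

Lemma dotv0l p (w : 'cV[R]_p) : dotv 0 w = 0.
Proof. by rewrite /dotv big1 // => i _; rewrite mxE mul0r. Qed.

Lemma dotv0r p (w : 'cV[R]_p) : dotv w 0 = 0.
Proof. by rewrite dotvC dotv0l. Qed.

Lemma dotv_mull m p (A : 'M[R]_(m, p)) u v : dotv (A *m u) v = dotv u (A^T *m v).
Proof. by rewrite !dotvE trmx_mul mulmxA. Qed.

Lemma dotv_mulr m p (A : 'M[R]_(m, p)) u v : dotv v (A *m u) = dotv (A^T *m v) u.
Proof. by rewrite dotvC dotv_mull dotvC. Qed.

Lemma dotv_ge0 p (v : 'cV[R]_p) : 0 <= dotv v v.
Proof. by apply: sumr_ge0 => i _; rewrite -expr2 sqr_ge0. Qed.

Lemma dotv_eq0 p (v : 'cV[R]_p) : (dotv v v == 0) = (v == 0).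
Proof.
apply/eqP/eqP => [|->]; last by rewrite dotv0l.
move=> /eqP; rewrite psumr_eq0 => [/allP h|i _]; last by rewrite -expr2 sqr_ge0.
apply/matrixP => i j; rewrite ord1 mxE; apply/eqP.
by have := h i; rewrite mem_index_enum mulf_eq0 orbb => /(_ isT).
Qed.

Lemma dotv_gt0 p (v : 'cV[R]_p) : v != 0 -> 0 < dotv v v.
Proof. by move=> v0; rewrite lt_def dotv_ge0 dotv_eq0 v0. Qed.

Lemma enormE p (v : 'cV[R]_p) : enorm v = Num.sqrt (dotv v v).
Proof. by rewrite /enorm; congr Num.sqrt; apply: eq_bigr => i _; rewrite expr2. Qed.

Lemma enorm_sqr p (v : 'cV[R]_p) : enorm v ^+ 2 = dotv v v.
Proof. by rewrite enormE sqr_sqrtr // dotv_ge0. Qed.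

Lemma enorm_ge0 p (v : 'cV[R]_p) : 0 <= enorm v.
Proof. by rewrite enormE sqrtr_ge0. Qed.

Lemma quadE p (A : 'M[R]_p) (v : 'cV[R]_p) :
  (v^T *m A *m v) 0 0 = dotv v (A *m v).
Proof. by rewrite dotvE mulmxA. Qed.

(* Take a complex left eigenvector: its real or its imaginary part is a real
   eigenvector, because symmetry forces the eigenvalue to be real. *)
Lemma symmetric_eigenvector p (A : 'M[R]_p) : (0 < p)%N -> A^T = A ->
  exists a (v : 'cV[R]_p), v != 0 /\ A *m v = a *: v.
Proof.
move=> p0 sA; pose AC : 'M[R[i]]_p := map_mx (real_complex R) A.
have [z /eigenvalueP[v vA v0]] := eigenvalue_closed AC p0.
pose x : 'cV[R]_p := \col_i complex.Re (v 0 i).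
pose y : 'cV[R]_p := \col_i complex.Im (v 0 i).
have ReD : {morph (@complex.Re R) : a b / a + b >-> a + b}.
  by move=> [a b] [c d].
have ImD : {morph (@complex.Im R) : a b / a + b >-> a + b}.
  by move=> [a b] [c d].
have entry j : \sum_k v 0 k * AC k j = z * v 0 j.
  by have /matrixP/(_ 0 j) := vA; rewrite !mxE.
have Ax : A *m x = complex.Re z *: x - complex.Im z *: y.
  apply/matrixP => j k; rewrite ord1 !mxE.
  have := congr1 (@complex.Re R) (entry j).
  rewrite (big_morph _ ReD (erefl _)).
  case: z {vA entry} => [a b] /=; case: (v 0 j) => [c d] /= <-.
  apply: eq_bigr => i _; rewrite !mxE -{1}sA mxE.
  by case: (v 0 i) => [e f] /=; rewrite mulr0 subr0 mulrC.
have Ay : A *m y = complex.Re z *: y + complex.Im z *: x.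
  apply/matrixP => j k; rewrite ord1 !mxE.
  have := congr1 (@complex.Im R) (entry j).
  rewrite (big_morph _ ImD (erefl _)).
  case: z {vA entry Ax} => [a b] /=; case: (v 0 j) => [c d] /= <-.
  apply: eq_bigr => i _; rewrite !mxE -{1}sA mxE.
  by case: (v 0 i) => [e f] /=; rewrite mulr0 add0r mulrC.
have xy : (x != 0) || (y != 0).
  apply: contra_neqT v0; rewrite negb_or !negbK => /andP[/eqP x0 /eqP y0].
  apply/matrixP => i j; rewrite ord1 mxE.
  have := congr1 (fun M : 'cV[R]_p => M j 0) x0.
  have := congr1 (fun M : 'cV[R]_p => M j 0) y0.
  by rewrite !mxE; case: (v 0 j) => a b /= -> ->.
have Imz : complex.Im z = 0.
  have : dotv x (A *m y) = dotv (A *m x) y by rewrite dotv_mulr sA.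
  rewrite Ax Ay dotvDr dotvBl !dotvZl !dotvZr => xAy.
  have /eqP : complex.Im z * (dotv x x + dotv y y) = 0 by lra.
  rewrite mulf_eq0 => /orP[/eqP//|].
  rewrite paddr_eq0 ?dotv_ge0// !dotv_eq0 => /andP[x0 y0].
  by move: xy; rewrite x0 y0.
case/orP: xy => [x0|y0]; [exists (complex.Re z), x|exists (complex.Re z), y].
  by split=> //; rewrite Ax Imz scale0r subr0.
by split=> //; rewrite Ay Imz scale0r addr0.
Qed.

(** The reflection in the hyperplane orthogonal to v - e exchanges the unit vectors v and e. It is a
    symmetric involution, so conjugation by it preserves symmetry. When v = e there is nothing to
    reflect and the identity serves. *)
Lemma householder p (v : 'cV[R]_p.+1) : dotv v v = 1 ->
  exists U : 'M[R]_p.+1, [/\ U^T = U, U *m U = 1%:M & U *m delta_mx 0 0 = v].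
Proof.
move=> v1; pose e : 'cV[R]_p.+1 := delta_mx 0 0.
have ee : dotv e e = 1.
  by rewrite dotvE trmx_delta mul_delta_mx mxE.
have [->|ve] := eqVneq v e.
  by exists 1%:M; rewrite trmx1 !mul1mx.
pose w : 'cV[R]_p.+1 := v - e; have w0 : 0 < dotv w w by rewrite dotv_gt0 // subr_eq0.
pose c := 2 / dotv w w.
have wwT : w^T *m w = (dotv w w)%:M.
  by rewrite dotvE [LHS]mx11_scalar.
exists (1%:M - c *: (w *m w^T)); split.
- by rewrite linearB linearZ /= trmx1 trmx_mul trmxK.
- rewrite mulmxBl mul1mx mulmxBr mulmx1 -scalemxAl -scalemxAr.
  have -> : w *m w^T *m (w *m w^T) = dotv w w *: (w *m w^T).
    by rewrite mulmxA -(mulmxA w) wwT mul_mx_scalar scalemxAl.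
  rewrite scalerA scalerA.
  have cc : c * c * dotv w w = c + c.
    by rewrite /c; field; rewrite gt_eqF.
  rewrite cc.
  by rewrite scalerDl opprB addrK subrK.
rewrite -/e mulmxBl mul1mx -scalemxAl -mulmxA.
have -> : w^T *m e = (dotv w e)%:M by rewrite dotvE [LHS]mx11_scalar.
have we : dotv w w = - (2 * dotv w e).
  by rewrite /w !dotvBl !dotvBr v1 ee (dotvC e v); ring.
rewrite mul_mx_scalar scalerA.
have -> : c * dotv w e = -1.
  have wen0 : dotv w e != 0.
    by apply/eqP => h; move: w0; rewrite we h mulr0 oppr0 ltxx.
  by rewrite /c we; field.
by rewrite scaleN1r opprK /w addrC subrK.
Qed.

(** Deflation: after conjugation by a reflection sending the first basis vector to a unit
    eigenvector, the first column, and by symmetry the first row, is a multiple of that basis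
    vector. The induction hypothesis diagonalizes the remaining block. *)
Theorem symmetric_spectral p (A : 'M[R]_p) : A^T = A ->
  exists (U : 'M[R]_p) (d : 'rV[R]_p),
    [/\ U^T *m U = 1%:M, U *m U^T = 1%:M & A = U *m diag_mx d *m U^T].
Proof.
elim: p => [|p IH] in A *; move=> sA.
  by exists 1%:M, 0; split; apply/matrixP => -[].
have [a [v [v0 Av]]] := symmetric_eigenvector (ltn0Sn p) sA.
pose u := (Num.sqrt (dotv v v))^-1 *: v.
have u1 : dotv u u = 1.
  rewrite dotvZl dotvZr mulrA -expr2 exprVn sqr_sqrtr ?dotv_ge0//.
  by rewrite mulVf // dotv_eq0.
have Au : A *m u = a *: u by rewrite -scalemxAr Av !scalerA mulrC.
have [U [sU UU Ue]] := householder u1.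
pose B := U *m A *m U.
have sB : B^T = B by rewrite /B !trmx_mul sU sA mulmxA.
have Be : B *m delta_mx 0 0 = a *: (delta_mx 0 0 : 'cV[R]_p.+1).
  by rewrite -mulmxA Ue -mulmxA Au -scalemxAr -Ue mulmxA UU mul1mx.
have Bi0 i : B i 0 = a * (i == 0)%:R.
  have := congr1 (fun M : 'cV[R]_p.+1 => M i 0) Be.
  by rewrite -colE !mxE eqxx andbT.
have B0i i : B 0 i = a * (i == 0)%:R by rewrite -sB mxE Bi0.
have AB : A = U *m B *m U.
  by rewrite /B !mulmxA UU mul1mx -mulmxA UU mulmx1.
clearbody B.
pose D : 'M[R]_p := drsubmx (B : 'M[R]_(1 + p)).
have l0 : lshift p (0 : 'I_1) = (0 : 'I_p.+1) by apply: val_inj.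
have Bblock : (B : 'M[R]_(1 + p)) = block_mx a%:M 0 0 D.
  rewrite -[LHS](@submxK _ 1 p 1 p); congr block_mx; apply/matrixP => i j; rewrite !mxE.
  - by rewrite (ord1 i) (ord1 j) !l0 B0i eqxx mulr1.
  - by rewrite (ord1 i) l0 B0i mulr0.
  - by rewrite (ord1 j) l0 Bi0 mulr0.
have sD : D^T = D.
  by apply/matrixP => i j; rewrite !mxE -[in LHS]sB mxE.
have [V [d [VV VV' DE]]] := IH D sD.
pose W : 'M[R]_(1 + p) := block_mx 1%:M 0 0 V.
have WT : W^T = block_mx 1%:M 0 0 V^T.
  by rewrite /W tr_block_mx trmx1 !trmx0.
have WTW : W^T *m W = 1%:M.
  rewrite WT /W mulmx_block !(mul1mx, mul0mx, mulmx0, mulmx1, addr0, add0r) VV.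
  by rewrite -scalar_mx_block.
have WWT : W *m W^T = 1%:M.
  rewrite WT /W mulmx_block !(mul1mx, mul0mx, mulmx0, mulmx1, addr0, add0r) VV'.
  by rewrite -scalar_mx_block.
pose d' : 'rV[R]_(1 + p) := row_mx a%:M d.
have BE : B = W *m diag_mx d' *m W^T.
  apply: (etrans Bblock).
  rewrite /d' diag_mx_row WT /W !mulmx_block.
  rewrite !(mul1mx, mul0mx, mulmx0, mulmx1, addr0, add0r) -DE; congr block_mx.
  by apply/matrixP => i j; rewrite !ord1 !mxE eqxx.
exists (U *m W), d'; split.
- by rewrite trmx_mul sU mulmxA -(mulmxA W^T) UU mulmx1.
- by rewrite trmx_mul sU mulmxA -(mulmxA U) WWT mulmx1.
by rewrite trmx_mul sU AB [in LHS]BE !mulmxA.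
Qed.

End SymmetricMatrices.

(** * Positive matrices, square roots, operator norm and trace inequalities *)

Section PositiveMatrices.
Context {R : realType}.

Lemma quad_col p q (C : 'M[R]_(p, q)) (M : 'M[R]_p) i :
  (C^T *m M *m C) i i = dotv (col i C) (M *m col i C).
Proof.
rewrite -mulmxA mxE; apply: eq_bigr => k _; rewrite !mxE; congr (_ * _).
by apply: eq_bigr => l _; rewrite !mxE.
Qed.

(** Eigenvalues are values of the quadratic form at the columns of U; this carries bounds on the
    form over to the spectrum. *)
Lemma spectral_entry p (A U : 'M[R]_p) (d : 'rV[R]_p) i :
  U^T *m U = 1%:M -> A = U *m diag_mx d *m U^T ->
  d 0 i = dotv (col i U) (A *m col i U).
Proof.
move=> UU ->; rewrite -quad_col !mulmxA UU mul1mx -mulmxA UU mulmx1.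
by rewrite mxE eqxx.
Qed.

Lemma col_orth_norm p (U : 'M[R]_p) i :
  U^T *m U = 1%:M -> dotv (col i U) (col i U) = 1.
Proof.
move=> UU; have := quad_col U 1%:M i.
by rewrite mulmx1 mul1mx UU mxE eqxx => <-.
Qed.

Lemma posdef_psd p (A : 'M[R]_p) : posdefmx A -> possemidefmx A.
Proof.
move=> [sA hA]; split=> // v; have [->|v0] := eqVneq v 0; last exact/ltW/hA.
by rewrite mulmx0 mxE.
Qed.

Lemma psd_quad p (A : 'M[R]_p) v : possemidefmx A -> 0 <= dotv v (A *m v).
Proof. by move=> [_ /(_ v)]; rewrite quadE. Qed.

Lemma posdef_quad p (A : 'M[R]_p) v :
  posdefmx A -> v != 0 -> 0 < dotv v (A *m v).
Proof. by move=> [_ /(_ v)]; rewrite quadE. Qed.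

(** [xget] returns an element of the set as soon as there is one, so the matter is existence: take
    square roots of the eigenvalues. *)
Lemma mxsqrtP p (A : 'M[R]_p) : possemidefmx A ->
  possemidefmx (mxsqrt A) /\ mxsqrt A *m mxsqrt A = A.
Proof.
move=> pA; apply: (@xgetPex _ 0 [set B | possemidefmx B /\ B *m B = A]).
have [U [d [UU UU' AE]]] := symmetric_spectral pA.1.
have d0 i : 0 <= d 0 i by rewrite (spectral_entry i UU AE); exact: psd_quad.
pose r : 'rV[R]_p := \row_i Num.sqrt (d 0 i).
exists (U *m diag_mx r *m U^T); split.
  split; first by rewrite !trmx_mul trmxK tr_diag_mx mulmxA.
  move=> v; rewrite quadE -!mulmxA dotv_mulr mul_diag_mx.
  apply: sumr_ge0 => i _; rewrite [X in _ * X]mxE mulrCA -expr2.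
  by rewrite mulr_ge0 ?sqr_ge0 // mxE sqrtr_ge0.
rewrite -mulmxA !(mulmxA U^T) UU mul1mx mulmxA -(mulmxA U).
rewrite mulmx_diag [in RHS]AE; congr (_ *m diag_mx _ *m _).
by apply/rowP => i; rewrite !mxE -expr2 sqr_sqrtr.
Qed.

Lemma tr_mxsqrt p (A : 'M[R]_p) : possemidefmx A -> (mxsqrt A)^T = mxsqrt A.
Proof. by move=> /mxsqrtP[[]]. Qed.

Lemma mxsqrt_sq p (A : 'M[R]_p) : possemidefmx A -> mxsqrt A *m mxsqrt A = A.
Proof. by move=> /mxsqrtP[]. Qed.

Lemma unitmx_ker0 p (A : 'M[R]_p) :
  (forall v : 'cV[R]_p, A *m v = 0 -> v = 0) -> A \in unitmx.
Proof.
move=> hA; rewrite -unitmx_tr -row_free_unit -kermx_eq0.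
apply/eqP/row_matrixP => i; rewrite row0.
have /(congr1 trmx) : row i (kermx A^T) *m A^T = 0.
  by apply/sub_kermxP; exact: row_sub.
rewrite trmx_mul trmxK trmx0 => /hA /(congr1 trmx).
by rewrite trmxK trmx0.
Qed.

Lemma posdef_unitmx p (A : 'M[R]_p) : posdefmx A -> A \in unitmx.
Proof.
move=> pA; apply: unitmx_ker0 => v Av; apply/eqP/negPn/negP => v0.
by have := posdef_quad pA v0; rewrite Av dotv0r ltxx.
Qed.

Lemma mxsqrt_unitmx p (A : 'M[R]_p) : posdefmx A -> mxsqrt A \in unitmx.
Proof.
move=> pA; have := posdef_unitmx pA.
by rewrite -{1}(mxsqrt_sq (posdef_psd pA)) unitmx_mul andbb.
Qed.

Lemma posdef_inv p (A : 'M[R]_p) : posdefmx A -> posdefmx (invmx A).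
Proof.
move=> pA; have uA := posdef_unitmx pA; split; first by rewrite trmx_inv pA.1.
move=> v v0; rewrite quadE.
have -> : v = A *m (invmx A *m v) by rewrite mulKVmx.
rewrite mulKmx // dotvC; apply: posdef_quad => //.
by apply: contra_neq v0 => h; rewrite -(mulKVmx uA v) h mulmx0.
Qed.

Lemma posdefD p (A B : 'M[R]_p) :
  possemidefmx A -> posdefmx B -> posdefmx (A + B).
Proof.
move=> pA pB; split; first by rewrite linearD /= pA.1 pB.1.
move=> v v0; rewrite quadE mulmxDl dotvDr ltr_wpDl ?psd_quad//.
exact: posdef_quad.
Qed.

Lemma posdefZ p (A : 'M[R]_p) a : 0 < a -> posdefmx A -> posdefmx (a *: A).
Proof.
move=> a0 pA; split; first by rewrite linearZ /= pA.1.
by move=> v v0; rewrite quadE -scalemxAl dotvZr mulr_gt0 ?posdef_quad.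
Qed.

Lemma psdZ p (A : 'M[R]_p) a : 0 <= a -> possemidefmx A -> possemidefmx (a *: A).
Proof.
move=> a0 pA; split; first by rewrite linearZ /= pA.1.
by move=> v; rewrite quadE -scalemxAl dotvZr mulr_ge0 ?psd_quad.
Qed.

Lemma psd_gram p q (X : 'M[R]_(q, p)) : possemidefmx (X^T *m X).
Proof.
split; first by rewrite trmx_mul trmxK.
by move=> v; rewrite quadE -mulmxA dotv_mulr trmxK dotv_ge0.
Qed.

Lemma psd_CS p (A : 'M[R]_p) u v : possemidefmx A ->
  dotv u (A *m v) ^+ 2 <= dotv u (A *m u) * dotv v (A *m v).
Proof.
move=> pA; set a := dotv u _; set b := dotv u (A *m u); set c := dotv v (A *m v).
have b0 : 0 <= b by exact: psd_quad.
have c0 : 0 <= c by exact: psd_quad.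
have h s t : 0 <= s ^+ 2 * b + (s * t) * a *+ 2 + t ^+ 2 * c.
  have := psd_quad (s *: u + t *: v) pA.
  rewrite mulmxDr -!scalemxAr !dotvDl !dotvDr !dotvZl !dotvZr -/a -/b -/c.
  have -> : dotv v (A *m u) = a by rewrite dotv_mulr pA.1 dotvC.
  by congr (0 <= _); ring.
have [c1|c1] := eqVneq c 0.
  rewrite c1 mulr0.
  have [a0|a0] := eqVneq a 0; first by rewrite a0 expr0n.
  (* With c = 0 and a nonzero, this choice would give the form the value - b - 2 < 0. *)
  have h2 := h 1 (- (b + 1) / a).
  rewrite c1 in h2.
  have e : 1 * (- (b + 1) / a) * a = - (b + 1) by field.
  by rewrite e in h2; exfalso; nra.
have c2 : 0 < c by rewrite lt_def c1.
have := h c (- a).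
have -> : c ^+ 2 * b + c * - a * a *+ 2 + (- a) ^+ 2 * c = c * (b * c - a ^+ 2).
  by ring.
by rewrite pmulr_rge0 // subr_ge0.
Qed.

Lemma dotv_CS p (u v : 'cV[R]_p) : dotv u v ^+ 2 <= dotv u u * dotv v v.
Proof.
have p1 : possemidefmx (1%:M : 'M[R]_p).
  by rewrite -[1%:M]mulmx1 -{1}trmx1; exact: psd_gram.
by have := psd_CS u v p1; rewrite !mul1mx.
Qed.

Lemma dotv_le_enorm p (u v : 'cV[R]_p) : `|dotv u v| <= enorm u * enorm v.
Proof.
rewrite -(@ler_pXn2r _ 2) ?nnegrE ?mulr_ge0 ?enorm_ge0//.
by rewrite real_normK ?num_real// exprMn !enorm_sqr dotv_CS.
Qed.

Lemma enormD p (u v : 'cV[R]_p) : enorm (u + v) <= enorm u + enorm v.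
Proof.
rewrite -(@ler_pXn2r _ 2) ?nnegrE ?addr_ge0 ?enorm_ge0//.
rewrite enorm_sqr sqrrD !enorm_sqr dotvDl !dotvDr (dotvC v u).
have := ler_norm (dotv u v); have := dotv_le_enorm u v; lra.
Qed.

Lemma enormZ p a (u : 'cV[R]_p) : enorm (a *: u) = `|a| * enorm u.
Proof.
rewrite !enormE dotvZl dotvZr mulrA -expr2 sqrtrM ?sqr_ge0//.
by rewrite sqrtr_sqr.
Qed.

Lemma enorm0 p : enorm (0 : 'cV[R]_p) = 0.
Proof. by rewrite enormE dotv0l sqrtr0. Qed.

Lemma enorm_delta p i : enorm (delta_mx i 0 : 'cV[R]_p) = 1.
Proof. by rewrite enormE dotvE trmx_delta mul_delta_mx mxE sqrtr1. Qed.

(** A relation rather than a value: bounds compose without evaluating the supremum in [opnorm]. The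
    sign of c is recorded because the second clause does not force it when p = 0. *)
Definition opbound p q (M : 'M[R]_(q, p)) (c : R) : Prop :=
  0 <= c /\ forall v, enorm (M *m v) <= c * enorm v.

Lemma opbound_le p q (M : 'M[R]_(q, p)) c d :
  opbound M c -> c <= d -> opbound M d.
Proof.
move=> [c0 Mc] cd; split=> [|v]; first exact: le_trans cd.
by apply: (le_trans (Mc v)); rewrite ler_wpM2r ?enorm_ge0.
Qed.

Lemma opboundM p q r (M : 'M[R]_(q, p)) (N : 'M[R]_(p, r)) c d :
  opbound M c -> opbound N d -> opbound (M *m N) (c * d).
Proof.
move=> [c0 Mc] [d0 Nd]; split=> [|v]; first exact: mulr_ge0.
rewrite -mulmxA -mulrA; apply: (le_trans (Mc _)).
by rewrite ler_wpM2l.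
Qed.

Lemma opboundD p q (M N : 'M[R]_(q, p)) c d :
  opbound M c -> opbound N d -> opbound (M + N) (c + d).
Proof.
move=> [c0 Mc] [d0 Nd]; split=> [|v]; first exact: addr_ge0.
by rewrite mulmxDl mulrDl; apply: (le_trans (enormD _ _)); exact: lerD.
Qed.

Lemma opboundZ p q (M : 'M[R]_(q, p)) c a :
  opbound M c -> opbound (a *: M) (`|a| * c).
Proof.
move=> [c0 Mc]; split=> [|v]; first exact: mulr_ge0.
by rewrite -scalemxAl enormZ -mulrA ler_wpM2l.
Qed.

Lemma opboundN p q (M : 'M[R]_(q, p)) c : opbound M c -> opbound (- M) c.
Proof. by move/opboundZ => /(_ (-1)); rewrite scaleN1r normrN1 mul1r. Qed.

Lemma opboundB p q (M N : 'M[R]_(q, p)) c d :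
  opbound M c -> opbound N d -> opbound (M - N) (c + d).
Proof. by move=> Mc /opboundN; exact: opboundD. Qed.

Lemma opbound_quad p (M : 'M[R]_p) c v :
  opbound M c -> dotv v (M *m v) <= c * dotv v v.
Proof.
move=> [c0 Mc]; apply: (le_trans (ler_norm _)).
apply: (le_trans (dotv_le_enorm _ _)).
by rewrite -enorm_sqr expr2 mulrCA ler_wpM2l ?enorm_ge0.
Qed.

Lemma opbound_trace p (M : 'M[R]_p) c : opbound M c -> `|\tr M| <= p%:R * c.
Proof.
move=> [c0 Mc]; apply: (le_trans (ler_norm_sum _ _ _)).
apply: (@le_trans _ _ (\sum_(i < p) c)); last by rewrite sumr_const card_ord mulr_natl.
apply: ler_sum => i _.
have -> : M i i = dotv (delta_mx i 0) (M *m delta_mx i 0).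
  by rewrite -colE dotvE trmx_delta -rowE !mxE.
apply: (le_trans (dotv_le_enorm _ _)); rewrite enorm_delta mul1r.
by apply: (le_trans (Mc _)); rewrite enorm_delta mulr1.
Qed.

(** Column j is the image of a basis vector, hence of norm at most c. *)
Lemma opbound_frobenius p q (M : 'M[R]_(q, p)) c : opbound M c ->
  \sum_i \sum_j M i j ^+ 2 <= p%:R * c ^+ 2.
Proof.
move=> [c0 Mc]; rewrite exchange_big /=.
apply: (@le_trans _ _ (\sum_(i < p) c ^+ 2)); last by rewrite sumr_const card_ord mulr_natl.
apply: ler_sum => j _.
have := Mc (delta_mx j 0); rewrite enorm_delta mulr1 => h.
have -> : \sum_i M i j ^+ 2 = enorm (M *m delta_mx j 0) ^+ 2.
  rewrite enorm_sqr -colE; apply: eq_bigr => i _; by rewrite mxE expr2.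
by rewrite ler_pXn2r ?nnegrE ?enorm_ge0.
Qed.

(** Cauchy-Schwarz for the form M between M v and v: |M v|^4 is at most the product of the values of
    the form at M v and at v, hence at most c |M v|^2 times c |v|^2. *)
Lemma opbound_psd p (M : 'M[R]_p) c : 0 <= c -> possemidefmx M ->
  (forall v, dotv v (M *m v) <= c * dotv v v) -> opbound M c.
Proof.
move=> c0 pM h; split=> // v.
rewrite -(@ler_pXn2r _ 2) ?nnegrE ?mulr_ge0 ?enorm_ge0// exprMn !enorm_sqr.
have CS := psd_CS (M *m v) v pM; rewrite expr2 in CS.
have h1 := h (M *m v); have h2 := h v.
set a := dotv (M *m v) (M *m v) in CS h1 *; set b := dotv v v in h2 *.
have a0 : 0 <= a by exact: dotv_ge0.
have [->|a1] := eqVneq a 0; first by rewrite mulr_ge0 ?sqr_ge0 ?dotv_ge0.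
have a2 : 0 < a by rewrite lt_def a1.
rewrite -(ler_pM2l a2); apply: (le_trans CS).
have -> : a * (c ^+ 2 * b) = (c * a) * (c * b) by ring.
by apply: ler_pM => //; exact: psd_quad.
Qed.

(** Coercivity: for w = M^-1 v, r |w|^2 <= <w, M w> = <w, v> <= |w| |v|. *)
Lemma opbound_inv p (M : 'M[R]_p) r : 0 < r -> M \in unitmx ->
  (forall v, r * dotv v v <= dotv v (M *m v)) -> opbound (invmx M) r^-1.
Proof.
move=> r0 uM h; split=> [|v]; first by rewrite invr_ge0 ltW.
set w := invmx M *m v; have vE : v = M *m w by rewrite /w mulKVmx.
have := le_trans (h w) (le_trans (ler_norm _) (dotv_le_enorm _ _)).
rewrite -vE -enorm_sqr; have := enorm_ge0 w; have := enorm_ge0 v.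
set a := enorm w; set b := enorm v => b0 a0 hab.
rewrite mulrC ler_pdivlMr //.
have [->|a1] := eqVneq a 0; first by rewrite mul0r.
by rewrite -(ler_pM2l (_ : 0 < a)) ?lt_def ?a1//; nra.
Qed.

(** The Frobenius norm bounds the set defining [opnorm], so its [sup] is a true supremum and not a
    default value; homogeneity then passes from the unit ball to all vectors. *)
Lemma opnorm_opbound p (M : 'M[R]_p) : opbound M (opnorm M).
Proof.
pose F := \sum_i \sum_j M i j ^+ 2.
have Mrow v i : (M *m v) i 0 ^+ 2 <= (\sum_j M i j ^+ 2) * dotv v v.
  have -> : (M *m v) i 0 = dotv (row i M)^T v.
    by rewrite mxE; apply: eq_bigr => j _; rewrite !mxE.
  apply: (le_trans (dotv_CS _ _)); rewrite ler_wpM2r ?dotv_ge0//.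
  by apply: ler_sum => j _; rewrite !mxE -expr2.
have MF v : enorm (M *m v) <= Num.sqrt F * enorm v.
  rewrite enormE [enorm v]enormE -sqrtrM; last first.
    by apply: sumr_ge0 => i _; apply: sumr_ge0 => j _; exact: sqr_ge0.
  rewrite ler_wsqrtr // mulr_suml; apply: ler_sum => i _.
  by rewrite -expr2 Mrow.
have ub : has_ubound [set enorm (M *m v) | v in [set v : 'cV[R]_p | enorm v <= 1]].
  exists (Num.sqrt F) => _ [v /= v1 <-]; apply: (le_trans (MF v)).
  by rewrite -[leRHS]mulr1 ler_wpM2l ?sqrtr_ge0.
have o0 : 0 <= opnorm M.
  apply: (ub_le_sup ub); exists 0 => /=; first by rewrite enorm0.
  by rewrite mulmx0 enorm0.
split=> // v; have [->|v0] := eqVneq v 0; first by rewrite mulmx0 enorm0 mulr0.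
have n0 : 0 < enorm v by rewrite enormE sqrtr_gt0 dotv_gt0.
rewrite -ler_pdivrMr // mulrC -[X in X * _]ger0_norm ?invr_ge0 ?enorm_ge0//.
rewrite -enormZ scalemxAr; apply: (ub_le_sup ub).
exists ((enorm v)^-1 *: v) => //=.
by rewrite enormZ ger0_norm ?invr_ge0 ?enorm_ge0// mulVf ?gt_eqF.
Qed.

Lemma opnorm_le p (M : 'M[R]_p) c : opbound M c -> opnorm M <= c.
Proof.
move=> [c0 Mc]; apply: ge_sup.
  by exists (enorm (M *m 0)), 0 => //=; rewrite enorm0.
move=> _ [v /= v1 <-]; apply: (le_trans (Mc v)).
by rewrite -[leRHS]mulr1 ler_wpM2l.
Qed.

(** With B = Q^{1/2}, the trace of M Q is that of B M B, whose diagonal entries are the values of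
    the form M at the columns of B. *)
Lemma ler_trace_psd p (M N Q : 'M[R]_p) : possemidefmx Q ->
  (forall v, dotv v (M *m v) <= dotv v (N *m v)) ->
  \tr (M *m Q) <= \tr (N *m Q).
Proof.
move=> pQ h; rewrite -(mxsqrt_sq pQ) !mulmxA.
rewrite mxtrace_mulC [leRHS]mxtrace_mulC !mulmxA.
by apply: ler_sum => i _; rewrite -{1 3}(tr_mxsqrt pQ) !quad_col.
Qed.

Lemma mxtrace_psd_ge0 p (M Q : 'M[R]_p) : possemidefmx M -> possemidefmx Q ->
  0 <= \tr (M *m Q).
Proof.
move=> pM pQ; rewrite -(mxtrace0 R p) -(mul0mx _ Q).
by apply: ler_trace_psd => // v; rewrite mul0mx dotv0r psd_quad.
Qed.

Lemma char_poly_spectral p (A U : 'M[R]_p) (d : 'rV[R]_p) :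
  U *m U^T = 1%:M -> A = U *m diag_mx d *m U^T ->
  char_poly A = \prod_(i < p) ('X - (d 0 i)%:P).
Proof.
move=> UU AE; transitivity (char_poly (diag_mx d)); last first.
  rewrite char_poly_trig ?diag_mx_is_trig//.
  by apply: eq_bigr => i _; rewrite mxE eqxx.
rewrite /char_poly.
have UU1 : map_mx polyC U *m map_mx polyC U^T = 1%:M by rewrite -map_mxM UU map_mx1.
have -> : char_poly_mx A = map_mx polyC U *m char_poly_mx (diag_mx d) *m map_mx polyC U^T.
  rewrite /char_poly_mx mulmxBr mulmxBl -!map_mxM -AE; congr (_ - _).
  by rewrite mul_mx_scalar -scalemxAl UU1 scalemx1.
rewrite !det_mulmx mulrAC -det_mulmx UU1 det1 mul1r //.
Qed.

(** A product of monic linear factors determines its roots up to order, so the choice made by [xget]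
    in [eigenvalues] does not matter. *)
Lemma eigenvalues_spectral p (A U : 'M[R]_p) (d : 'rV[R]_p) :
  U *m U^T = 1%:M -> A = U *m diag_mx d *m U^T ->
  perm_eq (eigenvalues A) [seq d 0 i | i <- enum 'I_p].
Proof.
move=> UU AE; apply: prod_XsubC_eq.
have cA : char_poly A = \prod_(a <- [seq d 0 i | i <- enum 'I_p]) ('X - a%:P).
  by rewrite (char_poly_spectral UU AE) big_map big_enum.
rewrite -cA; symmetry.
exact: (@xgetPex _ [::] [set s | char_poly A = \prod_(a <- s) ('X - a%:P)] (ex_intro _ _ cA)).
Qed.

End PositiveMatrices.

(** * Resolvents and the leave-one-out expansion *)

Section GeneralizedResolvent.
Context {R : realType}.

(** With B = A^{1/2}, B S B + lambda = B (S + lambda A^-1) B. All later estimates use the right-hand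
    side, free of square roots. *)
Lemma resolventE p (lambda : R) (A S : 'M[R]_p) :
  0 < lambda -> posdefmx A -> possemidefmx S ->
  mxsqrt A *m resolvent lambda A S *m mxsqrt A
    = invmx (S + lambda *: invmx A).
Proof.
move=> l0 pA pS; pose B := mxsqrt A.
have uB : B \in unitmx := mxsqrt_unitmx pA.
have BB : B *m B = A := mxsqrt_sq (posdef_psd pA).
pose M := S + lambda *: invmx A.
have uM : M \in unitmx by apply/posdef_unitmx/posdefD => //; exact/posdefZ/posdef_inv.
have iA : B *m invmx A *m B = 1%:M.
  have h : B *m (B *m invmx A) = 1%:M by rewrite mulmxA BB mulmxV ?posdef_unitmx.
  by rewrite -[B *m _](mulKmx uB) h mulmx1 mulVmx.
have BMB : twist A S + lambda%:M = B *m M *m B.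
  rewrite /M mulmxDr mulmxDl /twist; congr (_ + _).
  by rewrite -scalemxAr -scalemxAl iA scalemx1.
rewrite /resolvent BMB.
have -> : invmx (B *m M *m B) = invmx B *m invmx M *m invmx B.
  have u : B *m M *m B \in unitmx by rewrite !unitmx_mul uB uM.
  rewrite -[RHS](mulKmx u) -[LHS]mulmx1; congr (_ *m _).
  by rewrite -!mulmxA (mulmxA B (invmx B)) mulmxV // mul1mx (mulmxA M) mulmxV // mul1mx mulmxV.
by rewrite !mulmxA mulmxV // mul1mx -mulmxA mulVmx // mulmx1.
Qed.

Lemma invmxB p (A B : 'M[R]_p) : A \in unitmx -> B \in unitmx ->
  invmx A - invmx B = invmx A *m (B - A) *m invmx B.
Proof.
by move=> uA uB; rewrite mulmxBr mulmxBl mulmxK // mulVmx // mul1mx.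
Qed.

Lemma psd_sample_cov n p (X : 'M[R]_(n, p)) : possemidefmx (sample_cov X).
Proof. by apply: psdZ (psd_gram X); rewrite invr_ge0. Qed.

Lemma mxtraceB p (A B : 'M[R]_p) : \tr A - \tr B = \tr (A - B).
Proof. by rewrite raddfB. Qed.

Lemma mxtrace_outer p (A : 'M[R]_p) (u v : 'cV[R]_p) :
  \tr (A *m (u *m v^T)) = dotv v (A *m u).
Proof. by rewrite mulmxA mxtrace_mulC dotvE mulmxA /mxtrace big_ord1. Qed.

(** By cyclicity each variance term is the trace of Sigma times (hatSigma + lambda C^-1)^-1. The
    resolvent identity gives the difference, and the square roots are then put back around each
    resolvent. *)
Lemma variance_term_diff n p (sigma lambda : R) (Sigma A B : 'M[R]_p)
    (X : 'M[R]_(n, p)) :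
  0 < lambda -> posdefmx A -> posdefmx B ->
  variance_term sigma lambda Sigma X A - variance_term sigma lambda Sigma X B
  = - (lambda * sigma ^+ 2) / n%:R *
    \tr (mxsqrt B *m Sigma *m mxsqrt A *m resolvent lambda A (sample_cov X)
         *m mxsqrt A *m (invmx A - invmx B) *m mxsqrt B
         *m resolvent lambda B (sample_cov X)).
Proof.
move=> l0 pA pB; set S := sample_cov X; have pS : possemidefmx S := psd_sample_cov X.
have vE C : posdefmx C -> variance_term sigma lambda Sigma X C
    = sigma ^+ 2 / n%:R * \tr (Sigma *m invmx (S + lambda *: invmx C)).
  move=> pC; rewrite -resolventE // /variance_term /twist -/S; congr (_ * _).
  by rewrite -!mulmxA mxtrace_mulC !mulmxA.
rewrite !vE // -mulrBr.
rewrite mxtraceB -mulmxBr.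
have uM C : posdefmx C -> S + lambda *: invmx C \in unitmx.
  by move=> pC; apply/posdef_unitmx/posdefD => //; exact/posdefZ/posdef_inv.
rewrite (invmxB (uM A pA) (uM B pB)).
have -> : S + lambda *: invmx B - (S + lambda *: invmx A)
    = - lambda *: (invmx A - invmx B).
  by rewrite opprD addrACA subrr add0r -scalerBr -opprB scalerN scaleNr.
rewrite -!resolventE // -/S -!scalemxAr -scalemxAl -scalemxAr mxtraceZ mulrA.
congr (_ * _); first by ring.
set RA := resolvent _ _ _; set RB := resolvent _ _ _.
by rewrite !mulmxA mxtrace_mulC !mulmxA.
Qed.

(** Everything follows from (A + c x x^T) y = (1 + b) x for y = A^-1 x. *)
Lemma sherman_morrison p (A : 'M[R]_p) (x : 'cV[R]_p) c : posdefmx A -> 0 <= c ->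
  let b := c * dotv x (invmx A *m x) in
  let Q := invmx (A + c *: (x *m x^T)) in
  [/\ 0 <= b, (1 + b) *: (Q *m x) = invmx A *m x &
      invmx A - Q = (c / (1 + b)) *: (invmx A *m x *m (invmx A *m x)^T)].
Proof.
move=> pA c0 b Q; set y := invmx A *m x.
have uA := posdef_unitmx pA.
have b0 : 0 <= b by apply: mulr_ge0 => //; exact/psd_quad/posdef_psd/posdef_inv.
have pM : posdefmx (A + c *: (x *m x^T)).
  rewrite addrC; apply: posdefD => //; apply: psdZ => //.
  by rewrite -{1}(trmxK x); exact: psd_gram.
have uM := posdef_unitmx pM.
have My : (A + c *: (x *m x^T)) *m y = (1 + b) *: x.
  rewrite mulmxDl /y mulKVmx // -scalemxAl -mulmxA.
  have -> : x^T *m (invmx A *m x) = (dotv x (invmx A *m x))%:M.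
    by rewrite dotvE [LHS]mx11_scalar.
  by rewrite mul_mx_scalar scalerA scalerDl scale1r.
have Qx : (1 + b) *: (Q *m x) = y by rewrite scalemxAr -My /Q mulKmx.
have b1 : 1 + b != 0 by rewrite gt_eqF // ltr_pwDl.
split=> //.
rewrite -opprB -/Q invmxB // opprD addNKr mulmxN mulNmx opprK.
have yT : y^T = x^T *m invmx A by rewrite trmx_mul trmx_inv pA.1.
rewrite yT -scalemxAr -scalemxAl mulmxA -Qx -!scalemxAl -!mulmxA scalerA.
by rewrite -mulrA mulVf // mulr1.
Qed.

End GeneralizedResolvent.

(** * Leave-one-out expansion and the approximate fixed-point equation *)

Section LeaveOneOut.
Context {R : realType}.
Variables (n p : nat).
Implicit Types (X : 'M[R]_(n, p)) (S P Sigma : 'M[R]_p).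

(** Normalized by n although n - 1 rows remain, so that [sample_cov] is exactly a rank one update of
    it. *)
Definition loo_cov X (i : 'I_n) : 'M[R]_p :=
  n%:R^-1 *: \sum_(k < n | k != i) ((row k X)^T *m row k X).

Lemma sample_covE X (i : 'I_n) :
  sample_cov X = loo_cov X i + n%:R^-1 *: ((row i X)^T *m row i X).
Proof.
rewrite /sample_cov /loo_cov -scalerDr addrC; congr (_ *: _).
transitivity (\sum_(k < n) ((row k X)^T *m row k X)); last by rewrite (bigD1 i).
apply/matrixP => a b; rewrite mxE summxE; apply: eq_bigr => k _.
by rewrite !mxE big_ord1 !mxE.
Qed.

Lemma psd_loo_cov X i : possemidefmx (loo_cov X i).
Proof.
apply: psdZ; first by rewrite invr_ge0.
split.
  by rewrite linear_sum; apply: eq_bigr => k _ /=; rewrite trmx_mul trmxK.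
move=> v; rewrite mulmx_sumr mulmx_suml summxE sumr_ge0 // => k _.
by case: (psd_gram (row k X)).
Qed.

Variables (rho sbar t : R) (Sigma P : 'M[R]_p).
Hypotheses (rho0 : 0 < rho) (sbar0 : 0 < sbar) (t0 : 0 <= t).
Hypotheses (pSigma : possemidefmx Sigma) (pP : posdefmx P).
Hypothesis Sigma_le : forall v, dotv v (Sigma *m v) <= sbar * dotv v v.
Hypothesis P_ge : forall v, rho * dotv v v <= dotv v (P *m v).

(** The deterministic equivalent of the resolvent: passing from Q to Q_i divides the contribution of
    row x_i by 1 + x_i^T Q_i x_i / n, which is expected to be close to 1 + t. *)
Definition det_resolvent : 'M[R]_p := invmx ((1 + t)^-1 *: Sigma + P).
Local Notation K := det_resolvent.

Definition gen_resolvent X : 'M[R]_p := invmx (sample_cov X + P).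
Definition loo_resolvent X i : 'M[R]_p := invmx (loo_cov X i + P).
Local Notation Q := gen_resolvent.
Local Notation Qi := loo_resolvent.

Lemma posdef_addP S : possemidefmx S -> posdefmx (S + P).
Proof. by move=> pS; exact: posdefD. Qed.

Lemma opbound_invP S : possemidefmx S -> opbound (invmx (S + P)) rho^-1.
Proof.
move=> pS; apply: opbound_inv => //; first exact/posdef_unitmx/posdef_addP.
move=> v; apply: (le_trans (P_ge v)).
by rewrite mulmxDl dotvDr lerDr psd_quad.
Qed.

Lemma invP_quad S v : possemidefmx S ->
  dotv (invmx (S + P) *m v) (invmx (S + P) *m v)
    <= rho^-1 * dotv v (invmx (S + P) *m v).
Proof.
move=> pS; set w := invmx _ *m v.
have -> : v = (S + P) *m w by rewrite /w mulKVmx //; exact/posdef_unitmx/posdef_addP.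
rewrite mulrC ler_pdivlMr // mulrC dotvC; apply: (le_trans (P_ge w)).
by rewrite mulmxDl dotvDr lerDr psd_quad.
Qed.

Let ratio := sbar / (sbar + rho).

Lemma det_psd : possemidefmx ((1 + t)^-1 *: Sigma).
Proof. by apply: psdZ => //; rewrite invr_ge0 addr_ge0. Qed.

Lemma posdef_det : posdefmx K.
Proof. exact/posdef_inv/posdef_addP/det_psd. Qed.

(** For x = K Sigma v, the left side is e = <x, K^-1 x> = <v, Sigma x>. Since P dominates (rho /
    sbar) Sigma, <x, Sigma x> is at most ratio (1 + t) e, and Cauchy-Schwarz for Sigma between v and
    x gives the claim after division by e. *)
Lemma det_contraction v :
  dotv v (Sigma *m K *m Sigma *m v) <= ratio * (1 + t) * dotv v (Sigma *m v).
Proof.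
pose M := (1 + t)^-1 *: Sigma + P.
have pM : posdefmx M := posdef_addP det_psd.
set x := K *m (Sigma *m v).
have Mx : Sigma *m v = M *m x by rewrite /x mulKVmx // posdef_unitmx.
have -> : dotv v (Sigma *m K *m Sigma *m v) = dotv x (M *m x).
  by rewrite -Mx -!mulmxA -/x dotv_mulr pSigma.1 dotvC.
set e := dotv x (M *m x).
have e0 : 0 <= e by exact/psd_quad/posdef_psd.
have eE : e = dotv v (Sigma *m x) by rewrite /e -Mx dotvC dotv_mull pSigma.1.
have Sx : dotv x (Sigma *m x) <= ratio * (1 + t) * e.
  have h1 := Sigma_le x; have h2 := P_ge x.
  rewrite /e /M mulmxDl dotvDr -scalemxAl dotvZr.
  set a := dotv x (Sigma *m x) in h1 *; set b := dotv x (P *m x) in h2 *.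
  set d := dotv x x in h1 h2.
  have t1 : 0 < 1 + t by rewrite ltr_pwDl.
  have sr : 0 < sbar + rho by rewrite addr_gt0.
  rewrite /ratio -(ler_pM2l sr).
  have -> : (sbar + rho) * (sbar / (sbar + rho) * (1 + t) * ((1 + t)^-1 * a + b))
      = sbar * a + sbar * (1 + t) * b by field; rewrite !gt_eqF.
  have hb : rho * a <= sbar * b.
    by have := ler_wpM2l (ltW rho0) h1; have := ler_wpM2l (ltW sbar0) h2; lra.
  have b0 : 0 <= b by exact/psd_quad/posdef_psd.
  have : 0 <= sbar * t * b by rewrite !mulr_ge0 // ltW.
  lra.
have CS := psd_CS v x pSigma; rewrite -eE in CS.
have [->|e1] := eqVneq e 0.
  rewrite mulr_ge0 ?psd_quad // mulr_ge0 // ?addr_ge0 //.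
  by rewrite divr_ge0 ?addr_ge0 // ltW.
have e2 : 0 < e by rewrite lt_def e1.
rewrite -(ler_pM2r e2) -expr2; apply: (le_trans CS).
rewrite [leRHS](_ : _ = dotv v (Sigma *m v) * (ratio * (1 + t) * e)); last by ring.
by rewrite ler_wpM2l ?psd_quad.
Qed.

(* Written Q_i for the leave-one-out resolvent and x_i for the i-th row, the
   diagonal terms of the expansion involve x_i^T Q_i Sigma K x_i / n and
   x_i^T Q_i x_i / n; quad_dev is the mean square of their deviations from the
   traces that replace them. *)
Definition quad_a X i : R :=
  n%:R^-1 * dotv (row i X)^T (Qi X i *m Sigma *m K *m (row i X)^T).
Definition tr_a X i : R := n%:R^-1 * \tr (Sigma *m Qi X i *m Sigma *m K).
Definition quad_b X i : R := n%:R^-1 * dotv (row i X)^T (Qi X i *m (row i X)^T).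
Definition tr_b X i : R := n%:R^-1 * \tr (Sigma *m Qi X i).

Definition quad_dev X : R :=
  n%:R^-1 * \sum_(i < n) ((quad_a X i - tr_a X i) ^+ 2 + (quad_b X i - tr_b X i) ^+ 2).

Let phi X := n%:R^-1 * \tr (Sigma *m Q X).
Let alpha X := n%:R^-1 * \tr (Sigma *m K *m Sigma *m Q X).
Let resid := n%:R^-1 * \tr (Sigma *m K) - t.

Hypothesis n0 : (0 < n)%N.
Let nV0 : 0 <= n%:R^-1 :> R. Proof. by rewrite invr_ge0. Qed.

Lemma psd_Q X : possemidefmx (Q X).
Proof. exact/posdef_psd/posdef_inv/posdef_addP/psd_sample_cov. Qed.

Lemma psd_Qi X i : possemidefmx (Qi X i).
Proof. exact/posdef_psd/posdef_inv/posdef_addP/psd_loo_cov. Qed.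

Lemma quad_b_ge0 X i : 0 <= quad_b X i.
Proof. by rewrite mulr_ge0 //; exact/psd_quad/psd_Qi. Qed.

Lemma rank_one X i :
  (1 + quad_b X i) *: (Q X *m (row i X)^T) = Qi X i *m (row i X)^T /\
  Qi X i - Q X = (n%:R^-1 / (1 + quad_b X i)) *:
    (Qi X i *m (row i X)^T *m (Qi X i *m (row i X)^T)^T).
Proof.
have [_ h1 h2] := sherman_morrison (row i X)^T (posdef_addP (psd_loo_cov X i)) nV0.
by move: h1 h2; rewrite trmxK addrAC -sample_covE.
Qed.

(** Q_i - Q is positive of rank one, along y = Q_i x_i. As |y|^2 <= <x_i, y> / rho, its trace
    against M is at most (m / rho) b / (1 + b) with b = [quad_b X i]; the denominator absorbs the
    size of the row, so the bound is uniform. *)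
Lemma loo_trace X i (M : 'M[R]_p) m : 0 <= m -> possemidefmx M ->
  (forall v, dotv v (M *m v) <= m * dotv v v) ->
  0 <= \tr (M *m Qi X i) - \tr (M *m Q X) <= m / rho.
Proof.
move=> m0 pM Mm; have b0 := quad_b_ge0 X i.
have [_ h] := rank_one X i.
rewrite mxtraceB -mulmxBr h -scalemxAr mxtraceZ mxtrace_outer.
set y := Qi X i *m (row i X)^T.
have b1 : 0 < 1 + quad_b X i by rewrite ltr_pwDl.
rewrite mulr_ge0 ?psd_quad ?divr_ge0 ?(ltW b1) //=.
have h1 : dotv y y <= rho^-1 * dotv (row i X)^T y by exact/invP_quad/psd_loo_cov.
have h2 := Mm y.
rewrite mulrAC ler_pdivrMr //.
apply: (@le_trans _ _ (n%:R^-1 * (m * (rho^-1 * dotv (row i X)^T y)))).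
  rewrite ler_wpM2l //; apply: (le_trans h2); by rewrite ler_wpM2l.
have -> : n%:R^-1 * (m * (rho^-1 * dotv (row i X)^T y)) = m / rho * quad_b X i.
  by rewrite /quad_b -/y; ring.
by rewrite ler_wpM2l ?lerDr // divr_ge0 // ltW.
Qed.

Lemma phi_ge0 X : 0 <= phi X.
Proof. by rewrite mulr_ge0 //; exact/mxtrace_psd_ge0/psd_Q. Qed.

Lemma phi_le X : phi X <= p%:R / n%:R * (sbar / rho).
Proof.
rewrite /phi [leRHS]mulrAC [leRHS]mulrC ler_wpM2l //.
have op : opbound (Sigma *m Q X) (sbar / rho).
  by apply: opboundM; [apply: opbound_psd (ltW sbar0) _ _|exact/opbound_invP/psd_sample_cov].
exact: (le_trans (ler_norm _) (opbound_trace op)).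
Qed.

Lemma psd_SKS : possemidefmx (Sigma *m K *m Sigma).
Proof.
split; first by rewrite !trmx_mul pSigma.1 posdef_det.1 mulmxA.
move=> v; rewrite quadE -!mulmxA dotv_mulr pSigma.1.
exact/psd_quad/posdef_psd/posdef_det.
Qed.

Lemma ratio01 : 0 <= ratio < 1.
Proof.
by rewrite /ratio divr_ge0 ?addr_ge0 ?(ltW sbar0) ?(ltW rho0) //= ltr_pdivrMr ?mul1r ?ltrDl // addr_gt0.
Qed.

Lemma alpha_ge0 X : 0 <= alpha X.
Proof. by rewrite mulr_ge0 //; apply: mxtrace_psd_ge0; [exact: psd_SKS|exact: psd_Q]. Qed.

Lemma alpha_le X : alpha X <= ratio * (1 + t) * phi X.
Proof.
rewrite /alpha /phi mulrCA ler_wpM2l // -mxtraceZ scalemxAl.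
apply: ler_trace_psd (psd_Q X) _ => v.
by rewrite -scalemxAl dotvZr; exact: det_contraction.
Qed.

(** The resolvent identity for Q - K. In the part coming from hatSigma the rows are treated one at a
    time, and Q x_i = Q_i x_i / (1 + b_i) replaces Q, which depends on x_i, by Q_i, which does
    not. *)
Lemma trace_expansion X :
  phi X - n%:R^-1 * \tr (Sigma *m K)
  = alpha X / (1 + t) - n%:R^-1 * \sum_(i < n) quad_a X i / (1 + quad_b X i).
Proof.
pose M := (1 + t)^-1 *: Sigma + P.
have uM : M \in unitmx by exact/posdef_unitmx/posdef_addP/det_psd.
have uN : sample_cov X + P \in unitmx by exact/posdef_unitmx/posdef_addP/psd_sample_cov.
rewrite /phi -mulrBr mxtraceB -mulmxBr.
have -> : Q X - K = K *m ((1 + t)^-1 *: Sigma - sample_cov X) *m Q X.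
  rewrite -opprB /K (invmxB uM uN) -mulNmx -mulmxN opprB.
  by rewrite /M opprD addrACA subrr addr0.
rewrite !mulmxA [Sigma *m K *m (_ - _)]mulmxBr mulmxBl -mxtraceB mulrBr -scalemxAr -scalemxAl mxtraceZ.
congr (_ - _); first by rewrite /alpha; ring.
congr (_ * _); rewrite /sample_cov -scalemxAr -scalemxAl mxtraceZ.
have -> : X^T *m X = \sum_(k < n) ((row k X)^T *m row k X).
  apply/matrixP => a b; rewrite mxE summxE; apply: eq_bigr => k _.
  by rewrite !mxE big_ord1 !mxE.
rewrite mulmx_sumr mulmx_suml raddf_sum mulr_sumr; apply: eq_bigr => i _ /=.
have [h _] := rank_one X i; have b0 := quad_b_ge0 X i.
have b1 : 1 + quad_b X i != 0 by rewrite gt_eqF // ltr_pwDl.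
pose x := (row i X)^T; have rx : row i X = x^T by rewrite /x trmxK.
rewrite mxtrace_mulC mulmxA rx trmxK mxtrace_outer /quad_a -/x.
have -> : Q X *m (Sigma *m K) *m x = Q X *m (Sigma *m K *m x) by rewrite !mulmxA.
rewrite dotv_mulr (psd_Q X).1.
have -> : Q X *m x = (1 + quad_b X i)^-1 *: (Qi X i *m x).
  by rewrite -h scalerA mulVf // scale1r.
rewrite dotvZl -[in dotv (Qi X i *m x) _](psd_Qi X i).1 -dotv_mulr !mulmxA.
by rewrite mulrA mulrAC.
Qed.

(* The error phi - t is multiplied by alpha / ((1 + t) (1 + phi)) <= ratio < 1,
   so the fixed-point equation is stable uniformly in the dimension. *)
Lemma fixed_point_bound X eps : 0 < eps -> quad_dev X <= eps ^+ 2 ->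
  `|phi X - t| <= (sbar + rho) / rho *
    (`|resid| + (1 + t) * (1 + p%:R / n%:R * (sbar / rho)) * (sbar / rho) / n%:R
     + (1 + (1 + t) * (p%:R / n%:R * (sbar / rho))) * (eps *+ 2)).
Proof.
move=> e0 We; set phibar := p%:R / n%:R * (sbar / rho).
have t1 : 0 < 1 + t by rewrite ltr_pwDl.
have n1 : 0 < n%:R :> R by rewrite ltr0n.
have f0 := phi_ge0 X; have f1 := phi_le X; have al0 := alpha_ge0 X.
have al1 := alpha_le X; have /andP[r0 r1] := ratio01.
have sr0 : 0 <= sbar / rho by rewrite divr_ge0 // ltW.
have fb0 : 0 <= phibar by rewrite mulr_ge0 // mulr_ge0.
have al2 : alpha X <= (1 + t) * phibar.
  apply: (le_trans al1); rewrite mulrAC mulrC ler_wpM2l ?(ltW t1)//.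
  by apply: (le_trans _ f1); rewrite ler_piMl // ltW.
(* E is the cost of replacing each [quad_a] by [alpha] and each [quad_b] by [phi]. Once this is
   isolated, alpha (1 / (1 + t) - 1 / (1 + phi)) is a multiple of phi - t, which is the feedback
   term of [EE]. *)
pose E := n%:R^-1 * \sum_(i < n) (alpha X / (1 + phi X) - quad_a X i / (1 + quad_b X i)).
have EE : phi X - t = resid + alpha X / (1 + t) * ((phi X - t) / (1 + phi X)) + E.
  have -> : E = alpha X / (1 + phi X)
      - n%:R^-1 * \sum_(i < n) quad_a X i / (1 + quad_b X i).
    rewrite /E sumrB mulrBr sumr_const card_ord -[X in _ * X - _]mulr_natl mulrA mulVf ?mul1r//.
    by rewrite gt_eqF.
  have := trace_expansion X; rewrite /resid.
  set U := n%:R^-1 * \tr _; set V := n%:R^-1 * \sum_(_ < _) _ => h.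
  have -> : V = alpha X / (1 + t) - (phi X - U) by rewrite h; ring.
  by field; rewrite !gt_eqF // ltr_pwDl.
have contr : `|alpha X / (1 + t) * ((phi X - t) / (1 + phi X))|
    <= ratio * `|phi X - t|.
  have f1' : 0 < 1 + phi X by rewrite ltr_pwDl.
  have nrm (a b c d : R) : 0 <= a -> 0 < b -> 0 < d ->
      `|a / b * (c / d)| = a / b / d * `|c|.
    move=> a0 b0 d0; rewrite !normrM !normfV (ger0_norm a0) (gtr0_norm b0).
    by rewrite (gtr0_norm d0); ring.
  rewrite nrm //.
  rewrite ler_wpM2r // ler_pdivrMr ?ltr_pwDl// ler_pdivrMr //.
  apply: (le_trans al1); rewrite -mulrA [(1 + t) * _]mulrC mulrA.
  by rewrite ler_wpM2r ?(ltW t1)// ler_wpM2l // lerDr.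
pose B := (1 + t) * (1 + phibar) * (sbar / rho) / n%:R + (1 + (1 + t) * phibar) * (eps *+ 2).
have Ebound : `|E| <= B.
  have term i : `|alpha X / (1 + phi X) - quad_a X i / (1 + quad_b X i)|
     <= (1 + t) * (1 + phibar) * (sbar / rho) / n%:R
        + (1 + (1 + t) * phibar) * eps
        + (1 + (1 + t) * phibar) * (eps^-1 *
            ((quad_a X i - tr_a X i) ^+ 2 + (quad_b X i - tr_b X i) ^+ 2)).
    have b0 := quad_b_ge0 X i.
    have [da0 da1] : 0 <= tr_a X i - alpha X /\ tr_a X i - alpha X <= (1 + t) * (sbar / rho) / n%:R.
      rewrite /tr_a /alpha -mulrBr.
      have -> : \tr (Sigma *m Qi X i *m Sigma *m K) = \tr (Sigma *m K *m Sigma *m Qi X i).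
        by rewrite mxtrace_mulC !mulmxA mxtrace_mulC !mulmxA mxtrace_mulC !mulmxA.
      have /andP[h1 h2] : 0 <= \tr (Sigma *m K *m Sigma *m Qi X i) - \tr (Sigma *m K *m Sigma *m Q X)
           <= (1 + t) * sbar / rho.
        apply: loo_trace; [by rewrite mulr_ge0 // ltW|exact: psd_SKS|move=> v].
        apply: (le_trans (det_contraction v)).
        rewrite -mulrA -[leRHS]mulrA -[leRHS]mul1r; apply: ler_pM => //; last 2 first.
        - exact: ltW.
        - by rewrite ler_wpM2l // ltW.
        by rewrite mulr_ge0 ?psd_quad // ltW.
      split; first exact: mulr_ge0.
      by rewrite mulrC ler_wpM2r // mulrA.
    have [db0 db1] : 0 <= tr_b X i - phi X /\ tr_b X i - phi X <= (sbar / rho) / n%:R.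
      rewrite /tr_b /phi -mulrBr.
      have /andP[h1 h2] := loo_trace X i (ltW sbar0) pSigma Sigma_le.
      split; first exact: mulr_ge0.
      by rewrite mulrC ler_wpM2r.
    (* This trades absolute deviations for their squares, whose average is at most eps^2; each
       average deviation then costs 2 eps. *)
    have young (x : R) : `|x| <= eps + eps^-1 * x ^+ 2.
      rewrite -(ler_pM2l e0) mulrDr mulrA divff ?gt_eqF// mul1r.
      rewrite -[x ^+ 2]real_normK ?num_real//.
      by have := sqr_ge0 (eps - `|x|); have := sqr_ge0 `|x|; have := sqr_ge0 eps; nra.
    have -> : alpha X / (1 + phi X) - quad_a X i / (1 + quad_b X i)
      = - (quad_a X i - alpha X) / (1 + quad_b X i)
        + alpha X * (quad_b X i - phi X) / ((1 + phi X) * (1 + quad_b X i)).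
      by field; rewrite !gt_eqF // ltr_pwDl.
    have d1 (x y : R) : 1 <= y -> `|x / y| <= `|x|.
      move=> y1; rewrite normrM normfV ler_pdivrMr ?normr_gt0 ?gt_eqF ?(lt_le_trans ltr01)//.
      rewrite ler_peMr //; exact: (le_trans y1 (ler_norm _)).
    apply: (@le_trans _ _ (`|quad_a X i - alpha X| + (1 + t) * phibar * `|quad_b X i - phi X|)).
      apply: (le_trans (ler_normD _ _)); apply: lerD.
        by rewrite -(normrN (quad_a _ _ - _)); apply: d1; rewrite lerDl.
      apply: (le_trans (d1 _ _ _)); first by rewrite mulr_ege1 // lerDl.
      by rewrite normrM ler_wpM2r // ger0_norm.
    have ha : `|quad_a X i - alpha X| <= eps + eps^-1 * (quad_a X i - tr_a X i) ^+ 2 + (1 + t) * (sbar / rho) / n%:R.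
      apply: (le_trans (ler_distD (tr_a X i) _ _)).
      by rewrite [X in _ + X]ger0_norm //; apply: lerD => //; exact: young.
    have hb : `|quad_b X i - phi X| <= eps + eps^-1 * (quad_b X i - tr_b X i) ^+ 2 + (sbar / rho) / n%:R.
      apply: (le_trans (ler_distD (tr_b X i) _ _)).
      by rewrite [X in _ + X]ger0_norm //; apply: lerD => //; exact: young.
    have k0 : 0 <= (1 + t) * phibar by rewrite mulr_ge0 // ltW.
    apply: (le_trans (lerD ha (ler_wpM2l k0 hb))).
    have p1 : 0 <= (1 + t) * phibar * (eps^-1 * (quad_a X i - tr_a X i) ^+ 2).
      by rewrite mulr_ge0 // mulr_ge0 ?sqr_ge0 // invr_ge0 ltW.
    have p2 : 0 <= eps^-1 * (quad_b X i - tr_b X i) ^+ 2.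
      by rewrite mulr_ge0 ?sqr_ge0 // invr_ge0 ltW.
    set A1 := (quad_a X i - tr_a X i) ^+ 2 in p1 *.
    set A2 := (quad_b X i - tr_b X i) ^+ 2 in p2 *.
    rewrite -subr_ge0.
    set L := (X in 0 <= X); have -> : L = (1 + t) * phibar * (eps^-1 * A1) + eps^-1 * A2.
      by rewrite /L; ring.
    exact: addr_ge0.
  rewrite /E normrM ger0_norm //; rewrite mulrC ler_pdivrMr //.
  apply: (le_trans (ler_norm_sum _ _ _)).
  apply: (le_trans (ler_sum _ (fun i _ => term i))).
  rewrite big_split /= sumr_const card_ord -[X in X + _]mulr_natr -!mulr_sumr.
  set W1 := \sum_(i < n) _.
  have WE : W1 <= eps ^+ 2 * n%:R by move: We; rewrite /quad_dev mulrC ler_pdivrMr.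
  have : (1 + (1 + t) * phibar) * (eps^-1 * W1) <= (1 + (1 + t) * phibar) * eps * n%:R.
    rewrite -mulrA ler_wpM2l //; first by rewrite addr_ge0 // mulr_ge0 // ltW.
    by rewrite mulrC ler_pdivrMr // mulrAC -expr2.
  rewrite /B mulr2n => h; apply: (le_trans (lerD (lexx _) h)).
  by rewrite -mulrDl ler_wpM2r ?(ltW n1)//; lra.
have main : (1 - ratio) * `|phi X - t| <= `|resid| + B.
  rewrite mulrBl mul1r lerBlDr {1}EE.
  apply: (le_trans (ler_normD _ _)).
  apply: (@le_trans _ _ (`|resid| + ratio * `|phi X - t| + B)); last by lra.
  apply: lerD Ebound; apply: (le_trans (ler_normD _ _)).
  exact: lerD.
(* (sbar + rho) / rho is the inverse of 1 - ratio. *)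
have -> : `|phi X - t| = (sbar + rho) / rho * ((1 - ratio) * `|phi X - t|).
  by rewrite /ratio; field; rewrite !gt_eqF // addr_gt0.
rewrite -addrA ler_wpM2l // divr_ge0 ?addr_ge0 // ltW //.
Qed.

End LeaveOneOut.

Ltac nonneg := repeat first [done | by apply: ltW | apply: sqr_ge0 | apply: mulr_ge0
  | apply: addr_ge0 | apply: mulrn_wge0 | rewrite invr_ge0].

(** * The trace formula for the risk and its continuity in the plugged-in matrix *)

Section RiskFormula.
Context {R : realType}.

Definition ridge_resolvent n p (lambda : R) (A : 'M[R]_p) (X : 'M[R]_(n, p)) :=
  gen_resolvent (lambda *: invmx A) X.
Local Notation Q := ridge_resolvent.

(** The noise of the new response, the squared bias, and the variance. The bias matrix is I - Q
    hatSigma = lambda Q A^-1, averaged over coefficients of covariance Omega / p. *)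
Definition risk_formula n p (lambda sigma : R) (Sigma Omega A : 'M[R]_p)
    (X : 'M[R]_(n, p)) : R :=
  sigma ^+ 2
  + lambda ^+ 2 / p%:R * \tr (Sigma *m (Q lambda A X *m invmx A *m Omega *m invmx A *m Q lambda A X))
  + sigma ^+ 2 / n%:R * \tr (Sigma *m (Q lambda A X *m sample_cov X *m Q lambda A X)).

Definition trace_Q n p (lambda : R) (Sigma A : 'M[R]_p) (X : 'M[R]_(n, p)) : R :=
  n%:R^-1 * \tr (Sigma *m Q lambda A X).

Definition trace_QAQ n p (lambda : R) (Sigma A : 'M[R]_p) (X : 'M[R]_(n, p)) : R :=
  n%:R^-1 * \tr (Sigma *m (Q lambda A X *m invmx A *m Q lambda A X)).

Lemma ridge_unitmx n p (lambda : R) (A : 'M[R]_p) (X : 'M[R]_(n, p)) :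
  0 < lambda -> posdefmx A -> sample_cov X + lambda *: invmx A \in unitmx.
Proof.
move=> l0 pA; apply/posdef_unitmx/posdefD; first exact: psd_sample_cov.
exact/posdefZ/posdef_inv.
Qed.

Lemma tr_ridge_resolvent n p (lambda : R) (A : 'M[R]_p) (X : 'M[R]_(n, p)) :
  0 < lambda -> posdefmx A -> (Q lambda A X)^T = Q lambda A X.
Proof.
move=> l0 pA; apply: (posdef_inv _).1; apply: posdefD; first exact: psd_sample_cov.
exact/posdefZ/posdef_inv.
Qed.

Lemma ridge_QSQ n p (lambda : R) (A : 'M[R]_p) (X : 'M[R]_(n, p)) :
  0 < lambda -> posdefmx A ->
  Q lambda A X *m sample_cov X *m Q lambda A X
  = Q lambda A X - lambda *: (Q lambda A X *m invmx A *m Q lambda A X).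
Proof.
move=> l0 pA; have uM := ridge_unitmx X l0 pA.
have -> : sample_cov X = (sample_cov X + lambda *: invmx A) - lambda *: invmx A.
  by rewrite addrK.
rewrite mulmxBr mulmxBl {1}/Q /ridge_resolvent /gen_resolvent mulVmx // mul1mx.
by rewrite -scalemxAr -scalemxAl.
Qed.

Lemma risk_formula_Omega n p (lambda sigma : R) (Sigma Omega : 'M[R]_p)
    (X : 'M[R]_(n, p)) : (0 < n)%N -> (0 < p)%N ->
  0 < lambda -> posdefmx Omega ->
  risk_formula lambda sigma Sigma Omega Omega X
  = sigma ^+ 2 + sigma ^+ 2 * trace_Q lambda Sigma Omega X
    + lambda * (lambda * (n%:R / p%:R) - sigma ^+ 2) * trace_QAQ lambda Sigma Omega X.
Proof.
move=> n0 p0 l0 pO; rewrite /risk_formula ridge_QSQ //.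
have -> : Q lambda Omega X *m invmx Omega *m Omega *m invmx Omega *m Q lambda Omega X
    = Q lambda Omega X *m invmx Omega *m Q lambda Omega X.
  by rewrite mulmxKV // posdef_unitmx.
rewrite mulmxBr raddfB /= -scalemxAr mxtraceZ /trace_Q /trace_QAQ.
by field; rewrite !pnatr_eq0 -!lt0n n0 p0.
Qed.

Lemma opbound_mulB p (M M' N N' : 'M[R]_p) a b da db :
  opbound (M - M') da -> opbound (N - N') db -> opbound N b -> opbound M' a ->
  opbound (M *m N - M' *m N') (da * b + a * db).
Proof.
move=> hM hN hb ha.
have -> : M *m N - M' *m N' = (M - M') *m N + M' *m (N - N').
  by rewrite mulmxBl mulmxBr addrA subrK.
by apply: opboundD; exact: opboundM.
Qed.

(** Inversion reverses the order; here Cauchy-Schwarz for A between A w and w gives |A w|^2 <= c <w,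
    A w>, with v = A w. *)
Lemma inv_quad_ge p (A : 'M[R]_p) c v : 0 < c -> posdefmx A ->
  (forall v, dotv v (A *m v) <= c * dotv v v) ->
  c^-1 * dotv v v <= dotv v (invmx A *m v).
Proof.
move=> c0 pA hA; set w := invmx A *m v.
have vE : v = A *m w by rewrite /w mulKVmx // posdef_unitmx.
rewrite mulrC ler_pdivrMr // mulrC vE [in leRHS]dotvC.
have CS := psd_CS (A *m w) w (posdef_psd pA); rewrite expr2 in CS.
set a := dotv (A *m w) (A *m w) in CS *; set b := dotv w (A *m w) in CS *.
have h1 := hA (A *m w); rewrite -/a in h1.
have a0 : 0 <= a by exact: dotv_ge0.
have b0 : 0 <= b by exact/psd_quad/posdef_psd.
have [->|a1] := eqVneq a 0; first by rewrite mulr_ge0 // ltW.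
have a2 : 0 < a by rewrite lt_def a1.
rewrite -(ler_pM2l a2); apply: (le_trans CS).
by rewrite mulrA [a * c]mulrC ler_wpM2r.
Qed.

Lemma ridge_P_ge p (lambda c : R) (A : 'M[R]_p) v : 0 < lambda -> 0 < c ->
  posdefmx A -> (forall v, dotv v (A *m v) <= c * dotv v v) ->
  lambda / c * dotv v v <= dotv v ((lambda *: invmx A) *m v).
Proof.
move=> l0 c0 pA hA; rewrite -scalemxAl dotvZr -mulrA ler_wpM2l ?(ltW l0)//.
exact: inv_quad_ge.
Qed.

Lemma opbound_ridge n p (lambda c : R) (A : 'M[R]_p) (X : 'M[R]_(n, p)) :
  0 < lambda -> 0 < c -> posdefmx A ->
  (forall v, dotv v (A *m v) <= c * dotv v v) ->
  opbound (Q lambda A X) (c / lambda).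
Proof.
move=> l0 c0 pA hA.
rewrite -[c / lambda]invrK invfM invrK mulrC.
apply: opbound_invP (psd_sample_cov X); first exact: divr_gt0.
  exact/posdefZ/posdef_inv.
by move=> v; exact: ridge_P_ge.
Qed.

(* trace_QAQ is minus the derivative of trace_Q in lambda; the difference
   quotient has an error linear in h. *)
Lemma trace_Q_diff n p (lambda h c m s : R) (Sigma A : 'M[R]_p) (X : 'M[R]_(n, p)) :
  0 < lambda -> 0 < h -> 0 < c -> posdefmx A ->
  (forall v, dotv v (A *m v) <= c * dotv v v) ->
  opbound (invmx A) m -> opbound Sigma s ->
  `|trace_QAQ lambda Sigma A X
     - (trace_Q lambda Sigma A X - trace_Q (lambda + h) Sigma A X) / h|
  <= p%:R / n%:R * (s * (c / lambda * m * (h * (c / lambda * m * (c / lambda))))).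
Proof.
move=> l0 h0 c0 pA hA hm hs; have lh0 : 0 < lambda + h by exact: addr_gt0.
have QB : Q lambda A X - Q (lambda + h) A X
    = h *: (Q lambda A X *m invmx A *m Q (lambda + h) A X).
  rewrite /Q /ridge_resolvent /gen_resolvent.
  rewrite (invmxB (ridge_unitmx X l0 pA) (ridge_unitmx X lh0 pA)).
  rewrite opprD addrACA subrr add0r -scalerBl addrAC subrr add0r.
  by rewrite -scalemxAr -scalemxAl.
have b1 : opbound (Q lambda A X) (c / lambda) by exact: opbound_ridge.
have b2 : opbound (Q (lambda + h) A X) (c / lambda).
  apply: opbound_le (opbound_ridge X lh0 c0 pA hA) _.
  by rewrite ler_pM2l // lef_pV2 ?posrE // lerDl ltW.
have -> : (trace_Q lambda Sigma A X - trace_Q (lambda + h) Sigma A X) / h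
   = n%:R^-1 * \tr (Sigma *m (Q lambda A X *m invmx A *m Q (lambda + h) A X)).
  rewrite /trace_Q -mulrBr mxtraceB -mulmxBr QB -scalemxAr mxtraceZ.
  by rewrite mulrCA mulrAC divff ?mul1r // gt_eqF.
rewrite /trace_QAQ -mulrBr mxtraceB -mulmxBr -mulmxBr QB normrM ger0_norm ?invr_ge0//.
rewrite [leRHS]mulrAC [leRHS]mulrC ler_wpM2l ?invr_ge0//.
apply: opbound_trace; apply: opboundM => //.
apply: opboundM; first exact: opboundM.
rewrite -[X in X * _](gtr0_norm h0); apply: opboundZ.
by apply: opboundM => //; exact: opboundM.
Qed.

(** [kappa] is chosen before the dimensions. These enter through 1 + p / n alone, since the bias
    trace is divided by p, the variance trace by n, and either trace is at most p times an operator
    norm. *)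
Lemma risk_formula_perturb (lambda sigma m c s : R) :
  0 < lambda -> 0 < m -> 0 < c -> 0 <= s ->
  exists2 kappa : R, 0 <= kappa &
  forall n p (Sigma Omega A : 'M[R]_p) (X : 'M[R]_(n, p)) eta,
    opbound Sigma s -> posdefmx Omega -> posdefmx A ->
    opbound Omega c -> opbound (invmx Omega) m ->
    opbound (A - Omega) eta -> eta * m <= 2^-1 -> eta <= c ->
    `|risk_formula lambda sigma Sigma Omega A X
      - risk_formula lambda sigma Sigma Omega Omega X|
    <= kappa * (1 + p%:R / n%:R) * eta.
Proof.
move=> l0 m0 c0 s0.
(* [m *+ 2], [q] and [k] bound A^-1, Q and Q A^-1, the doubling leaving room for A near Omega. [eI],
   [eQ], [eD], [k1] and [k2] are Lipschitz constants for A^-1, Q, Q A^-1, the bias matrix and Q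
   hatSigma Q. *)
pose q := (c *+ 2) / lambda.
pose eI := m *+ 2 * m.
pose eQ := q * (lambda * eI) * q.
pose k := q * (m *+ 2).
pose eD := eQ * (m *+ 2) + q * eI.
pose k1 := (eD * c) * k + k * c * eD.
pose k2 := eQ + lambda * (eD * q + k * eQ).
have q0 : 0 <= q by rewrite /q; nonneg.
have eI0 : 0 <= eI by rewrite /eI; nonneg.
have eQ0 : 0 <= eQ by rewrite /eQ; nonneg.
have k0 : 0 <= k by rewrite /k; nonneg.
have eD0 : 0 <= eD by rewrite /eD; nonneg.
have k10 : 0 <= k1 by rewrite /k1; nonneg.
have k20 : 0 <= k2 by rewrite /k2; nonneg.
exists (lambda ^+ 2 * s * k1 + sigma ^+ 2 * s * k2); first by nonneg.
move=> n p Sigma Omega A X eta hS pO pA hO hOi hE em ec.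
have e0 : 0 <= eta by case: hE.
have hA : opbound A (c *+ 2).
  rewrite -[A](subrK Omega) mulr2n; apply: opboundD hO.
  exact: opbound_le hE ec.
(* The form of Omega is at least 1 / m, and a perturbation of norm at most 1 / (2 m) leaves at least
   1 / (2 m). *)
have Age v : (m^-1 / 2) * dotv v v <= dotv v (A *m v).
  have h1 : m^-1 * dotv v v <= dotv v (Omega *m v).
    rewrite -[in leRHS](invmxK Omega); apply: inv_quad_ge => //; first exact: posdef_inv.
    by move=> u; exact: opbound_quad.
  have h2 := opbound_quad v (opboundN hE).
  rewrite opprB mulmxBl dotvBr in h2.
  have h3 : eta * dotv v v <= m^-1 / 2 * dotv v v.
    by rewrite ler_wpM2r ?dotv_ge0// ler_pdivlMl // mulrC.
  by lra.
have hAi : opbound (invmx A) (m *+ 2).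
  rewrite -[m *+ 2]invrK; apply: opbound_inv.
  - by rewrite invr_gt0 pmulrn_lgt0.
  - exact: posdef_unitmx.
  move=> v; have -> : (m *+ 2)^-1 = m^-1 / 2 by rewrite -[m *+ 2]mulr_natr invfM.
  exact: Age.
have hI : opbound (invmx A - invmx Omega) (eI * eta).
  rewrite invmxB ?posdef_unitmx //.
  have -> : eI * eta = m *+ 2 * eta * m by rewrite /eI; ring.
  by apply: opboundM => //; apply: opboundM => //; rewrite -opprB; exact: opboundN.
have hQA : opbound (Q lambda A X) q.
  apply: opbound_ridge => //; first by rewrite pmulrn_lgt0.
  by move=> v; exact: opbound_quad.
have hQO : opbound (Q lambda Omega X) q.
  apply: opbound_ridge => //; first by rewrite pmulrn_lgt0.
  move=> v; apply: (le_trans (opbound_quad v hO)).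
  by rewrite ler_wpM2r ?dotv_ge0// mulr2n lerDl ltW.
have hQ : opbound (Q lambda A X - Q lambda Omega X) (eQ * eta).
  rewrite /Q /ridge_resolvent /gen_resolvent.
  rewrite (invmxB (ridge_unitmx X l0 pA) (ridge_unitmx X l0 pO)).
  have -> : eQ * eta = q * (`|lambda| * (eI * eta)) * q by rewrite gtr0_norm // /eQ; ring.
  apply: opboundM hQO; apply: opboundM hQA _.
  rewrite opprD addrACA subrr add0r -scalerBr -opprB scalerN.
  by apply/opboundN/opboundZ.
have hOi' : opbound (invmx Omega) (m *+ 2).
  by apply: opbound_le hOi _; rewrite mulr2n lerDl ltW.
pose DA := Q lambda A X *m invmx A; pose DO := Q lambda Omega X *m invmx Omega.
have hDA : opbound DA k by exact: opboundM.
have hDO : opbound DO k by exact: opboundM.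
have hD : opbound (DA - DO) (eD * eta).
  have -> : eD * eta = eQ * eta * (m *+ 2) + q * (eI * eta) by rewrite /eD; ring.
  exact: opbound_mulB.
have hDA' : opbound (invmx A *m Q lambda A X) k by rewrite /k mulrC; exact: opboundM.
have hD' : opbound (invmx A *m Q lambda A X - invmx Omega *m Q lambda Omega X) (eD * eta).
  have -> : eD * eta = eI * eta * q + (m *+ 2) * (eQ * eta) by rewrite /eD; ring.
  exact: opbound_mulB.
have hT1 : opbound (DA *m Omega *m (invmx A *m Q lambda A X)
    - DO *m Omega *m (invmx Omega *m Q lambda Omega X)) (k1 * eta).
  have -> : k1 * eta = eD * eta * c * k + k * c * (eD * eta) by rewrite /k1; ring.
  apply: opbound_mulB => //; last exact: opboundM.
  by rewrite -mulmxBl; exact: opboundM.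
have hT2 : opbound ((Q lambda A X - lambda *: (DA *m Q lambda A X))
    - (Q lambda Omega X - lambda *: (DO *m Q lambda Omega X))) (k2 * eta).
  rewrite opprB addrCA addrA -addrA [X in opbound X _](_ : _ =
    (Q lambda A X - Q lambda Omega X) - lambda *: (DA *m Q lambda A X - DO *m Q lambda Omega X)).
    have -> : k2 * eta = eQ * eta + `|lambda| * (eD * eta * q + k * (eQ * eta)).
      by rewrite gtr0_norm // /k2; ring.
    by apply: opboundB => //; apply: opboundZ; exact: opbound_mulB.
  by rewrite scalerBr opprB; apply/matrixP => i j; rewrite !mxE; ring.
have RE C : posdefmx C -> risk_formula lambda sigma Sigma Omega C X
  = sigma ^+ 2
    + lambda ^+ 2 / p%:R * \tr (Sigma *m (Q lambda C X *m invmx C *m Omega *m (invmx C *m Q lambda C X)))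
    + sigma ^+ 2 / n%:R * \tr (Sigma *m (Q lambda C X
        - lambda *: (Q lambda C X *m invmx C *m Q lambda C X))).
  by move=> pC; rewrite /risk_formula ridge_QSQ // !mulmxA.
have dE (a b1 b2 x1 y1 x2 y2 : R) : a + b1 * x1 + b2 * y1 - (a + b1 * x2 + b2 * y2)
  = b1 * (x1 - x2) + b2 * (y1 - y2) by ring.
rewrite !RE // -/DA -/DO dE !mxtraceB -!mulmxBr.
have t1 := opbound_trace (opboundM hS hT1).
have t2 := opbound_trace (opboundM hS hT2).
apply: (le_trans (ler_normD _ _)).
have nrm (a b : R) : 0 <= a -> `|a * b| = a * `|b|.
  by move=> a0; rewrite normrM ger0_norm.
rewrite [`|lambda ^+ 2 / _ * _|]nrm; last by nonneg.
rewrite [`|sigma ^+ 2 / _ * _|]nrm; last by nonneg.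
(* An inequality, because for p = 0 the inverse is 0 and the product is 0. *)
have pp : p%:R^-1 * p%:R <= 1 :> R.
  by have [->|p0] := eqVneq (p%:R : R) 0; rewrite ?mulr0 // mulVf.
apply: (@le_trans _ _ (lambda ^+ 2 * s * k1 * eta + sigma ^+ 2 * s * k2 * (p%:R / n%:R) * eta)).
  apply: lerD.
    apply: (@le_trans _ _ (lambda ^+ 2 / p%:R * (p%:R * (s * (k1 * eta))))).
      by rewrite ler_wpM2l // mulr_ge0 ?sqr_ge0 ?invr_ge0.
    have -> : lambda ^+ 2 / p%:R * (p%:R * (s * (k1 * eta)))
      = (lambda ^+ 2 * s * k1 * eta) * (p%:R^-1 * p%:R) by ring.
    by rewrite -[leRHS]mulr1 ler_wpM2l //; nonneg.
  apply: (@le_trans _ _ (sigma ^+ 2 / n%:R * (p%:R * (s * (k2 * eta))))).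
    by rewrite ler_wpM2l // mulr_ge0 ?sqr_ge0 ?invr_ge0.
  by rewrite le_eqVlt; apply/orP; left; apply/eqP; ring.
have pn : 0 <= p%:R / n%:R :> R by rewrite mulr_ge0 ?invr_ge0.
set a := lambda ^+ 2 * s * k1; set b := sigma ^+ 2 * s * k2.
have a0 : 0 <= a by rewrite /a; nonneg.
have b0 : 0 <= b by rewrite /b; nonneg.
rewrite -mulrDl ler_wpM2r //.
have : 0 <= a * (p%:R / n%:R) by exact: mulr_ge0.
by rewrite mulrDl !mulrDr !mulr1; lra.
Qed.

End RiskFormula.

(** * Independence and concentration *)

Section Independence.
Context {R : realType} {d : measure_display} {T : measurableType d}.
Variable P : probability T R.
Local Open Scope ereal_scope.

Definition independent2 (F G : set (set T)) : Prop :=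
  forall A B, F A -> G B -> P (A `&` B) = P A * P B.

Lemma independent2C F G : independent2 F G -> independent2 G F.
Proof. by move=> h A B GA FB; rewrite setIC muleC; exact: h. Qed.

(** For a fixed B, the sets A obeying the product rule form a Dynkin system; since F is stable under
    intersection, it contains the sigma-algebra generated by F. *)
Lemma independent2_gen_left (F G : set (set T)) :
  F `<=` measurable -> G `<=` measurable -> setI_closed F ->
  independent2 F G -> independent2 <<s F >> G.
Proof.
move=> mF mG FI h A B FA GB.
have mB : measurable B by exact: mG.
suff : [set A | measurable A /\ P (A `&` B) = P A * P B] A by case.
move: A FA; rewrite -setI_closed_g_dynkin_g_sigma_algebra //.
apply: smallest_sub; last by move=> A FA; split; [exact: mF|exact: h].
split.
- by split; [exact: measurableT|rewrite setTI probability_setT mul1e].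
- move=> A [mA AB]; split; first exact: measurableC.
  have fB : P B \is a fin_num by exact: fin_num_measure.
  have fA : P A \is a fin_num by exact: fin_num_measure.
  rewrite probability_setC //.
  have -> : (1 - P A) * P B = P B - P (A `&` B).
    by rewrite AB -(fineK fA) -(fineK fB) -EFinB -!EFinM -EFinB mulrBl mul1r.
  rewrite setIC -setDE measureD // ?ltey_eq ?fB //.
  by rewrite setIC.
- move=> A tA hA; split; first by apply: bigcup_measurable => k _; case: (hA k).
  have mA k : measurable (A k) by case: (hA k).
  rewrite setI_bigcupl measure_bigcup //; last 2 first.
  - by move=> k _; exact: measurableI.
  - exact: trivIset_setIr.
  rewrite measure_bigcup // -(fineK (fin_num_measure P B mB)) muleC -nneseriesZl //.
  by apply: eq_eseriesr => k _; rewrite fineK ?fin_num_measure // muleC; case: (hA k).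
Qed.

Lemma independent2_gen (F G : set (set T)) :
  F `<=` measurable -> G `<=` measurable -> setI_closed F -> setI_closed G ->
  independent2 F G -> independent2 <<s F >> <<s G >>.
Proof.
move=> mF mG FI GI h; apply: independent2_gen_left => //.
  by apply: smallest_sub => //; exact: sigma_algebra_measurable.
by apply: independent2C; apply: independent2_gen_left => //; exact: independent2C.
Qed.

Lemma independent2S (F G F' G' : set (set T)) :
  F' `<=` F -> G' `<=` G -> independent2 F G -> independent2 F' G'.
Proof. by move=> sF sG h A B /sF FA /sG GB; exact: h. Qed.

Variables (I : finType) (F : I -> set (set T)).
Hypothesis sF : forall i, sigma_algebra setT (F i).
Hypothesis mF : forall i, F i `<=` measurable.

Let FT i : F i setT.
Proof. by have [h0 hC _] := sF i; rewrite -(setD0 setT); exact: hC. Qed.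

Let FI i : setI_closed (F i).
Proof. by rewrite -(sigma_algebra_id (sF i)); exact: (@measurableI _ (g_sigma_algebraType (F i))). Qed.

(** An intersection-stable family generating the joint sigma-algebra of the F i with i in J.
    Indexing by all of I, with full sets off J, allows complementary cylinders to be intersected
    index by index. *)
Definition cylinders (J : pred I) : set (set T) :=
  [set \bigcap_i B i | B in [set B : I -> set T |
     forall i, F i (B i) /\ (~~ J i -> B i = setT)]].

Lemma cylinders_setI (J : pred I) : setI_closed (cylinders J).
Proof.
move=> _ _ [B /= hB <-] [C /= hC <-]; exists (fun i => B i `&` C i).
  move=> i; split; first by apply: FI; [case: (hB i)|case: (hC i)].
  by move=> Ji; rewrite (hB i).2 // (hC i).2 // setTI.
by rewrite -bigcapI.
Qed.

Lemma cylinders_measurable (J : pred I) : cylinders J `<=` measurable.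
Proof.
move=> _ [B /= hB <-]; apply: fin_bigcap_measurable; first exact: finite_finset.
by move=> i _; exact: (mF (hB i).1).
Qed.

(** In the intersection of a cylinder over J with one over its complement, each index carries at
    most one proper set, so the product rule for the whole family splits into two products.
    Generation does the rest. *)
Lemma independent2_group (J : pred I) : mutually_independent P F ->
  independent2 <<s \bigcup_(i in [set i | J i]) F i >>
               <<s \bigcup_(i in [set i | ~~ J i]) F i >>.
Proof.
move=> indF.
have sub (K : pred I) :
    <<s \bigcup_(i in [set i | K i]) F i >> `<=` <<s cylinders K >>.
  apply: smallest_sub; first exact: smallest_sigma_algebra.
  move=> A [i /= Ki FA]; apply: sub_sigma_algebra.
  exists (fun j => if j == i then A else setT).
    move=> j /=; case: eqVneq => [->|_]; split => //.
    by rewrite Ki.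
  apply/seteqP; split=> [w /(_ i)|w Aw j _ /=]; first by rewrite eqxx; apply.
  by case: eqP.
apply: (independent2S (sub J) (sub (fun i => ~~ J i))).
apply: independent2_gen; try exact: cylinders_measurable; try exact: cylinders_setI.
move=> _ _ [B /= hB <-] [C /= hC <-].
rewrite -bigcapI indF; last by move=> i; apply: FI; [case: (hB i)|case: (hC i)].
rewrite indF; last by move=> i; case: (hB i).
rewrite indF; last by move=> i; case: (hC i).
rewrite -big_split /=; apply: eq_bigr => i _.
have [Ji|Ji] := boolP (J i).
  by rewrite (hC i).2 ?Ji // setIT probability_setT mule1.
by rewrite (hB i).2 // setTI probability_setT mul1e.
Qed.

End Independence.

(** * Expectations of products of independent variables *)

Section ExpectationProduct.
Context {R : realType} {d : measure_display} {T : measurableType d}.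
Variable P : probability T R.

(** Measurability for the sigma-algebra generated by G, encoded as a change of the source type so
    that the closure properties of measurable functions apply as they are. *)
Definition sub_measurable (G : set (set T)) (f : T -> R) : Prop :=
  measurable_fun [set: g_sigma_algebraType G] (f : g_sigma_algebraType G -> R).

Lemma sub_measurableP G f : sub_measurable G f <-> sigma_rv f `<=` <<s G >>.
Proof.
split=> [mf _ [B mB <-]|mf _ B mB]; first exact: mf.
by apply: mf; exists B.
Qed.

Lemma sub_measurable_fun G f : G `<=` measurable -> sub_measurable G f ->
  measurable_fun [set: T] f.
Proof.
move=> mG mf _ B mB.
have : <<s G >> `<=` measurable.
  by apply: smallest_sub => //; exact: sigma_algebra_measurable.
by apply; exact: mf.
Qed.

Lemma sub_measurableS (G G' : set (set T)) f : <<s G >> `<=` <<s G' >> ->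
  sub_measurable G f -> sub_measurable G' f.
Proof. by move=> GG' mf _ B mB; apply: GG'; exact: mf. Qed.

Lemma sub_measurableM G f g : sub_measurable G f -> sub_measurable G g ->
  sub_measurable G (fun w => f w * g w).
Proof. exact: measurable_funM. Qed.

Lemma sub_measurableB G f g : sub_measurable G f -> sub_measurable G g ->
  sub_measurable G (fun w => f w - g w).
Proof. exact: measurable_funB. Qed.

Lemma sub_measurable_cst G a : sub_measurable G (fun=> a).
Proof. exact: measurable_cst. Qed.

Variables (F G : set (set T)).
Hypotheses (mF : F `<=` measurable) (mG : G `<=` measurable).
Hypothesis FG : independent2 P <<s F >> <<s G >>.

(** By uniqueness of product measures, the joint law of f and g is the product of their laws;
    Tonelli's theorem separates the integral. *)
Lemma independent2_expectationM_ge0 (f g : T -> R) :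
  sub_measurable F f -> sub_measurable G g ->
  (forall w, 0 <= f w) -> (forall w, 0 <= g w) ->
  (\int[P]_w (f w * g w)%:E = (\int[P]_w (f w)%:E) * (\int[P]_w (g w)%:E))%E.
Proof.
move=> sf sg f0 g0.
have mf := sub_measurable_fun mF sf; have mg := sub_measurable_fun mG sg.
have mfg : measurable_fun [set: T] (fun w => (f w, g w)) by exact: measurable_fun_pair.
pose X : {RV P >-> R} := HB.pack f (isMeasurableFun.Build _ _ _ _ _ mf).
pose Y : {RV P >-> R} := HB.pack g (isMeasurableFun.Build _ _ _ _ _ mg).
pose XY : {RV P >-> (R * R)%type} :=
  HB.pack (fun w => (f w, g w)) (isMeasurableFun.Build _ _ _ _ _ mfg).
(* The truncations at 0 make the integrand nonnegative on the whole plane, as Tonelli's theorem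
   requires; they change nothing at the values taken by f and g. *)
pose h (z : R * R) : \bar R := (Num.max z.1 0 * Num.max z.2 0)%:E.
have mh : measurable_fun [set: R * R] h.
  apply/measurable_EFinP; apply: measurable_funM.
    by apply: measurable_maxr => //; exact: measurable_fst.
  by apply: measurable_maxr => //; exact: measurable_snd.
have h0 z : (0 <= h z)%E by rewrite lee_fin mulr_ge0 // le_max lexx orbT.
have -> : (\int[P]_w (f w * g w)%:E = \int[distribution P XY]_z h z)%E.
  rewrite ge0_integral_distribution //; apply: eq_integral => w _ /=.
  by rewrite /h /= !max_l.
have -> : (\int[distribution P XY]_z h z
    = \int[(distribution P X \x distribution P Y)%E]_z h z)%E.
  apply: eq_measure_integral => A mA _; apply/esym.
  have := @product_measure_unique _ _ _ _ _ (distribution P X) (distribution P Y) (distribution P XY).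
  move=> h'; apply: h' => //.
  move=> B C mB mC; rewrite /distribution /pushforward /=.
  rewrite -FG; first by congr (P _).
    by rewrite -[_ @^-1` _]setTI; exact: sf.
  by rewrite -[_ @^-1` _]setTI; exact: sg.
rewrite fubini_tonelli1 // /fubini_F /=.
under eq_integral => x _.
  rewrite /h /=.
  under eq_integral do rewrite EFinM.
  rewrite ge0_integralZl_EFin //; last 3 first.
    by move=> y _; rewrite lee_fin le_max lexx orbT.
    by apply/measurable_EFinP; exact: measurable_maxr.
    by rewrite le_max lexx orbT.
  over.
rewrite ge0_integralZr //; last 3 first.
- by apply/measurable_EFinP; exact: measurable_maxr.
- by move=> x _; rewrite lee_fin le_max lexx orbT.
- by apply: integral_ge0 => x _; rewrite lee_fin le_max lexx orbT.
congr (_ * _)%E.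
- rewrite ge0_integral_distribution //.
  + by apply: eq_integral => w _ /=; rewrite max_l.
  + by apply/measurable_EFinP; exact: measurable_maxr.
  + by move=> x; rewrite lee_fin le_max lexx orbT.
- rewrite ge0_integral_distribution //.
  + by apply: eq_integral => w _ /=; rewrite max_l.
  + by apply/measurable_EFinP; exact: measurable_maxr.
  + by move=> x; rewrite lee_fin le_max lexx orbT.
Qed.

Definition L1 (f : T -> R) := P.-integrable [set: T] (EFin \o f).
Definition EE (f : T -> R) : R := fine (\int[P]_w (f w)%:E)%E.

Lemma EE_fin f : L1 f -> (\int[P]_w (f w)%:E)%E = (EE f)%:E.
Proof. by move=> If; rewrite /EE fineK //; exact: integrable_fin_num. Qed.

Lemma L1_ge0 (f : T -> R) : measurable_fun [set: T] f -> (forall w, 0 <= f w) ->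
  (\int[P]_w (f w)%:E < +oo)%E -> L1 f.
Proof.
move=> mf f0 h; apply/integrableP; split; first exact/measurable_EFinP.
rewrite (eq_integral (fun w => (f w)%:E)) // => w _ /=.
by rewrite ger0_norm.
Qed.

Lemma L1_measurable (f : T -> R) : L1 f -> measurable_fun [set: T] f.
Proof. by move/measurable_int/measurable_EFinP. Qed.

Lemma L1_le (f g : T -> R) : measurable_fun [set: T] f -> L1 g ->
  (forall w, `|f w| <= g w) -> L1 f.
Proof.
move=> mf Ig fg; apply: (le_integrable measurableT _ _ Ig).
  exact/measurable_EFinP.
by move=> w _ /=; rewrite lee_fin (le_trans (fg w)) // ler_norm.
Qed.

Lemma L1D f g : L1 f -> L1 g -> L1 (fun w => f w + g w).
Proof. by move=> If Ig; exact: (integrableD measurableT If Ig). Qed.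

Lemma L1Z a f : L1 f -> L1 (fun w => a * f w).
Proof. by move=> If; exact: (integrableZl measurableT a If). Qed.

Lemma L1B f g : L1 f -> L1 g -> L1 (fun w => f w - g w).
Proof. by move=> If Ig; exact: (integrableB measurableT If Ig). Qed.

Lemma L1_abs f : L1 f -> L1 (fun w => `|f w|).
Proof. by move=> If; exact: (integrable_norm If). Qed.

Lemma L1_cst a : L1 (fun=> a).
Proof. exact: finite_measure_integrable_cst. Qed.

Lemma L1_sum (J : Type) (s : seq J) (p : pred J) (f : J -> T -> R) :
  (forall j, p j -> L1 (f j)) -> L1 (fun w => \sum_(j <- s | p j) f j w).
Proof.
move=> If; have := integrable_sum measurableT s (h := fun j w => (f j w)%:E) If.
apply: eq_integrable => // w _; by rewrite /= sumEFin.
Qed.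

Lemma EED f g : L1 f -> L1 g -> EE (fun w => f w + g w) = EE f + EE g.
Proof.
move=> If Ig; apply: EFin_inj; rewrite EFinD -!EE_fin //; last exact: L1D.
by rewrite -integralD.
Qed.

Lemma EEZ a f : L1 f -> EE (fun w => a * f w) = a * EE f.
Proof.
move=> If; apply: EFin_inj; rewrite EFinM -!EE_fin //; last exact: L1Z.
by rewrite -integralZl.
Qed.

Lemma EEB f g : L1 f -> L1 g -> EE (fun w => f w - g w) = EE f - EE g.
Proof.
move=> If Ig; apply: EFin_inj; rewrite EFinB -!EE_fin //; last exact: L1B.
by rewrite -integralB.
Qed.

Lemma EE_cst a : EE (fun=> a) = a.
Proof.
apply: EFin_inj; rewrite -EE_fin; last exact: L1_cst.
transitivity (a%:E * P [set: T])%E; first exact: integral_cst.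
by rewrite probability_setT mule1.
Qed.

Lemma EE_sum (J : Type) (s : seq J) (p : pred J) (f : J -> T -> R) :
  (forall j, p j -> L1 (f j)) ->
  EE (fun w => \sum_(j <- s | p j) f j w) = \sum_(j <- s | p j) EE (f j).
Proof.
move=> If; elim: s => [|j s IH].
  rewrite big_nil -[RHS](EE_cst 0); congr EE; apply/funext => w.
  by rewrite big_nil.
rewrite big_cons; case: ifPn => pj; last first.
  rewrite -IH; congr EE; apply/funext => w.
  by rewrite big_cons (negbTE pj).
rewrite -IH -EED; [|exact: If|exact: L1_sum].
by congr EE; apply/funext => w; rewrite big_cons pj.
Qed.

Lemma le_EE f g : L1 f -> L1 g -> (forall w, f w <= g w) -> EE f <= EE g.
Proof.
move=> If Ig fg; rewrite -lee_fin -!EE_fin //.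
by apply: le_integral => // w _; rewrite lee_fin.
Qed.

Lemma EE_ge0 f : (forall w, 0 <= f w) -> 0 <= EE f.
Proof.
by move=> f0; apply: fine_ge0; apply: integral_ge0 => w _; rewrite lee_fin.
Qed.

Lemma independent2_EEM (f g : T -> R) : sub_measurable F f -> sub_measurable G g ->
  L1 f -> L1 g -> L1 (fun w => f w * g w) /\ EE (fun w => f w * g w) = EE f * EE g.
Proof.
move=> sf sg If Ig.
have mf := sub_measurable_fun mF sf; have mg := sub_measurable_fun mG sg.
(* The splitting u = (|u| + u) - |u| has both terms nonnegative, integrable, and measurable for the
   same sigma-algebra as u; bilinearity reduces the claim to four nonnegative products. *)
pose pos (u : T -> R) w := `|u w| + u w; pose neg (u : T -> R) w := `|u w|.
have pos0 u w : 0 <= pos u w by rewrite -lerBlDr sub0r -normrN ler_norm.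
have neg0 u w : 0 <= neg u w by exact: normr_ge0.
have uE u w : u w = pos u w - neg u w by rewrite /pos /neg addrAC subrr add0r.
have Ineg u : L1 u -> L1 (neg u) by exact: L1_abs.
have Ipos u : L1 u -> L1 (pos u) by move=> Iu; apply: L1D => //; exact: Ineg.
have sneg H u : sub_measurable H u -> sub_measurable H (neg u).
  by move=> su; exact: measurableT_comp.
have spos H u : sub_measurable H u -> sub_measurable H (pos u).
  by move=> su; apply: measurable_funD => //; exact: sneg.
have prod u v : sub_measurable F u -> sub_measurable G v -> L1 u -> L1 v ->
    (forall w, 0 <= u w) -> (forall w, 0 <= v w) ->
    L1 (fun w => u w * v w) /\ EE (fun w => u w * v w) = EE u * EE v.
  move=> su sv Iu Iv u0 v0.
  have e := independent2_expectationM_ge0 su sv u0 v0.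
  have I : L1 (fun w => u w * v w).
    apply: L1_ge0.
    - apply: measurable_funM; exact: L1_measurable.
    - by move=> w; rewrite mulr_ge0.
    - by rewrite e (EE_fin Iu) (EE_fin Iv) ltry.
  split=> //; apply: EFin_inj; rewrite -EE_fin // e EFinM.
  by rewrite (EE_fin Iu) (EE_fin Iv).
have [Ipp Epp] := prod _ _ (spos _ _ sf) (spos _ _ sg) (Ipos _ If) (Ipos _ Ig) (pos0 f) (pos0 g).
have [Ipn Epn] := prod _ _ (spos _ _ sf) (sneg _ _ sg) (Ipos _ If) (Ineg _ Ig) (pos0 f) (neg0 g).
have [Inp Enp] := prod _ _ (sneg _ _ sf) (spos _ _ sg) (Ineg _ If) (Ipos _ Ig) (neg0 f) (pos0 g).
have [Inn Enn] := prod _ _ (sneg _ _ sf) (sneg _ _ sg) (Ineg _ If) (Ineg _ Ig) (neg0 f) (neg0 g).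
have -> : (fun w => f w * g w) = (fun w => (pos f w * pos g w - pos f w * neg g w)
    - (neg f w * pos g w - neg f w * neg g w)).
  by apply/funext => w; rewrite [in LHS](uE f w) [in LHS](uE g w); ring.
split; first by apply: L1B; exact: L1B.
have -> : EE f = EE (pos f) - EE (neg f).
  rewrite -EEB; [|exact: Ipos|exact: Ineg].
  by congr EE; apply/funext => w; exact: uE.
have -> : EE g = EE (pos g) - EE (neg g).
  rewrite -EEB; [|exact: Ipos|exact: Ineg].
  by congr EE; apply/funext => w; exact: uE.
rewrite EEB; [|exact: L1B|exact: L1B].
by rewrite !EEB // Epp Epn Enp Enn; ring.
Qed.

End ExpectationProduct.

(** * Measurability of matrix operations *)

Section MatrixMeasurability.
Context {R : realType}.

Lemma measurable_sum_fun d (T : measurableType d) (J : Type) (s : seq J)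
    (p : pred J) (f : J -> T -> R) :
  (forall j, p j -> measurable_fun [set: T] (f j)) ->
  measurable_fun [set: T] (fun w => \sum_(j <- s | p j) f j w).
Proof.
move=> mf; elim: s => [|j s IH].
  by under eq_fun do rewrite big_nil; exact: measurable_cst.
under eq_fun do rewrite big_cons.
have [pj|pj] := boolP (p j); rewrite ?pj ?(negbTE pj) //.
by apply: measurable_funD => //; exact: mf.
Qed.

Lemma measurable_prod_fun d (T : measurableType d) (J : Type) (s : seq J)
    (p : pred J) (f : J -> T -> R) :
  (forall j, p j -> measurable_fun [set: T] (f j)) ->
  measurable_fun [set: T] (fun w => \prod_(j <- s | p j) f j w).
Proof.
move=> mf; elim: s => [|j s IH].
  by under eq_fun do rewrite big_nil; exact: measurable_cst.
under eq_fun do rewrite big_cons.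
have [pj|pj] := boolP (p j); rewrite ?pj ?(negbTE pj) //.
by apply: measurable_funM => //; exact: mf.
Qed.

Lemma measurable_invr : measurable_fun [set: R] (fun x : R => x^-1).
Proof.
rewrite -(setvU [set (0 : R)]); apply/measurable_funU.
- by apply: measurableC; exact: measurable_set1.
- exact: measurable_set1.
split; last exact: measurable_fun_set1.
apply: open_continuous_measurable_fun.
  by apply: closed_openC; exact: closed_eq.
by move=> x; rewrite inE => /eqP x0; exact: inv_continuous.
Qed.

Definition mx_measurable d (T : measurableType d) p q (M : T -> 'M[R]_(p, q)) : Prop :=
  forall i j, measurable_fun [set: T] (fun w => M w i j).

Lemma mx_measurable_cst d (T : measurableType d) p q (A : 'M[R]_(p, q)) :
  mx_measurable (fun _ : T => A).
Proof. by move=> i j; exact: measurable_cst. Qed.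

Lemma mx_measurableD d (T : measurableType d) p q (M N : T -> 'M[R]_(p, q)) :
  mx_measurable M -> mx_measurable N -> mx_measurable (fun w => M w + N w).
Proof.
move=> mM mN i j; under eq_fun do rewrite mxE.
exact: measurable_funD.
Qed.

Lemma mx_measurableZ d (T : measurableType d) p q a (M : T -> 'M[R]_(p, q)) :
  mx_measurable M -> mx_measurable (fun w => a *: M w).
Proof.
move=> mM i j; under eq_fun do rewrite mxE.
by apply: measurable_funM => //; exact: measurable_cst.
Qed.

Lemma mx_measurableM d (T : measurableType d) p q r (M : T -> 'M[R]_(p, q))
    (N : T -> 'M[R]_(q, r)) :
  mx_measurable M -> mx_measurable N -> mx_measurable (fun w => M w *m N w).
Proof.
move=> mM mN i j; under eq_fun do rewrite mxE.
by apply: measurable_sum_fun => k _; exact: measurable_funM.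
Qed.

Lemma mx_measurable_tr d (T : measurableType d) p q (M : T -> 'M[R]_(p, q)) :
  mx_measurable M -> mx_measurable (fun w => (M w)^T).
Proof. by move=> mM i j; under eq_fun do rewrite mxE; exact: mM. Qed.

Lemma mx_measurable_row d (T : measurableType d) p q (M : T -> 'M[R]_(p, q)) i :
  mx_measurable M -> mx_measurable (fun w => row i (M w)).
Proof. by move=> mM k j; under eq_fun do rewrite mxE; exact: mM. Qed.

Lemma mx_measurable_sum d (T : measurableType d) p q (J : Type) (s : seq J)
    (P : pred J) (M : J -> T -> 'M[R]_(p, q)) :
  (forall j, P j -> mx_measurable (M j)) ->
  mx_measurable (fun w => \sum_(j <- s | P j) M j w).
Proof.
move=> mM i j; under eq_fun do rewrite summxE.
by apply: measurable_sum_fun => k Pk; exact: mM.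
Qed.

Lemma measurable_det d (T : measurableType d) p (M : T -> 'M[R]_p) :
  mx_measurable M -> measurable_fun [set: T] (fun w => \det (M w)).
Proof.
move=> mM; apply: measurable_sum_fun => s _; apply: measurable_funM.
  exact: measurable_cst.
by apply: measurable_prod_fun => i _; exact: mM.
Qed.

(** Cramer's rule makes each entry of the inverse a rational function of the entries. *)
Lemma mx_measurable_inv d (T : measurableType d) p (M : T -> 'M[R]_p) :
  (forall w, M w \in unitmx) -> mx_measurable M ->
  mx_measurable (fun w => invmx (M w)).
Proof.
move=> uM mM i j.
have -> : (fun w => invmx (M w) i j) = (fun w => (\det (M w))^-1 * \adj (M w) i j).
  by apply/funext => w; rewrite /invmx uM !mxE.
apply: measurable_funM.
  exact: measurableT_comp measurable_invr (measurable_det mM).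
under eq_fun do rewrite mxE /cofactor.
apply: measurable_funM; first exact: measurable_cst.
apply: measurable_det => k l.
by under eq_fun do rewrite !mxE; exact: mM.
Qed.

End MatrixMeasurability.

(** * Variance of quadratic forms in independent variables *)

Section RandomQuadraticForms.
Context {R : realType} {d : measure_display} {T : measurableType d}.
Variable P : probability T R.
Local Notation L1 := (L1 P).
Local Notation EE := (EE P).

Lemma L1_bounded (f : T -> R) K : measurable_fun [set: T] f ->
  (forall w, `|f w| <= K) -> L1 f.
Proof. by move=> mf fK; exact: (L1_le mf (L1_cst P K) fK). Qed.

Lemma L1_mul (f g : T -> R) : measurable_fun [set: T] f -> measurable_fun [set: T] g ->
  L1 (fun w => f w ^+ 2) -> L1 (fun w => g w ^+ 2) -> L1 (fun w => f w * g w).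
Proof.
move=> mf mg Lf Lg; apply: (L1_le _ (L1D Lf Lg)); first exact: measurable_funM.
move=> w; rewrite -[f w ^+ 2]real_normK ?num_real // -[g w ^+ 2]real_normK ?num_real // normrM.
move: (`|f w|) (`|g w|) (normr_ge0 (f w)) (normr_ge0 (g w)) => a b a0 b0.
by have := sqr_ge0 (a - b); nra.
Qed.

Lemma L1_sqr (f : T -> R) : measurable_fun [set: T] f ->
  L1 (fun w => f w ^+ 2) -> L1 f.
Proof.
move=> mf Lf; have := L1_mul mf (@measurable_cst _ _ _ _ setT (1 : R)) Lf.
have -> : (fun w => f w * cst 1 w) = f by apply/funext => w; exact: mulr1.
by apply; exact: (L1_cst P (1 ^+ 2)).
Qed.

Section SquareOfSum.
Variables (F G : set (set T)).
Hypotheses (mF : F `<=` measurable) (mG : G `<=` measurable).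
Hypothesis FG : independent2 P <<s F >> <<s G >>.
Variables (I : finType) (c v : I -> T -> R) (K : R).
Hypotheses (sc : forall m, sub_measurable F (c m))
  (sv : forall m, sub_measurable G (v m)).
Hypothesis cK : forall m w, `|c m w| <= K.
Hypothesis vL1 : forall m m', L1 (fun w => v m w * v m' w).

Let mc m : measurable_fun [set: T] (c m).
Proof. exact: sub_measurable_fun mF (sc m). Qed.

Let ccL1 m m' : L1 (fun w => c m w * c m' w).
Proof.
apply: (@L1_bounded _ (K * K)); first exact: measurable_funM.
by move=> w; rewrite normrM ler_pM.
Qed.

Let square_sumE : (fun w => (\sum_m c m w * v m w) ^+ 2)
  = (fun w => \sum_m \sum_m' (c m w * c m' w) * (v m w * v m' w)).
Proof.
apply/funext => w; rewrite expr2 mulr_suml; apply: eq_bigr => m _.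
by rewrite mulr_sumr; apply: eq_bigr => m' _; ring.
Qed.

Let fact m m' : L1 (fun w => (c m w * c m' w) * (v m w * v m' w)) /\
    EE (fun w => (c m w * c m' w) * (v m w * v m' w))
      = EE (fun w => c m w * c m' w) * EE (fun w => v m w * v m' w).
Proof.
exact: (independent2_EEM mF mG FG (sub_measurableM (sc m) (sc m'))
  (sub_measurableM (sv m) (sv m')) (ccL1 m m') (vL1 m m')).
Qed.

Lemma L1_square_sum : L1 (fun w => (\sum_m c m w * v m w) ^+ 2).
Proof.
rewrite square_sumE; apply: L1_sum => m _; apply: L1_sum => m' _.
by case: (fact m m').
Qed.

(** The effect of conditioning on F: the coefficients c stay random while the products of the v are
    averaged. *)
Lemma EE_square_sum : EE (fun w => (\sum_m c m w * v m w) ^+ 2)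
  = EE (fun w => \sum_m \sum_m' c m w * c m' w * EE (fun w => v m w * v m' w)).
Proof.
rewrite square_sumE.
have L1r m m' : L1 (fun w => c m w * c m' w * EE (fun w => v m w * v m' w)).
  by under eq_fun do rewrite mulrC; exact: L1Z.
rewrite !EE_sum; first last.
- by move=> m _; apply: L1_sum => m' _; case: (fact m m').
- by move=> m _; apply: L1_sum => m' _.
apply: eq_bigr => m _; rewrite !EE_sum; first last.
- by move=> m' _; case: (fact m m').
- by [].
apply: eq_bigr => m' _; rewrite (fact m m').2.
by under [in RHS]eq_fun do rewrite mulrC; rewrite EEZ // mulrC.
Qed.

Lemma L1_quadratic : L1 (fun w =>
  \sum_m \sum_m' c m w * c m' w * EE (fun w => v m w * v m' w)).
Proof.
apply: L1_sum => m _; apply: L1_sum => m' _.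
by under eq_fun do rewrite mulrC; exact: L1Z.
Qed.

End SquareOfSum.

Lemma sub_measurable_bigcup (K : Type) (J : set K) (z : K -> T -> R) k : J k ->
  sub_measurable (\bigcup_(k in J) sigma_rv (z k)) (z k).
Proof.
move=> Jk; apply/sub_measurableP => A zA; apply: sub_sigma_algebra.
by exists k.
Qed.

Lemma sub_measurable_self (z : T -> R) : sub_measurable (sigma_rv z) z.
Proof. by apply/sub_measurableP; exact: sub_sigma_algebra. Qed.

Lemma sigma_rv_measurable (z : T -> R) : measurable_fun [set: T] z ->
  sigma_rv z `<=` measurable.
Proof. by move=> mz _ [B mB <-]; exact: mz. Qed.

Section QuadraticForm.
Variables (p : nat) (z : 'I_p -> T -> R) (cm : R) (F : set (set T)).
Hypothesis mF : F `<=` measurable.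
Hypothesis mz : forall k, measurable_fun [set: T] (z k).
Hypothesis indz : forall c, independent2 P <<s sigma_rv (z c) >>
  <<s \bigcup_(k in [set k | k != c]) sigma_rv (z k) >>.
Hypothesis indF : independent2 P <<s F >> <<s \bigcup_k sigma_rv (z k) >>.
Hypothesis Ez : forall k, EE (z k) = 0.
Hypothesis Ez2 : forall k, EE (fun w => z k w ^+ 2) = 1.
Hypothesis Lz12 : forall k, L1 (fun w => z k w ^+ 12).
Hypothesis Ez12 : forall k, EE (fun w => z k w ^+ 12) <= cm.

(** The products z_a z_b minus their expectations. A quadratic form minus its trace is linear in
    these variables, so its variance is read off their covariances. *)
Let D (ab : 'I_p * 'I_p) w : R := z ab.1 w * z ab.2 w - (ab.1 == ab.2)%:R.

Let mD ab : measurable_fun [set: T] (D ab).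
Proof.
apply: measurable_funB; last exact: measurable_cst.
exact: measurable_funM.
Qed.

Let x4_le (x : R) : x ^+ 4 <= 1 + x ^+ 12.
Proof.
have -> : x ^+ 12 = (x ^+ 4) ^+ 3 by rewrite -exprM.
have : 0 <= x ^+ 4 by rewrite exprn_even_ge0.
by move: (x ^+ 4) => y y0; have := sqr_ge0 (y - 1); nra.
Qed.

(** From (x y)^2 <= (x^4 + y^4) / 2 and x^4 <= 1 + x^12, the moment bound on the entries becomes a
    bound on second moments of D. *)
Let D2_le ab w : D ab w ^+ 2 <= 4 + z ab.1 w ^+ 12 + z ab.2 w ^+ 12.
Proof.
have h1 := x4_le (z ab.1 w); have h2 := x4_le (z ab.2 w).
apply: (@le_trans _ _ (2 + z ab.1 w ^+ 4 + z ab.2 w ^+ 4)); last by lra.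
rewrite /D; move: (z ab.1 w) (z ab.2 w) => x y.
have -> : x ^+ 4 = (x * x) * (x * x) by ring.
have -> : y ^+ 4 = (y * y) * (y * y) by ring.
have := sqr_ge0 (x * x - y * y); have := sqr_ge0 (x * y + 1).
have := sqr_ge0 (x * y); have := sqr_ge0 (x * y - 1).
by case: (_ == _) => /=; nra.
Qed.

Let LD2 ab : L1 (fun w => D ab w ^+ 2).
Proof.
apply: (@L1_le _ _ _ _ _ (fun w => 4 + z ab.1 w ^+ 12 + z ab.2 w ^+ 12)).
- exact: measurable_funX.
- by apply: L1D => //; apply: L1D => //; exact: L1_cst.
- by move=> w; rewrite ger0_norm ?sqr_ge0.
Qed.

Let LDD ab cd : L1 (fun w => D ab w * D cd w).
Proof. exact: L1_mul. Qed.

Let Lz4 k : L1 (fun w => z k w ^+ 4).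
Proof.
apply: (@L1_le _ _ _ _ _ (fun w => 1 + z k w ^+ 12)).
- exact: measurable_funX.
- by apply: L1D => //; exact: L1_cst.
- by move=> w; rewrite ger0_norm ?exprn_even_ge0.
Qed.

Let Lz2 k : L1 (fun w => z k w ^+ 2).
Proof.
apply: L1_sqr; first exact: measurable_funX.
by under eq_fun do rewrite -exprM.
Qed.

Let Lz k : L1 (z k).
Proof. exact: L1_sqr. Qed.

Let LD ab : L1 (D ab).
Proof. exact: L1_sqr. Qed.

Let rest c := \bigcup_(k in [set k | k != c]) sigma_rv (z k).

Let mrest c : rest c `<=` measurable.
Proof. by move=> A [k _]; exact: sigma_rv_measurable. Qed.

Let srest c k : k != c -> sub_measurable (rest c) (z k).
Proof. by move=> kc; exact: sub_measurable_bigcup. Qed.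

Let srestD c ab : ab.1 != c -> ab.2 != c -> sub_measurable (rest c) (D ab).
Proof.
move=> ac bc; apply: measurable_funB; last exact: measurable_cst.
by apply: measurable_funM; exact: srest.
Qed.

(** An index c of the second pair that is absent from the first makes z_c independent of the other
    factors. If it is paired with itself, the centring kills the expectation; otherwise z_c factors
    out and has mean 0. *)
Let cov_eq0 ab cd : ab.1 != cd.1 -> ab.2 != cd.1 ->
  EE (fun w => D ab w * D cd w) = 0.
Proof.
case: cd => c e /= ac bc; have mc := sigma_rv_measurable (mz c).
have [<-|ce] := eqVneq c e.
  have sD : sub_measurable (sigma_rv (z c)) (D (c, c)).
    apply: measurable_funB; last exact: measurable_cst.
    by apply: measurable_funM; exact: sub_measurable_self.
  have [_ h] := independent2_EEM mc (@mrest c) (@indz c) sD (srestD ac bc) (LD _) (LD ab).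
  under eq_fun do rewrite mulrC.
  rewrite h (_ : EE (D (c, c)) = 0) ?mul0r //.
  rewrite -[RHS](subrr 1) -[X in X - _](Ez2 c) -(EE_cst P 1) -EEB //; last exact: L1_cst.
  by congr EE; apply/funext => w; rewrite /D /= eqxx expr2.
have Lze : L1 (fun w => z e w * D ab w) by exact: L1_mul.
have sze : sub_measurable (rest c) (fun w => z e w * D ab w).
  by apply: measurable_funM; [apply: srest; rewrite eq_sym|exact: srestD].
have [_ h] := independent2_EEM mc (@mrest c) (@indz c) (@sub_measurable_self (z c)) sze (Lz c) Lze.
rewrite (_ : (fun w => D ab w * D (c, e) w) = (fun w => z c w * (z e w * D ab w))).
  by rewrite h Ez mul0r.
by apply/funext => w; rewrite {2}/D /= (negbTE ce) subr0; ring.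
Qed.

Let swap (ab : 'I_p * 'I_p) := (ab.2, ab.1).

Let Dswap ab : D (swap ab) = D ab.
Proof. by apply/funext => w; rewrite /D /= mulrC eq_sym. Qed.

(* The covariances of the products z_a z_b are diagonal up to the swap
   (a, b) <-> (b, a), whence the variance of a quadratic form is bounded by its
   squared Frobenius norm. *)
Let cov_supp ab cd : EE (fun w => D ab w * D cd w) != 0 -> (cd == ab) || (cd == swap ab).
Proof.
move=> ne0.
have flip x y : (fun w => D x w * D y w) = (fun w => D y w * D x w).
  by apply/funext => w; rewrite mulrC.
(* A nonzero covariance requires each index of either pair to occur in the other. *)
have h1 : (ab.1 == cd.1) || (ab.2 == cd.1).
  by apply: contraR ne0 => /norP[? ?]; rewrite cov_eq0.
have h2 : (ab.1 == cd.2) || (ab.2 == cd.2).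
  by apply: contraR ne0 => /norP[? ?]; rewrite -(Dswap cd) cov_eq0.
have h3 : (cd.1 == ab.1) || (cd.2 == ab.1).
  by apply: contraR ne0 => /norP[? ?]; rewrite flip cov_eq0.
have h4 : (cd.1 == ab.2) || (cd.2 == ab.2).
  by apply: contraR ne0 => /norP[? ?]; rewrite flip -(Dswap ab) cov_eq0.
case: ab cd h1 h2 h3 h4 {ne0} => [a b] [c e] /=; rewrite /swap /= !xpair_eqE.
by move=> /orP[]/eqP? /orP[]/eqP? /orP[]/eqP? /orP[]/eqP?; subst;
  rewrite !eqxx ?orbT.
Qed.

Let C4 : R := 4 + cm *+ 2.

Let ED2 ab : EE (fun w => D ab w ^+ 2) <= C4.
Proof.
apply: (@le_trans _ _ (EE (fun w => 4 + z ab.1 w ^+ 12 + z ab.2 w ^+ 12))).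
  by apply: le_EE => //; apply: L1D => //; apply: L1D => //; exact: L1_cst.
rewrite EED //; last by apply: L1D => //; exact: L1_cst.
rewrite EED //; last exact: L1_cst.
by rewrite EE_cst; have := Ez12 ab.1; have := Ez12 ab.2; rewrite /C4; lra.
Qed.

Let cov_le ab cd : `|EE (fun w => D ab w * D cd w)| <= C4.
Proof.
have h : L1 (fun w => 2^-1 * (D ab w ^+ 2 + D cd w ^+ 2)) by apply: L1Z; exact: L1D.
have hE : EE (fun w => 2^-1 * (D ab w ^+ 2 + D cd w ^+ 2)) <= C4.
  rewrite EEZ ?EED //; last exact: L1D.
  by have := ED2 ab; have := ED2 cd; lra.
rewrite ler_norml; apply/andP; split.
  rewrite lerNl; apply: le_trans hE.
  rewrite -mulN1r -EEZ //; apply: le_EE => //; first exact: L1Z.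
  by move=> w; have := sqr_ge0 (D ab w + D cd w); nra.
apply: le_trans hE; apply: le_EE => //.
by move=> w; have := sqr_ge0 (D ab w - D cd w); nra.
Qed.

(** B is independent of z, so the second moment is the mean of a quadratic expression in the entries
    of B weighted by the covariances of D; their sparsity reduces it to the squared Frobenius
    norm. *)
Lemma quadratic_form_deviation (B : T -> 'M[R]_p) K b : (0 < p)%N ->
  (forall i j, sub_measurable F (fun w => B w i j)) ->
  (forall i j w, `|B w i j| <= K) ->
  (forall w, \sum_i \sum_j B w i j ^+ 2 <= b) ->
  L1 (fun w => (\sum_i \sum_j B w i j * (z i w * z j w) - \tr (B w)) ^+ 2) /\
  EE (fun w => (\sum_i \sum_j B w i j * (z i w * z j w) - \tr (B w)) ^+ 2)
    <= (8 + cm *+ 4) * b.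
Proof.
move=> p0 sB BK Bb.
pose c (ab : 'I_p * 'I_p) w := B w ab.1 ab.2.
have C40 : 0 <= C4.
  exact: le_trans (normr_ge0 _) (cov_le (Ordinal p0, Ordinal p0) (Ordinal p0, Ordinal p0)).
have -> : (fun w => (\sum_i \sum_j B w i j * (z i w * z j w) - \tr (B w)) ^+ 2)
    = (fun w => (\sum_m c m w * D m w) ^+ 2).
  apply/funext => w; congr (_ ^+ 2).
  rewrite pair_big /= /mxtrace.
  have -> : \sum_i B w i i = \sum_(m : 'I_p * 'I_p) c m w * (m.1 == m.2)%:R.
    rewrite -(pair_big xpredT xpredT (fun i j => B w i j * (i == j)%:R)) /=.
    apply: eq_bigr => i _; rewrite (bigD1 i) //= eqxx mulr1 big1 ?addr0 // => j ji.
    by rewrite eq_sym (negbTE ji) mulr0.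
  rewrite -sumrB; apply: eq_bigr => m _; by rewrite /c /D mulrBr.
have mall : \bigcup_k sigma_rv (z k) `<=` measurable.
  by move=> A [k _]; exact: sigma_rv_measurable.
have sc m : sub_measurable F (c m) by exact: sB.
have sD m : sub_measurable (\bigcup_k sigma_rv (z k)) (D m).
  apply: measurable_funB; last exact: measurable_cst.
  by apply: measurable_funM; exact: sub_measurable_bigcup.
have cK m w : `|c m w| <= K by exact: BK.
split; first exact: (L1_square_sum mF mall indF sc sD cK LDD).
rewrite (EE_square_sum mF mall indF sc sD cK LDD).
rewrite -[leRHS](EE_cst P); apply: le_EE.
- apply: L1_sum => m _; apply: L1_sum => m' _; under eq_fun do rewrite mulrC.
  apply: L1Z; apply: (@L1_bounded _ (K * K)).
    by apply: measurable_funM; exact: sub_measurable_fun mF (sc _).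
  by move=> w; rewrite normrM ler_pM.
- exact: L1_cst.
move=> w; pose q m := c m w.
have qb : \sum_m q m ^+ 2 <= b.
  by apply: le_trans (Bb w); rewrite pair_big.
have qsw : \sum_m q (swap m) ^+ 2 = \sum_m q m ^+ 2.
  rewrite [RHS](reindex_inj (_ : injective swap)) //.
  by move=> [a1 b1] [a2 b2] [-> ->].
(* B need not be symmetric, so the cross term between an entry and its transpose is bounded by half
   the sum of squares. The diagonal and swapped terms contribute [C4] each, whence the constant 2 C4
   = 8 + 4 cm. *)
apply: (@le_trans _ _ (\sum_m \sum_m' ((if m' == m then C4 * q m ^+ 2 else 0)
    + (if m' == swap m then C4 / 2 * (q m ^+ 2 + q (swap m) ^+ 2) else 0)))).
  apply: ler_sum => m _; apply: ler_sum => m' _; rewrite -/(q m) -/(q m').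
  set t := EE _.
  have pos1 : 0 <= (if m' == m then C4 * q m ^+ 2 else 0).
    by case: ifP => // _; rewrite mulr_ge0 ?sqr_ge0.
  have pos2 : 0 <= (if m' == swap m then C4 / 2 * (q m ^+ 2 + q (swap m) ^+ 2) else 0).
    by case: ifP => // _; rewrite mulr_ge0 ?addr_ge0 ?sqr_ge0 // divr_ge0.
  have [t0|/cov_supp] := eqVneq t 0; first by rewrite t0 mulr0 addr_ge0.
  have tC : `|t| <= C4 by exact: cov_le.
  have bnd (x y : R) : x * y * t <= C4 / 2 * (x ^+ 2 + y ^+ 2).
    apply: (le_trans (ler_norm _)); rewrite !normrM.
    apply: (@le_trans _ _ (`|x| * `|y| * C4)).
      by rewrite ler_wpM2l // mulr_ge0.
    rewrite -[x ^+ 2]real_normK ?num_real// -[y ^+ 2]real_normK ?num_real//.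
    have := mulr_ge0 C40 (sqr_ge0 (`|x| - `|y|)); nra.
  case/orP => /eqP e; subst m'.
    rewrite eqxx -[leLHS]addr0; apply: lerD => //.
    by have := bnd (q m) (q m); lra.
  by rewrite eqxx -[leLHS]add0r; apply: lerD.
under eq_bigr => m _ do rewrite big_split /= -!big_mkcond !big_pred1_eq.
rewrite big_split /= -!mulr_sumr big_split /= qsw.
have : C4 * \sum_m q m ^+ 2 <= C4 * b by rewrite ler_wpM2l.
by rewrite /C4; lra.
Qed.

End QuadraticForm.

End RandomQuadraticForms.

(** * Concentration of the leave-one-out quadratic forms *)

Section SampleCovarianceConcentration.
Context {R : realType} {d : measure_display} {T : measurableType d}.
Variable P : probability T R.
Local Notation L1 := (L1 P).
Local Notation EE := (EE P).

Lemma measurable_gt_set (W : T -> R) a : measurable_fun [set: T] W ->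
  measurable [set w | a < W w].
Proof.
move=> mW; have -> : [set w | a < W w] = [set: T] `&` W @^-1` `]a, +oo[%classic.
  by rewrite setTI; apply/seteqP; split=> w /=; rewrite in_itv /= andbT.
by apply: mW => //; exact: measurable_itv.
Qed.

Lemma probability_gt_le (W : T -> R) a : 0 < a -> L1 W -> (forall w, 0 <= W w) ->
  (P [set w | (a < W w)%R] <= (EE W / a)%:E)%E.
Proof.
move=> a0 LW W0; have mW := L1_measurable LW.
have mA : measurable [set w | a < W w] by exact: measurable_gt_set.
have LI : L1 (\1_[set w | a < W w] : T -> R).
  apply: (@L1_bounded _ _ _ _ _ 1); first exact: measurable_indic.
  by move=> w; rewrite indicE; case: (_ \in _); rewrite ?normr1 ?normr0.
have -> : P [set w | a < W w] = (EE (\1_[set w | a < W w] : T -> R))%:E.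
  by rewrite -EE_fin // integral_indic // setIT.
rewrite lee_fin ler_pdivlMr // mulrC -EEZ //; apply: le_EE => //; first exact: L1Z.
move=> w; rewrite indicE.
have [|_] := boolP (w \in [set w | a < W w]); last by rewrite mulr0.
by rewrite inE /= mulr1 => /ltW.
Qed.

Lemma sub_measurable_entry m k (V : T -> 'M[R]_(m, k)) i j :
  sub_measurable (sigma_mx V) (fun w => V w i j).
Proof.
apply/sub_measurableP => _ [B mB <-]; apply: sub_sigma_algebra.
exists [set M : 'M[R]_(m, k) | B (M i j)] => //.
by apply: sub_sigma_algebra; exists i, j; exists B.
Qed.

Lemma random_mx_measurable m k (V : T -> 'M[R]_(m, k)) :
  random_mx V -> mx_measurable V.
Proof.
by move=> rV i j; have := sub_measurable_fun rV (@sub_measurable_entry _ _ V i j).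
Qed.

Lemma sigma_algebra_sigma_rv (z : T -> R) : sigma_algebra setT (sigma_rv z).
Proof. exact/sigma_algebra_preimage/sigma_algebra_measurable. Qed.

Lemma opbound_mxsqrt p (A : 'M[R]_p) s : 0 <= s -> possemidefmx A ->
  (forall v, dotv v (A *m v) <= s * dotv v v) -> opbound (mxsqrt A) (Num.sqrt s).
Proof.
move=> s0 pA hA; split=> [|v]; first exact: sqrtr_ge0.
rewrite !enormE -sqrtrM // ler_wsqrtr //.
by rewrite dotv_mull (tr_mxsqrt pA) mulmxA (mxsqrt_sq pA).
Qed.

Lemma opbound_entry p q (M : 'M[R]_(q, p)) c i j : opbound M c -> `|M i j| <= c.
Proof.
move=> [c0 Mc]; have := Mc (delta_mx j 0); rewrite enorm_delta mulr1.
apply: le_trans; have -> : M i j = dotv (delta_mx i 0) (M *m delta_mx j 0).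
  by rewrite -colE dotvE trmx_delta -rowE !mxE.
by apply: (le_trans (dotv_le_enorm _ _)); rewrite enorm_delta mul1r.
Qed.

Lemma quadE_sum p (B : 'M[R]_p) (v : 'cV[R]_p) :
  dotv v (B *m v) = \sum_i \sum_j B i j * (v i 0 * v j 0).
Proof.
apply: eq_bigr => i _; rewrite mxE mulr_sumr; apply: eq_bigr => j _; ring.
Qed.

Section Design.
Variables (n p : nat) (Z : T -> 'M[R]_(n, p)) (cm : R).
Hypotheses (n0 : (0 < n)%N) (p0 : (0 < p)%N).
Hypothesis rZ : random_mx Z.
Hypothesis iidZ : iid_entries P Z.
Hypothesis EZ : forall i j, EE (fun w => Z w i j) = 0.
Hypothesis EZ2 : forall i j, EE (fun w => Z w i j ^+ 2) = 1.
Hypothesis LZ12 : forall i j, L1 (fun w => Z w i j ^+ 12).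
Hypothesis EZ12 : forall i j, EE (fun w => Z w i j ^+ 12) <= cm.
Variables (Sigma A : 'M[R]_p) (rho s t : R).
Hypotheses (rho0 : 0 < rho) (s0 : 0 < s) (t0 : 0 <= t).
Hypotheses (pSigma : possemidefmx Sigma) (pA : posdefmx A).
Hypothesis Sigma_le : forall v, dotv v (Sigma *m v) <= s * dotv v v.
Hypothesis A_ge : forall v, rho * dotv v v <= dotv v (A *m v).

Let zent (kl : 'I_n * 'I_p) : T -> R := fun w => Z w kl.1 kl.2.
Let other (i : 'I_n) := \bigcup_(kl in [set kl | kl.1 != i]) sigma_rv (zent kl).
Let X := design Sigma Z.
Let S := mxsqrt Sigma.

Let mZ i j : measurable_fun [set: T] (fun w => Z w i j).
Proof. exact: random_mx_measurable. Qed.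

Let mother i : other i `<=` measurable.
Proof. by move=> B [kl _]; apply: sigma_rv_measurable; exact: mZ. Qed.

Let group (J : pred ('I_n * 'I_p)) :=
  independent2_group (J := J) (fun kl => sigma_algebra_sigma_rv (zent kl))
    (fun kl => @sigma_rv_measurable _ _ _ (zent kl) (mZ kl.1 kl.2)) iidZ.1.

Let ind_other i : independent2 P <<s other i >>
  <<s \bigcup_k sigma_rv (fun w => Z w i k) >>.
Proof.
apply: independent2S (@group (fun kl => kl.1 != i)) => //.
apply: sub_sigma_algebra2 => B [k _ zB]; exists (i, k) => //=.
by rewrite eqxx.
Qed.

Let ind_row i c : independent2 P <<s sigma_rv (fun w => Z w i c) >>
  <<s \bigcup_(k in [set k | k != c]) sigma_rv (fun w => Z w i k) >>.
Proof.
apply: independent2S (@group (fun kl => kl == (i, c))).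
  by apply: sub_sigma_algebra2 => B zB; exists (i, c) => //=.
apply: sub_sigma_algebra2 => B [k /= kc zB]; exists (i, k) => //=.
by rewrite xpair_eqE eqxx.
Qed.

Let rowX w i : (row i (X w))^T = S *m (row i (Z w))^T.
Proof. by rewrite /X /design row_mul trmx_mul (tr_mxsqrt pSigma). Qed.

(** Only the rows other than i are read; together with [ind_other] this gives the independence of
    Q_i and row i. *)
Let sQi i : @mx_measurable R _ (g_sigma_algebraType (other i)) _ _
  (fun w => loo_resolvent A (X w) i).
Proof.
apply: mx_measurable_inv.
  by move=> w; apply/posdef_unitmx/posdefD => //; exact: psd_loo_cov.
apply: mx_measurableD; last exact: mx_measurable_cst.
apply: mx_measurableZ; apply: mx_measurable_sum => k ki.
have mr : @mx_measurable R _ (g_sigma_algebraType (other i)) _ _ (fun w => row k (X w)).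
  under eq_fun do rewrite /X /design row_mul.
  apply: mx_measurableM; last exact: mx_measurable_cst.
  move=> a b; under eq_fun do rewrite mxE.
  exact: (@sub_measurable_bigcup _ _ _ _ _ zent (k, b)).
by apply: mx_measurableM => //; exact: mx_measurable_tr.
Qed.

(** Row i of the design is Sigma^{1/2} z_i, so the form has matrix B = Sigma^{1/2} M Sigma^{1/2} / n
    in z_i. Its operator norm is at most s c / n and its squared Frobenius norm at most p (s c /
    n)^2, of order 1 / n when p / n is bounded. *)
Let deviation (i : 'I_n) (M : T -> 'M[R]_p) c :
  @mx_measurable R _ (g_sigma_algebraType (other i)) _ _ M ->
  (forall w, opbound (M w) c) -> 0 <= c ->
  L1 (fun w => (n%:R^-1 * dotv (row i (X w))^T (M w *m (row i (X w))^T)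
               - n%:R^-1 * \tr (Sigma *m M w)) ^+ 2) /\
  EE (fun w => (n%:R^-1 * dotv (row i (X w))^T (M w *m (row i (X w))^T)
               - n%:R^-1 * \tr (Sigma *m M w)) ^+ 2)
    <= (8 + cm *+ 4) * (p%:R * (n%:R^-1 * (s * c)) ^+ 2).
Proof.
move=> sM Mc c0.
pose B w := n%:R^-1 *: (S *m M w *m S).
have opB w : opbound (B w) (n%:R^-1 * (s * c)).
  rewrite -{1}[n%:R^-1]ger0_norm ?invr_ge0 //; apply: opboundZ.
  have -> : s * c = Num.sqrt s * c * Num.sqrt s.
    by rewrite mulrAC -expr2 sqr_sqrtr // ltW.
  have oS := opbound_mxsqrt (ltW s0) pSigma Sigma_le.
  by apply: opboundM => //; exact: opboundM.
have -> : (fun w => (n%:R^-1 * dotv (row i (X w))^T (M w *m (row i (X w))^T)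
               - n%:R^-1 * \tr (Sigma *m M w)) ^+ 2)
  = (fun w => (\sum_k \sum_l B w k l * (Z w i k * Z w i l) - \tr (B w)) ^+ 2).
  apply/funext => w; congr (_ ^+ 2); congr (_ - _).
    rewrite rowX dotv_mull (tr_mxsqrt pSigma) -dotvZr scalemxAl !mulmxA.
    have -> : (n%:R^-1 *: mxsqrt Sigma) *m M w *m S = B w by rewrite /B -!scalemxAl.
    rewrite quadE_sum; apply: eq_bigr => k _; apply: eq_bigr => l _.
    by rewrite !mxE.
  rewrite /B mxtraceZ; congr (_ * _).
  by rewrite -(mxsqrt_sq pSigma) -/S mxtrace_mulC !mulmxA mxtrace_mulC !mulmxA.
apply: (@quadratic_form_deviation _ _ _ P p (fun k w => Z w i k) cm (other i) _ _ _ _ _ _ _ _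
    B (n%:R^-1 * (s * c))) => //.
- move=> a b; apply: (mx_measurableZ n%:R^-1 (M := fun w : g_sigma_algebraType (other i) => S *m M w *m S)).
  apply: mx_measurableM; last exact: mx_measurable_cst.
  by apply: mx_measurableM => //; exact: mx_measurable_cst.
- by move=> a b w; exact: opbound_entry.
- by move=> w; exact: opbound_frobenius.
Qed.

(** For [quad_a] the matrix Q_i Sigma K has norm at most s / rho^2, for [quad_b] the matrix Q_i has
    norm at most 1 / rho; hence the fourth and second powers of s / rho. *)
Lemma quad_dev_bound :
  L1 (fun w => quad_dev t Sigma A (X w)) /\
  EE (fun w => quad_dev t Sigma A (X w))
    <= (8 + cm *+ 4) * ((s / rho) ^+ 2 + (s / rho) ^+ 4) * (p%:R / n%:R) / n%:R.
Proof.
have oS : opbound Sigma s by exact: opbound_psd (ltW s0) pSigma Sigma_le.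
have oK : opbound (det_resolvent t Sigma A) rho^-1.
  apply: opbound_invP => //; apply: psdZ => //.
  by rewrite invr_ge0 addr_ge0.
have oQ i w : opbound (loo_resolvent A (X w) i) rho^-1.
  by apply: opbound_invP => //; exact: psd_loo_cov.
have da i : L1 (fun w => (quad_a t Sigma A (X w) i - tr_a t Sigma A (X w) i) ^+ 2) /\
    EE (fun w => (quad_a t Sigma A (X w) i - tr_a t Sigma A (X w) i) ^+ 2)
    <= (8 + cm *+ 4) * (p%:R * (n%:R^-1 * (s * (rho^-1 * s * rho^-1))) ^+ 2).
  pose M w := loo_resolvent A (X w) i *m Sigma *m det_resolvent t Sigma A.
  have -> : (fun w => (quad_a t Sigma A (X w) i - tr_a t Sigma A (X w) i) ^+ 2)
      = (fun w => (n%:R^-1 * dotv (row i (X w))^T (M w *m (row i (X w))^T)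
               - n%:R^-1 * \tr (Sigma *m M w)) ^+ 2).
    by apply/funext => w; rewrite /quad_a /tr_a /M !mulmxA.
  apply: deviation.
  - apply: mx_measurableM; last exact: mx_measurable_cst.
    by apply: mx_measurableM; [exact: sQi|exact: mx_measurable_cst].
  - by move=> w; apply: opboundM => //; exact: opboundM.
  - by rewrite !mulr_ge0 // ?invr_ge0 ltW.
have db i : L1 (fun w => (quad_b A (X w) i - tr_b Sigma A (X w) i) ^+ 2) /\
    EE (fun w => (quad_b A (X w) i - tr_b Sigma A (X w) i) ^+ 2)
    <= (8 + cm *+ 4) * (p%:R * (n%:R^-1 * (s * rho^-1)) ^+ 2).
  apply: (@deviation i (fun w => loo_resolvent A (X w) i) rho^-1).
  - exact: sQi.
  - by move=> w.
  - by rewrite invr_ge0 ltW.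
have Li i : L1 (fun w => (quad_a t Sigma A (X w) i - tr_a t Sigma A (X w) i) ^+ 2
    + (quad_b A (X w) i - tr_b Sigma A (X w) i) ^+ 2).
  by apply: L1D; [case: (da i)|case: (db i)].
have LS : L1 (fun w => \sum_i ((quad_a t Sigma A (X w) i - tr_a t Sigma A (X w) i) ^+ 2
    + (quad_b A (X w) i - tr_b Sigma A (X w) i) ^+ 2)) by exact: L1_sum.
split; first exact: L1Z.
rewrite /quad_dev EEZ // EE_sum //.
rewrite mulrC ler_pdivrMr ?ltr0n //.
apply: (@le_trans _ _ (\sum_(i < n) ((8 + cm *+ 4) * (p%:R * (n%:R^-1 * (s * (rho^-1 * s * rho^-1))) ^+ 2)
   + (8 + cm *+ 4) * (p%:R * (n%:R^-1 * (s * rho^-1)) ^+ 2)))).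
  apply: ler_sum => i _; rewrite EED; [|by case: (da i)|by case: (db i)].
  by apply: lerD; [case: (da i)|case: (db i)].
rewrite sumr_const card_ord -[leLHS]mulr_natr ler_wpM2r //.
by rewrite le_eqVlt; apply/orP; left; apply/eqP; field; rewrite !gt_eqF // ltr0n.
Qed.

Lemma quad_dev_prob eps : 0 < eps ->
  measurable [set w | eps ^+ 2 < quad_dev t Sigma A (X w)] /\
  (P [set w | (eps ^+ 2 < quad_dev t Sigma A (X w))%R]
  <= ((8 + cm *+ 4) * ((s / rho) ^+ 2 + (s / rho) ^+ 4) * (p%:R / n%:R) / n%:R / eps ^+ 2)%:E)%E.
Proof.
move=> e0; have [LW EW] := quad_dev_bound; split.
  by apply: measurable_gt_set; exact: (L1_measurable LW).
apply: le_trans (probability_gt_le _ LW _) _; first by rewrite exprn_gt0.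
  move=> w; rewrite /quad_dev mulr_ge0 ?invr_ge0 //.
  by apply: sumr_ge0 => i _; rewrite addr_ge0 ?sqr_ge0.
by rewrite lee_fin ler_wpM2r // invr_ge0 sqr_ge0.
Qed.

End Design.
End SampleCovarianceConcentration.

(** * Versions of a conditional expectation of a square *)

Section ConditionalExpectation.
Context {R : realType} {d : measure_display} {T : measurableType d}.
Variable P : probability T R.
Local Notation L1 := (L1 P).
Local Notation EE := (EE P).

Lemma sub_measurable_indic (G : set (set T)) A : <<s G >> A ->
  sub_measurable G (\1_A : T -> R).
Proof. by move=> GA; exact: (@measurable_indic _ (g_sigma_algebraType G)). Qed.

Lemma integral_indicM (A : set T) (f : T -> R) :
  (\int[P]_(w in A) (f w)%:E = \int[P]_w (\1_A w * f w)%:E)%E.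
Proof.
rewrite integral_mkcond; apply: eq_integral => w _.
by rewrite patchE indicE; case: ifP => _; rewrite ?mul1r ?mul0r.
Qed.

Lemma L1_indicM (A : set T) (f : T -> R) : measurable A -> L1 f ->
  L1 (fun w => \1_A w * f w).
Proof.
move=> mA Lf; apply: (L1_le _ (L1_abs Lf)).
  by apply: measurable_funM; [exact: measurable_indic|exact: L1_measurable Lf].
move=> w; rewrite normrM indicE; case: (_ \in _); rewrite ?normr1 ?mul1r //.
by rewrite normr0 mul0r.
Qed.

(** Test u on the set where it is positive and on the complement. *)
Lemma EE_abs_eq0 (G : set (set T)) (u : T -> R) : G `<=` measurable ->
  sub_measurable G u -> L1 u ->
  (forall B, <<s G >> B -> EE (fun w => \1_B w * u w) = 0) ->
  EE (fun w => `|u w|) = 0.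
Proof.
move=> mG su Lu h.
have sG A : <<s G >> A -> measurable A.
  by move: A; apply: smallest_sub => //; exact: sigma_algebra_measurable.
pose B := [set w | 0 < u w].
have GB : <<s G >> B by exact: (@measurable_gt_set _ _ (g_sigma_algebraType G) u 0).
have GBC : <<s G >> (~` B) by exact: (@measurableC _ (g_sigma_algebraType G)).
have -> : (fun w => `|u w|) = (fun w => \1_B w * u w - \1_(~` B) w * u w).
  apply/funext => w; rewrite !indicE in_setC.
  have [uw|uw] := ltP 0 (u w).
    by rewrite (mem_set (uw : B w)) mul1r mul0r subr0 gtr0_norm.
  rewrite memNset; last by rewrite /B /= ltNge uw.
  by rewrite mul1r mul0r sub0r ler0_norm.
rewrite EEB ?h ?subr0 //; apply: L1_indicM => //; exact: sG.
Qed.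

Section SquareVersion.
Variables (F G : set (set T)).
Hypotheses (mF : F `<=` measurable) (mG : G `<=` measurable).
Hypothesis FG : independent2 P <<s F >> <<s G >>.
Variables (I : finType) (c v : I -> T -> R).
Hypotheses (sc : forall m, sub_measurable F (c m))
  (sv : forall m, sub_measurable G (v m)).
Hypothesis vL1 : forall m m', L1 (fun w => v m w * v m' w).
Variable g : T -> R.

Let f w := (\sum_m c m w * v m w) ^+ 2.
Let h w := \sum_m \sum_m' c m w * c m' w * EE (fun w => v m w * v m' w).

Hypothesis condg : is_cond_expectation P <<s F >> f g.

Let sF A : <<s F >> A -> measurable A.
Proof. by move: A; apply: smallest_sub => //; exact: sigma_algebra_measurable. Qed.

Let sg : sub_measurable F g.
Proof. by case: condg => sg _ _; apply/sub_measurableP. Qed.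

(* The coefficients need not be integrable: all identities are first proved on
   the sets AK K, where they are bounded. *)
Let AK (K : nat) := [set w | \sum_m `|c m w| <= K%:R].

Let FAK K : <<s F >> (AK K).
Proof.
have -> : AK K = ~` [set w | K%:R < \sum_m `|c m w|].
  by apply/seteqP; split=> w; rewrite /AK /= leNgt; move/negP.
apply: (@measurableC _ (g_sigma_algebraType F)).
apply: (@measurable_gt_set _ _ (g_sigma_algebraType F)).
apply: measurable_sum_fun => m _.
by apply: measurableT_comp => //; exact: sc.
Qed.

Let set_eq A K : <<s F >> A -> A `<=` AK K ->
  [/\ L1 (fun w => \1_A w * f w), L1 (fun w => \1_A w * h w) &
      EE (fun w => \1_A w * f w) = EE (fun w => \1_A w * h w)].
Proof.
move=> FA AAK; pose c' m w := \1_A w * c m w.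
have sc' m : sub_measurable F (c' m).
  by apply: sub_measurableM => //; exact: sub_measurable_indic.
have c'K m w : `|c' m w| <= K%:R.
  rewrite /c' indicE; have [|_] := boolP (w \in A); last by rewrite mul0r normr0.
  rewrite inE mul1r => /AAK; apply: le_trans.
  by rewrite (bigD1 m) //= lerDl sumr_ge0.
have i2 w : \1_A w * \1_A w = \1_A w :> R.
  by rewrite indicE; case: (_ \in _); rewrite ?mul1r ?mul0r.
have fE : (fun w => \1_A w * f w) = (fun w => (\sum_m c' m w * v m w) ^+ 2).
  apply/funext => w; rewrite /f.
  have -> : \sum_m c' m w * v m w = \1_A w * \sum_m c m w * v m w.
    by rewrite mulr_sumr; apply: eq_bigr => m _; rewrite /c' mulrA.
  by rewrite exprMn [\1_A w ^+ 2]expr2 i2.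
have hE : (fun w => \1_A w * h w) = (fun w => \sum_m \sum_m' c' m w * c' m' w * EE (fun w => v m w * v m' w)).
  apply/funext => w; rewrite /h mulr_sumr; apply: eq_bigr => m _.
  rewrite mulr_sumr; apply: eq_bigr => m' _; rewrite /c' -{1}i2; ring.
rewrite fE hE; split.
- exact: (L1_square_sum mF mG FG sc' sv c'K vL1).
- exact: (@L1_quadratic _ _ _ _ F mF I c' v K%:R sc' c'K).
- exact: (EE_square_sum mF mG FG sc' sv c'K vL1).
Qed.

(** A version g is not assumed integrable. On [AK K] it is nonnegative almost surely and has the
    same integral as f, which is finite there. *)
Let Lg K : L1 (fun w => \1_(AK K) w * g w).
Proof.
have [_ g0 gf] := condg.
have [Lf _ _] := set_eq (FAK K) (@subset_refl _ (AK K)).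
have mg : measurable_fun [set: T] (fun w => \1_(AK K) w * g w).
  apply: measurable_funM; last exact: sub_measurable_fun mF sg.
  exact: measurable_indic (sF (FAK K)).
apply/integrableP; split; first exact/measurable_EFinP.
have -> : (\int[P]_w `|(EFin \o (fun w => (\1_(AK K) w * g w)%R)) w| = \int[P]_w (\1_(AK K) w * g w)%R%:E)%E.
  apply: ae_eq_integral => //.
  - by apply: measurableT_comp => //; exact/measurable_EFinP.
  - exact/measurable_EFinP.
  apply: filterS g0 => w gw _ /=; rewrite ger0_norm // mulr_ge0 //.
rewrite -integral_indicM gf; last exact: FAK.
by rewrite integral_indicM (EE_fin Lf) ltry.
Qed.

Let EE_u K : EE (fun w => `|\1_(AK K) w * (g w - h w)|) = 0.
Proof.
have [_ _ gf] := condg; have [_ Lh _] := set_eq (FAK K) (@subset_refl _ (AK K)).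
have Lu : L1 (fun w => \1_(AK K) w * (g w - h w)).
  under eq_fun do rewrite mulrBr.
  exact: (L1B (Lg K) Lh).
have sh : sub_measurable F h.
  apply: measurable_sum_fun => m _; apply: measurable_sum_fun => m' _.
  apply: sub_measurableM; last exact: sub_measurable_cst.
  exact: sub_measurableM.
apply: (EE_abs_eq0 mF) => //.
  apply: sub_measurableM; first exact: sub_measurable_indic.
  exact: sub_measurableB.
move=> B FB; pose A := B `&` AK K.
have FA : <<s F >> A by exact: (@measurableI _ (g_sigma_algebraType F) _ _ FB (FAK K)).
have [Lf' Lh' E'] := set_eq FA (@subIsetr _ B (AK K)).
have iA w : \1_B w * \1_(AK K) w = \1_A w :> R.
  by rewrite /A indicI.
have Lg' : L1 (fun w => \1_A w * g w).
  have := L1_indicM (sF FB) (Lg K).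
  by under eq_fun do rewrite mulrA iA.
under eq_fun do rewrite mulrA iA mulrBr.
rewrite EEB // -E'; apply/eqP; rewrite subr_eq0; apply/eqP.
by apply: EFin_inj; rewrite -!EE_fin // -!integral_indicM gf.
Qed.

(** On each [AK K] the two functions agree almost surely, and these countably many sets exhaust the
    space. The threshold a puts the conclusion in the form used for convergence in probability. *)
Lemma cond_expectation_square a : 0 < a ->
  measurable [set w | a < `|g w - h w|] /\ P [set w | a < `|g w - h w|] = 0%E.
Proof.
move=> a0.
have sh : sub_measurable F h.
  apply: measurable_sum_fun => m _; apply: measurable_sum_fun => m' _.
  apply: sub_measurableM; last exact: sub_measurable_cst.
  exact: sub_measurableM.
have mgh : measurable_fun [set: T] (fun w => g w - h w).
  exact: sub_measurable_fun mF (sub_measurableB sg sh).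
have mA : measurable [set w | a < `|g w - h w|].
  by apply: measurable_gt_set; exact: measurableT_comp.
split=> //; apply/eqP; rewrite -measure_le0.
pose N K := [set w | a < `|\1_(AK K) w * (g w - h w)|].
have mN K : measurable (N K).
  apply: measurable_gt_set; apply: measurableT_comp => //.
  by apply: measurable_funM => //; exact: measurable_indic (sF (FAK K)).
have PN K : P (N K) = 0%E.
  apply/eqP; rewrite -measure_le0.
  have Lu : L1 (fun w => `|\1_(AK K) w * (g w - h w)|).
    apply: L1_abs; under eq_fun do rewrite mulrBr.
    have [_ Lh _] := set_eq (FAK K) (@subset_refl _ (AK K)).
    exact: (L1B (Lg K) Lh).
  apply: le_trans (probability_gt_le a0 Lu _) _ => //.
  by rewrite EE_u mul0r.
have sub : [set w | a < `|g w - h w|] `<=` \bigcup_K N K.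
  move=> w /= aw; have [K hK] : exists K : nat, \sum_m `|c m w| <= K%:R.
    exists (Num.bound (\sum_m `|c m w|)); apply/ltW/archi_boundP.
    exact: sumr_ge0.
  exists K => //; by rewrite /N /= indicE (mem_set (hK : AK K w)) mul1r.
apply: le_trans (le_measure P _ _ sub) _; rewrite ?inE //.
  exact: bigcup_measurable.
apply: le_trans (measure_sigma_subadditive _ _ _ (@subset_refl _ _)) _ => //.
  exact: bigcup_measurable.
by rewrite (eq_eseriesr (fun n _ => PN n)) eseries0.
Qed.

End SquareVersion.

End ConditionalExpectation.

(** * Measurability of the operator norm *)

Section OpnormMeasurable.
Context {R : realType}.

Lemma rational_approx p (v : 'cV[R]_p) e : 0 < e ->
  exists q : 'cV[rat]_p, enorm (v - map_mx ratr q) <= e.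
Proof.
move=> e0; pose del := e / p.+1%:R.
have d0 : 0 < del by rewrite divr_gt0.
have /choice[q hq] : forall i : 'I_p, exists r : rat, `|v i 0 - ratr r| < del.
  move=> i; have [|r] := @rat_in_itvoo R (v i 0 - del) (v i 0 + del).
    by rewrite ltrBlDr -addrA ltrDl addr_gt0.
  by rewrite in_itv /= => h; exists r; rewrite -normrN opprB ltr_distl.
exists (\col_i q i).
rewrite -(@ler_pXn2r _ 2) ?nnegrE ?enorm_ge0 ?(ltW e0) // enorm_sqr.
apply: (@le_trans _ _ (\sum_(i < p) del ^+ 2)).
  apply: ler_sum => i _; rewrite !mxE -expr2 -real_normK ?num_real //.
  by rewrite ler_pXn2r ?nnegrE ?(ltW d0) //; exact: ltW.
rewrite sumr_const card_ord -mulr_natl /del expr_div_n mulrA ler_pdivrMr; last first.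
  by rewrite exprn_gt0.
rewrite mulrC ler_wpM2l ?sqr_ge0 // -natrX ler_nat.
by rewrite expnS expn1 (leq_trans (leqnSn p)) // leq_pmulr.
Qed.

(* Reduces the operator norm to countably many vectors, for measurability. *)
Lemma opnorm_gt_rational p (M : 'M[R]_p) c : 0 <= c -> c < opnorm M ->
  exists q : 'cV[rat]_p, c * enorm (map_mx ratr q : 'cV[R]_p) < enorm (M *m map_mx ratr q).
Proof.
move=> c0; apply: contraPP => /forallNP h; apply/negP; rewrite -leNgt.
have {}h q : enorm (M *m map_mx ratr q) <= c * enorm (map_mx ratr q : 'cV[R]_p).
  by rewrite leNgt; apply/negP; exact: h.
apply: opnorm_le; split=> // v; apply/ler_addgt0Pr => e e0.
have [on0 hM] := opnorm_opbound M.
have k0 : 0 < opnorm M + c + 1 by rewrite ltr_wpDl // addr_ge0.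
have [q hq] := rational_approx v (divr_gt0 e0 k0).
set u := map_mx ratr q in hq *.
have h1 : enorm (M *m v) <= enorm (M *m u) + opnorm M * enorm (v - u).
  rewrite -{1}(subrK u v) mulmxDr addrC; apply: (le_trans (enormD _ _)).
  by rewrite lerD2l.
have h2 : enorm u <= enorm v + enorm (v - u).
  rewrite -{1}(subKr v u) -scaleN1r; apply: (le_trans (enormD _ _)).
  by rewrite enormZ normrN1 mul1r.
have h3 := h q; rewrite -/u in h3.
have h4 : (opnorm M + c + 1) * enorm (v - u) <= e by rewrite mulrC -ler_pdivlMr.
have n0 := enorm_ge0 (v - u).
have := ler_wpM2l c0 h2; nra.
Qed.

Lemma measurable_opnorm d (T : measurableType d) p (M : T -> 'M[R]_p) eta :
  mx_measurable M -> 0 < eta -> measurable [set w | eta <= opnorm (M w)].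
Proof.
move=> mM eta0.
have mgt c : 0 <= c -> measurable [set w | c < opnorm (M w)].
  move=> c0.
  have -> : [set w | c < opnorm (M w)] = \bigcup_(q in [set: 'cV[rat]_p])
      [set w | c * enorm (map_mx ratr q : 'cV[R]_p) < enorm (M w *m map_mx ratr q)].
    apply/seteqP; split=> [w /= /(opnorm_gt_rational c0)[q hq]|w [q _ /= hq]].
      by exists q.
    have [_ hM] := opnorm_opbound (M w).
    have := lt_le_trans hq (hM _).
    have := enorm_ge0 (map_mx ratr q : 'cV[R]_p); rewrite le_eqVlt => /orP[/eqP<-|n0].
      by rewrite !mulr0 ltxx.
    by rewrite ltr_pM2r.
  apply: countable_bigcupT_measurable; first exact: countableP.
  move=> q.
  pose u : 'cV[R]_p := map_mx ratr q.
  have -> : [set w | c * enorm u < enorm (M w *m u)]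
      = [set w | (c * enorm u) ^+ 2 < dotv (M w *m u) (M w *m u)].
    by apply/seteqP; split=> w /=; rewrite -enorm_sqr ltr_pXn2r ?nnegrE ?mulr_ge0 ?enorm_ge0.
  apply: measurable_gt_set; apply: measurable_sum_fun => i _.
  have mMu : mx_measurable (fun w => M w *m u).
    by apply: mx_measurableM => //; exact: mx_measurable_cst.
  exact: measurable_funM.
(* A large inequality as a countable intersection of strict ones. The thresholds are truncated at 0
   because [mgt] concerns nonnegative ones. *)
have -> : [set w | eta <= opnorm (M w)]
    = \bigcap_k [set w | Num.max 0 (eta - k.+1%:R^-1) < opnorm (M w)].
  apply/seteqP; split=> [w /= h k _ /=|w h /=].
    rewrite gt_max (lt_le_trans eta0 h) /=; apply: lt_le_trans h.
    by rewrite ltrBlDr ltrDl invr_gt0.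
  apply/ler_addgt0Pr => e e0; have [k hk] := ltr_add_invr e0.
  have /= := h k I; rewrite gt_max => /andP[_ h1].
  by move: hk h1; rewrite add0r; move: (k.+1%:R^-1) (opnorm _) => q o; lra.
apply: bigcapT_measurable => k; apply: mgt; by rewrite le_max lexx.
Qed.

End OpnormMeasurable.

(** * The predictive risk as a trace formula *)

Section LawTransfer.
Context {R : realType} {d : measure_display} {T : measurableType d}.
Variable P : probability T R.
Local Notation L1 := (L1 P).
Local Notation EE := (EE P).

Lemma expectation_EE (f : T -> R) r : ('E_P[f] = r%:E)%E -> EE f = r.
Proof. by rewrite unlock /EE => ->. Qed.

Lemma expectation_L1 (f : T -> R) r : measurable_fun [set: T] f ->
  (forall w, 0 <= f w) -> ('E_P[f] <= r%:E)%E -> L1 f.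
Proof.
rewrite unlock => mf f0 h; apply: L1_ge0 => //.
exact: le_lt_trans h (ltry _).
Qed.

Lemma EE_transfer (f g : T -> R) :
  measurable_fun [set: T] f -> measurable_fun [set: T] g ->
  (forall B, measurable B -> P (f @^-1` B) = P (g @^-1` B)) ->
  L1 g -> L1 f /\ EE f = EE g.
Proof.
move=> mf mg fg Lg.
pose X : {RV P >-> R} := HB.pack f (isMeasurableFun.Build _ _ _ _ _ mf).
pose Y : {RV P >-> R} := HB.pack g (isMeasurableFun.Build _ _ _ _ _ mg).
have dE (h : R -> \bar R) : (\int[distribution P X]_x h x = \int[distribution P Y]_x h x)%E.
  by apply: eq_measure_integral => A mA _; exact: fg.
have mid : measurable_fun [set: measurableTypeR R] (fun x : measurableTypeR R => (x : R)%:E).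
  exact/measurable_EFinP.
have mabs : measurable_fun [set: measurableTypeR R] (fun x : measurableTypeR R => `|(x : R)|%:E).
  by apply/measurable_EFinP; exact: normr_measurable.
have Lf : L1 f.
  apply/integrableP; split; first exact/measurable_EFinP.
  have -> : (\int[P]_w `|(EFin \o f) w| = \int[distribution P X]_x `|x|%:E)%E.
    by rewrite ge0_integral_distribution.
  rewrite dE ge0_integral_distribution //.
  by have /integrableP[] := Lg.
split=> //; rewrite /EE.
have -> : (\int[P]_w (f w)%:E = \int[distribution P X]_x x%:E)%E.
  by rewrite integral_distribution.
by rewrite dE integral_distribution.
Qed.

Lemma same_law_EE m k (V W : T -> 'M[R]_(m, k)) (f : 'M[R]_(m, k) -> R) :
  random_mx V -> random_mx W -> same_law P V W ->
  (forall B, measurable B -> measurable_mx (f @^-1` B)) ->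
  L1 (f \o W) -> L1 (f \o V) /\ EE (f \o V) = EE (f \o W).
Proof.
move=> rV rW VW mf; apply: EE_transfer.
- by move=> _ B mB; rewrite setTI; apply: rV; exists (f @^-1` B); [exact: mf|rewrite setTI].
- by move=> _ B mB; rewrite setTI; apply: rW; exists (f @^-1` B); [exact: mf|rewrite setTI].
- by move=> B mB; exact: (VW _ (mf _ mB)).
Qed.

Lemma measurable_mx_entryM m k i j i' j' (B : set R) : measurable B ->
  measurable_mx ((fun M : 'M[R]_(m, k) => M i j * M i' j') @^-1` B).
Proof.
pose gen := [set A | exists i j, exists2 B : set R, measurable B &
                 A = [set M : 'M[R]_(m, k) | B (M i j)]].
have me a b : measurable_fun [set: g_sigma_algebraType gen] (fun M : 'M[R]_(m, k) => M a b).
  by move=> _ C mC; rewrite setTI; apply: sub_sigma_algebra; exists a, b, C.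
move=> mB; have := measurable_funM (me i j) (me i' j') measurableT mB.
by rewrite setTI.
Qed.

Lemma EE_mutually_independent (I : finType) (F : I -> set (set T)) i j (f g : T -> R) :
  (forall i, sigma_algebra setT (F i)) -> (forall i, F i `<=` measurable) ->
  mutually_independent P F -> i != j ->
  sub_measurable (F i) f -> sub_measurable (F j) g -> L1 f -> L1 g ->
  L1 (fun w => f w * g w) /\ EE (fun w => f w * g w) = EE f * EE g.
Proof.
move=> sF mF indF ij sf sg; apply: independent2_EEM sf sg => //.
apply: independent2S (independent2_group (J := pred1 i) sF mF indF).
  by apply: sub_sigma_algebra2 => A FA; exists i => //=.
by apply: sub_sigma_algebra2 => A FA; exists j => //=; rewrite eq_sym.
Qed.

Section Bilinear.
Variables (F G : set (set T)).
Hypotheses (mF : F `<=` measurable) (mG : G `<=` measurable).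
Hypothesis FG : independent2 P <<s F >> <<s G >>.
Variables (a b : nat) (C : T -> 'M[R]_(a, b)) (x : T -> 'cV[R]_a) (u : T -> 'cV[R]_b).
Variables (M : 'M[R]_a) (N : 'M[R]_b).
Hypothesis sC : forall i j, sub_measurable F (fun w => C w i j).
Hypothesis sx : forall i, sub_measurable G (fun w => x w i 0).
Hypothesis su : forall i, sub_measurable G (fun w => u w i 0).
Hypothesis xu : forall i i' j j',
  L1 (fun w => (x w i 0 * x w i' 0) * (u w j 0 * u w j' 0)) /\
  EE (fun w => (x w i 0 * x w i' 0) * (u w j 0 * u w j' 0)) = M i i' * N j j'.

(** The form is a combination of the products x_i u_j with coefficients C_ij measurable for F.
    Averaging its square replaces x_i x_i' u_j u_j' by M_ii' N_jj', and the resulting quadruple sum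
    is the trace. *)
Lemma cond_expectation_bilinear (g : T -> R) e :
  is_cond_expectation P <<s F >> (fun w => ((x w)^T *m C w *m u w) 0 0 ^+ 2) g ->
  0 < e ->
  measurable [set w | e < `|g w - \tr (M^T *m (C w *m N *m (C w)^T))|] /\
  P [set w | e < `|g w - \tr (M^T *m (C w *m N *m (C w)^T))|] = 0%E.
Proof.
move=> cg e0.
pose c (m : 'I_a * 'I_b) w := C w m.1 m.2.
pose v (m : 'I_a * 'I_b) w := x w m.1 0 * u w m.2 0.
have vv m m' : (fun w => v m w * v m' w)
    = (fun w => (x w m.1 0 * x w m'.1 0) * (u w m.2 0 * u w m'.2 0)).
  by apply/funext => w; rewrite /v; ring.
have lossE : (fun w => ((x w)^T *m C w *m u w) 0 0 ^+ 2) = (fun w => (\sum_m c m w * v m w) ^+ 2).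
  apply/funext => w; congr (_ ^+ 2).
  rewrite -(pair_bigA _ (fun i j => c (i, j) w * v (i, j) w)) exchange_big mxE.
  apply: eq_bigr => j _; rewrite mxE mulr_suml; apply: eq_bigr => i _.
  by rewrite /c /v !mxE; ring.
rewrite lossE in cg.
have hE w : \tr (M^T *m (C w *m N *m (C w)^T))
    = \sum_m \sum_m' c m w * c m' w * EE (fun w => v m w * v m' w).
  rewrite -(pair_bigA _ (fun i j => \sum_m' c (i, j) w * c m' w * EE (fun w => v (i, j) w * v m' w))) /=.
  have -> : \tr (M^T *m (C w *m N *m (C w)^T)) = \sum_i \sum_i' M i i' * (C w *m N *m (C w)^T) i i'.
    rewrite exchange_big; apply: eq_bigr => i' _; rewrite mxE.
    by apply: eq_bigr => i _; rewrite mxE.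
  apply: eq_bigr => i _.
  under [RHS]eq_bigr => j _ do
    rewrite -(pair_bigA _ (fun i' j' => c (i, j) w * c (i', j') w * EE (fun w => v (i, j) w * v (i', j') w))) /=.
  rewrite [RHS]exchange_big /=; apply: eq_bigr => i' _.
  rewrite [RHS]exchange_big /= mxE mulr_sumr; apply: eq_bigr => j' _.
  rewrite mxE mulr_suml mulr_sumr; apply: eq_bigr => j _.
  by rewrite vv /= (xu i i' j j').2 /c mxE /=; ring.
have := cond_expectation_square mF mG FG (c := c) (v := v) _ _ _ cg e0.
rewrite (_ : [set w | e < `|g w - \tr (M^T *m (C w *m N *m (C w)^T))|]
  = [set w | e < `|g w - \sum_m \sum_m' c m w * c m' w * EE (fun w => v m w * v m' w)|]); last first.
  by apply/funext => w; rewrite /= hE.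
apply.
- by move=> m; exact: sC.
- by move=> m; exact: sub_measurableM.
- by move=> m m'; rewrite vv; exact: (xu _ _ _ _).1.
Qed.

End Bilinear.

Definition moments m (U : T -> 'cV[R]_m) (A : 'M[R]_m) : Prop :=
  [/\ forall i, L1 (fun w => U w i 0), forall i, EE (fun w => U w i 0) = 0 &
      forall i j, L1 (fun w => U w i 0 * U w j 0) /\ EE (fun w => U w i 0 * U w j 0) = A i j].

(** Independence and zero means make the mixed second moments vanish. *)
Lemma moments_col_mx (F G : set (set T)) m k (U : T -> 'cV[R]_m) (V : T -> 'cV[R]_k) A B :
  F `<=` measurable -> G `<=` measurable -> independent2 P <<s F >> <<s G >> ->
  (forall i, sub_measurable F (fun w => U w i 0)) ->
  (forall i, sub_measurable G (fun w => V w i 0)) ->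
  moments U A -> moments V B -> moments (fun w => col_mx (U w) (V w)) (block_mx A 0 0 B).
Proof.
move=> mF mG FG sU sV [LU EU UU] [LV EV VV].
have UV i j := independent2_EEM mF mG FG (sU i) (sV j) (LU i) (LV j).
have e1 w i : col_mx (U w) (V w) (lshift k i) 0 = U w i 0 by rewrite col_mxEu.
have e2 w i : col_mx (U w) (V w) (rshift m i) 0 = V w i 0 by rewrite col_mxEd.
split.
- move=> i; case: (split_ordP i) => j ->.
    by under eq_fun do rewrite e1.
  by under eq_fun do rewrite e2.
- move=> i; case: (split_ordP i) => j ->.
    by under eq_fun do rewrite e1.
  by under eq_fun do rewrite e2.
move=> i i'; case: (split_ordP i) => j ->; case: (split_ordP i') => j' ->.
- by under eq_fun do rewrite !e1; rewrite block_mxEul.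
- under eq_fun do rewrite e1 e2; rewrite block_mxEur mxE; split; first by case: (UV j j').
  by rewrite (UV j j').2 EU mul0r.
- under eq_fun do rewrite e1 e2 mulrC; rewrite block_mxEdl mxE; split; first by case: (UV j' j).
  by rewrite (UV j' j).2 EU mul0r.
- by under eq_fun do rewrite !e2; rewrite block_mxEdr.
Qed.

End LawTransfer.

(** * The loss as the square of a bilinear form *)

Section RiskAlgebra.
Context {R : realType} (n p : nat) (lambda sigma : R) (Sigma Omega A : 'M[R]_p) (X : 'M[R]_(n, p)).
Hypotheses (n0 : (0 < n)%N) (l0 : 0 < lambda) (pA : posdefmx A).
Local Notation Q := (ridge_resolvent lambda A X).

(* The loss is the square of the bilinear form with matrix loss_coef in the
   independent vectors (xnew, 1) and (beta, eps, epsnew). *)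
Definition loss_coef : 'M[R]_(p + 1, p + (n + 1)) :=
  block_mx (- lambda *: (Q *m invmx A)) (row_mx (n%:R^-1 *: (Q *m X^T)) 0)
           0 (row_mx 0 (- 1%:M)).

Let nn : n%:R != 0 :> R. Proof. by rewrite pnatr_eq0 -lt0n. Qed.

Lemma gridgeE y : gridge lambda X y A = n%:R^-1 *: (Q *m X^T *m y).
Proof.
rewrite /gridge.
have -> : X^T *m X + (n%:R * lambda) *: invmx A
    = n%:R *: (sample_cov X + lambda *: invmx A).
  by rewrite scalerDr scalerA /sample_cov scalerA divff // scale1r.
by rewrite invmxZ ?unitmxZ ?unitfE ?ridge_unitmx // -!scalemxAl.
Qed.

Lemma prediction_lossE b e x e' : prediction_loss lambda X b e x e' A
  = ((col_mx x (1%:M : 'cV[R]_1))^T *m loss_coef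
      *m col_mx b (col_mx e (const_mx e' : 'cV[R]_1))) 0 0 ^+ 2.
Proof.
rewrite /prediction_loss; congr (_ ^+ 2).
rewrite gridgeE /loss_coef tr_col_mx mul_row_block mulmx0 addr0 mul_row_col.
rewrite !mul_mx_row !mulmx0 tr_scalar_mx mul1mx add_row_mx addr0 add0r mul_row_col.
rewrite mulNmx mul1mx.
(* Q hatSigma - 1 = - lambda Q A^-1, because Q is the inverse of hatSigma + lambda A^-1. *)
have -> : - lambda *: (Q *m invmx A) = n%:R^-1 *: (Q *m X^T *m X) - 1%:M.
  apply/eqP; rewrite eq_sym subr_eq addrC -subr_eq.
  have -> : n%:R^-1 *: (Q *m X^T *m X) = Q *m sample_cov X.
    by rewrite /sample_cov -scalemxAr mulmxA.
  rewrite scaleNr opprK scalemxAr -mulmxDr.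
  by rewrite /ridge_resolvent /gen_resolvent mulVmx // ridge_unitmx.
have -> : x^T *m (n%:R^-1 *: (Q *m X^T *m (X *m b + e)))
    = n%:R^-1 *: (x^T *m Q *m X^T *m X *m b) + n%:R^-1 *: (x^T *m Q *m X^T *m e).
  by rewrite mulmxDr scalerDr mulmxDr -!scalemxAr !mulmxA.
have -> : x^T *m (n%:R^-1 *: (Q *m X^T *m X) - 1%:M) *m b
    = n%:R^-1 *: (x^T *m Q *m X^T *m X *m b) - x^T *m b.
  by rewrite mulmxBr mulmx1 mulmxBl -scalemxAr -scalemxAl !mulmxA.
have -> : x^T *m (n%:R^-1 *: (Q *m X^T)) *m e = n%:R^-1 *: (x^T *m Q *m X^T *m e).
  by rewrite -scalemxAr -scalemxAl !mulmxA.
move: (_ *: (x^T *m Q *m X^T *m X *m b)) (_ *: (x^T *m Q *m X^T *m e)) (x^T *m b) => a c f.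
rewrite !mxE.
by ring.
Qed.

(** The vector m stands for the mean of xnew. It meets the off-diagonal blocks of C N C^T, where C
    is the loss matrix and N the covariance of the noise and coefficients; these blocks are 0. *)
Lemma trace_loss_coef (m : 'cV[R]_p) : posdefmx Omega -> Sigma^T = Sigma -> (0 < p)%N ->
  \tr ((block_mx Sigma m m^T (1%:M : 'M[R]_1))^T
    *m (loss_coef *m block_mx (p%:R^-1 *: Omega) 0 0
          (block_mx (sigma ^+ 2)%:M 0 0 (sigma ^+ 2)%:M : 'M[R]_(n + 1)) *m loss_coef^T))
  = risk_formula lambda sigma Sigma Omega A X.
Proof.
move=> pO tS p0; have tQ := tr_ridge_resolvent X l0 pA.
have tA : (invmx A)^T = invmx A := (posdef_inv pA).1.
rewrite /loss_coef mulmx_block !mulmx0 !mul0mx !addr0 !add0r mul_row_block !mulmx0 addr0 add0r.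
rewrite mul_row_block !mulmx0 !mul0mx addr0 !add0r.
rewrite !tr_block_mx !tr_row_mx !trmx0 mulmx_block !mul0mx ?mulmx0 !mul_row_col.
rewrite !mulmx0 !mul0mx !addr0 !add0r.
rewrite mulmx_block !mulmx0 !addr0 !add0r mxtrace_block tS.
have -> : - 1%:M *m (sigma ^+ 2)%:M *m (- 1%:M)^T = (sigma ^+ 2)%:M :> 'M[R]_1.
  by rewrite raddfN /= trmx1 mulNmx mulmxN mulNmx mul1mx mulmx1 opprK.
rewrite trmx1 mul1mx mxtrace_scalar mulr1n mulmxDr raddfD /= /risk_formula -[RHS]addrA [RHS]addrC; congr (_ + _ + _).
  rewrite [(_ *: (_ *m _))^T]linearZ /= trmx_mul tA tQ -!scalemxAl -!scalemxAr -!scalemxAl -!scalemxAr.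
  by rewrite !scalerA mxtraceZ !mulmxA; congr (_ * _); ring.
rewrite [(_ *: (_ *m _))^T]linearZ /= trmx_mul trmxK tQ -!scalemxAl mul_mx_scalar /sample_cov.
rewrite -!scalemxAr -!scalemxAl -!scalemxAr !scalerA !mxtraceZ !mulmxA mulrA; congr (_ * _).
by field.
Qed.

End RiskAlgebra.

(** * Moments in the test-task model and the almost sure form of the risk *)

Section RiskVersion.
Context {R : realType} {d : measure_display} {T : measurableType d}.
Variables (P : probability T R) (n p : nat).
Local Notation L1 := (L1 P).
Local Notation EE := (EE P).
Variables (lambda cm cop sigma : R) (Sigma Omega : 'M[R]_p)
  (Z : T -> 'M[R]_(n, p)) (beta : T -> 'cV[R]_p) (eps : T -> 'cV[R]_n)
  (xnew : T -> 'cV[R]_p) (epsnew : T -> R) (Omegahat : T -> 'M[R]_p).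
Hypothesis M : test_task_model P cm cop sigma Sigma Omega Z beta eps xnew epsnew Omegahat.
Hypotheses (n0 : (0 < n)%N) (l0 : 0 < lambda).

Let X := design Sigma Z.
Let fam (k : 'I_6) := nth set0 [:: sigma_mx X; sigma_mx beta; sigma_mx eps;
                 sigma_mx xnew; sigma_rv epsnew; sigma_mx Omegahat] k.

Let pSigma : possemidefmx Sigma := posdef_psd (Sigma_posdef M).

Let mZ i j : measurable_fun [set: T] (fun w => Z w i j).
Proof. exact: (random_mx_measurable (Z_random M)). Qed.

Lemma random_mxP m k (V : T -> 'M[R]_(m, k)) : mx_measurable V -> random_mx V.
Proof.
move=> mV; pose g := [set A | exists i j, exists2 B : set R, measurable B &
                 A = [set N : 'M[R]_(m, k) | B (N i j)]].
suff h : @measurable_fun _ _ T (g_sigma_algebraType g) [set: T] V.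
  by move=> _ [B mB <-]; exact: h.
apply: measurability; first by [].
move=> _ [_ [i [j [B mB ->]]] <-].
by have := mV i j measurableT B mB.
Qed.

Lemma design_random : random_mx X.
Proof.
apply: random_mxP; apply: mx_measurableM => //; exact: mx_measurable_cst.
Qed.

Let sfam k : sigma_algebra setT (fam k).
Proof.
by case: k => [[|[|[|[|[|[|//]]]]]] hk]; apply: sigma_algebra_preimage;
  rewrite /measurable_mx; try exact: smallest_sigma_algebra; exact: sigma_algebra_measurable.
Qed.

Let mfam k : fam k `<=` measurable.
Proof.
case: k => [[|[|[|[|[|[|//]]]]]] hk]; rewrite /fam /=.
- exact: design_random.
- exact: (beta_random M).
- exact: (eps_random M).
- exact: (xnew_random M).
- exact: (epsnew_random M).
- exact: (Omegahat_random M).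
Qed.

Let group (J : pred 'I_6) := independent2_group (J := J) sfam mfam (test_task_independent M).

Let sub_fam (J : pred 'I_6) k (f : T -> R) : J k -> sub_measurable (fam k) f ->
  sub_measurable (\bigcup_(i in [set i | J i]) fam i) f.
Proof. by move=> Jk; apply: sub_measurableS; apply: sub_sigma_algebra2 => A FA; exists k. Qed.

Let mbig (J : pred 'I_6) : \bigcup_(i in [set i | J i]) fam i `<=` measurable.
Proof. by move=> A [k _]; exact: mfam. Qed.

Let kX : 'I_6 := inord 0. Let kb : 'I_6 := inord 1. Let ke : 'I_6 := inord 2.
Let kx : 'I_6 := inord 3. Let kn : 'I_6 := inord 4. Let kO : 'I_6 := inord 5.

Let sbeta i : sub_measurable (fam kb) (fun w => beta w i 0).
Proof. by rewrite /fam inordK //; exact: sub_measurable_entry. Qed.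
Let seps i : sub_measurable (fam ke) (fun w => eps w i 0).
Proof. by rewrite /fam inordK //; exact: sub_measurable_entry. Qed.
Let sx i : sub_measurable (fam kx) (fun w => xnew w i 0).
Proof. by rewrite /fam inordK //; exact: sub_measurable_entry. Qed.
Let sepsn : sub_measurable (fam kn) epsnew.
Proof. by rewrite /fam inordK //; exact: sub_measurable_self. Qed.

Let fam_fun k (f : T -> R) : sub_measurable (fam k) f -> measurable_fun [set: T] f.
Proof. exact/sub_measurable_fun/mfam. Qed.

Let zvar (ij : 'I_n * 'I_p) w := Z w ij.1 ij.2.

Let LZ i j : L1 (fun w => Z w i j ^+ 2).
Proof.
apply: (@expectation_L1 _ _ _ _ _ 1); first exact: measurable_funX.
- by move=> w; exact: sqr_ge0.
- by rewrite (Z_variance M).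
Qed.

Lemma Z_row_moments i a b : L1 (fun w => Z w i a * Z w i b) /\
  EE (fun w => Z w i a * Z w i b) = (a == b)%:R.
Proof.
have [->|ab] := eqVneq a b.
  under eq_fun do rewrite -expr2; split=> //.
  exact: expectation_EE (Z_variance M i b).
have [] := @EE_mutually_independent _ _ _ P _ (fun ij => sigma_rv (zvar ij)) (i, a) (i, b)
    (fun w => Z w i a) (fun w => Z w i b) _ _ (Z_iid M).1 _ _ _ _ _.
- by move=> ij; exact: sigma_algebra_sigma_rv.
- by move=> ij; apply: sigma_rv_measurable; exact: mZ.
- by rewrite xpair_eqE (negbTE ab) andbF.
- exact: sub_measurable_self.
- exact: sub_measurable_self.
- exact: L1_sqr.
- exact: L1_sqr.
move=> h1 h2; split=> //.
by rewrite h2 (expectation_EE (Z_mean M i a)) mul0r.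
Qed.

Lemma design_row_moments i k l : L1 (fun w => X w i k * X w i l) /\
  EE (fun w => X w i k * X w i l) = Sigma k l.
Proof.
pose S := mxsqrt Sigma.
have XE : (fun w => X w i k * X w i l)
  = (fun w => \sum_a \sum_b (S a k * S b l) * (Z w i a * Z w i b)).
  apply/funext => w; rewrite /X /design !mxE mulr_suml; apply: eq_bigr => a _.
  by rewrite mulr_sumr; apply: eq_bigr => b _; rewrite -/S; ring.
rewrite XE; split.
  by apply: L1_sum => a _; apply: L1_sum => b _; apply: L1Z; case: (Z_row_moments i a b).
rewrite EE_sum; last first.
  by move=> a _; apply: L1_sum => b _; apply: L1Z; case: (Z_row_moments i a b).
rewrite -(mxsqrt_sq pSigma) mxE; apply: eq_bigr => a _.
rewrite EE_sum; last by move=> b _; apply: L1Z; case: (Z_row_moments i a b).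
rewrite (bigD1 a) //= big1 ?addr0.
  rewrite EEZ; last by case: (Z_row_moments i a a).
  rewrite (Z_row_moments i a a).2 eqxx mulr1; congr (_ * _).
  by rewrite -[in RHS](tr_mxsqrt pSigma) mxE.
move=> b ba; rewrite EEZ; last by case: (Z_row_moments i a b).
by rewrite (Z_row_moments i a b).2 eq_sym (negbTE ba) mulr0.
Qed.

Lemma xnew_moments k l : L1 (fun w => xnew w k 0 * xnew w l 0) /\
  EE (fun w => xnew w k 0 * xnew w l 0) = Sigma k l.
Proof.
pose i0 := Ordinal n0.
pose W w := (row i0 (X w))^T.
have WE : (fun w => W w k 0 * W w l 0) = (fun w => X w i0 k * X w i0 l).
  by apply/funext => w; rewrite /W !mxE.
have [h1 h2] := design_row_moments i0 k l; rewrite -WE in h1 h2.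
have rW : random_mx W.
  apply: random_mxP; apply: mx_measurable_tr; apply: mx_measurable_row.
  by apply: random_mx_measurable; exact: design_random.
have := @same_law_EE _ _ _ P _ _ xnew W (fun v => v k 0 * v l 0) (xnew_random M) rW (xnew_law M i0).
by rewrite -h2; apply => //; exact: measurable_mx_entryM.
Qed.

Let Lx k : L1 (fun w => xnew w k 0).
Proof.
apply: L1_sqr; first exact: fam_fun (sx k).
by under eq_fun do rewrite expr2; case: (xnew_moments k k).
Qed.

Let moments_of m (U : T -> 'cV[R]_m) (A : 'M[R]_m) :
  (forall i, measurable_fun [set: T] (fun w => U w i 0)) ->
  (forall i, ('E_P[fun w => U w i ord0] = 0)%E) ->
  (forall i j, ('E_P[fun w => (U w i ord0 * U w j ord0)%R] = (A i j)%:E)%E) ->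
  moments P U A.
Proof.
move=> mU EU EUU.
have LU i : L1 (fun w => U w i 0 ^+ 2).
  apply: (@expectation_L1 _ _ _ _ _ (A i i)); first exact: measurable_funX.
  - by move=> w; exact: sqr_ge0.
  - by under eq_fun do rewrite expr2; rewrite EUU.
split.
- by move=> i; exact: L1_sqr.
- by move=> i; exact: expectation_EE (EU i).
- by move=> i j; split; [exact: L1_mul|exact: expectation_EE (EUU i j)].
Qed.

Let u w := col_mx (beta w) (col_mx (eps w) (const_mx (epsnew w) : 'cV[R]_1)).
Let N := block_mx (p%:R^-1 *: Omega) 0 0 (block_mx (sigma ^+ 2)%:M 0 0 (sigma ^+ 2)%:M : 'M[R]_(n + 1)).

Let momN : moments P (fun w => const_mx (epsnew w) : 'cV[R]_1) (sigma ^+ 2)%:M.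
Proof.
apply: moments_of.
- by move=> i; under eq_fun do rewrite mxE; exact: fam_fun sepsn.
- by move=> i; under eq_fun do rewrite mxE; exact: epsnew_mean M.
- move=> i j; under eq_fun do rewrite !mxE -expr2.
  by rewrite (epsnew_variance M) !ord1 mxE eqxx mulr1n.
Qed.

Let snoise i : sub_measurable (\bigcup_(k in [set k | (k == ke) || (k == kn)]) fam k)
  (fun w => col_mx (eps w) (const_mx (epsnew w) : 'cV[R]_1) i 0).
Proof.
case: (split_ordP i) => j ->.
  have -> : (fun w => col_mx (eps w) (const_mx (epsnew w) : 'cV[R]_1) (lshift 1 j) 0)
    = (fun w => eps w j 0) by apply/funext => w; rewrite col_mxEu.
  by apply: sub_fam (seps j); rewrite eqxx.
have -> : (fun w => col_mx (eps w) (const_mx (epsnew w) : 'cV[R]_1) (rshift n j) 0)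
    = epsnew by apply/funext => w; rewrite col_mxEd mxE.
by apply: sub_fam sepsn; rewrite eqxx orbT.
Qed.

Let inord_neq (a b : nat) : (a < 6)%N -> (b < 6)%N -> a != b -> (inord a : 'I_6) != inord b.
Proof. by move=> ha hb ab; rewrite -(inj_eq val_inj) /= !inordK. Qed.

Let momu : moments P u N.
Proof.
apply: (@moments_col_mx _ _ _ _ (\bigcup_(k in [set k | k == kb]) fam k)
    (\bigcup_(k in [set k | (k == ke) || (k == kn)]) fam k)).
- exact: mbig.
- exact: mbig.
- apply: (independent2S _ _ (@group (pred1 kb))) => //.
  apply: sub_sigma_algebra2 => A [k /= /orP[] /eqP -> FA].
    by exists ke => //=; exact: inord_neq.
  by exists kn => //=; exact: inord_neq.
- by move=> i; apply: sub_fam (sbeta i); rewrite eqxx.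
- exact: snoise.
- apply: moments_of.
  + by move=> i; exact: fam_fun (sbeta i).
  + exact: beta_mean M.
  + by move=> i j; rewrite (beta_cov M) mxE mulrC.
apply: (@moments_col_mx _ _ _ _ (\bigcup_(k in [set k | k == ke]) fam k)
    (\bigcup_(k in [set k | ~~ (k == ke)]) fam k)).
- exact: mbig.
- exact: mbig.
- exact: (@group (pred1 ke)).
- by move=> i; apply: sub_fam (seps i); rewrite eqxx.
- move=> i; have -> : (fun w => (const_mx (epsnew w) : 'cV[R]_1) i 0) = epsnew.
    by apply/funext => w; rewrite mxE.
  by apply: (@sub_fam (fun k => k != ke) _ _ _ sepsn); exact: inord_neq.
- apply: moments_of.
  + by move=> i; exact: fam_fun (seps i).
  + exact: eps_mean M.
  + by move=> i j; rewrite (eps_cov M) mxE.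
- exact: momN.
Qed.

Let su i : sub_measurable (\bigcup_(k in [set k | [|| k == kb, k == ke | k == kn]]) fam k)
  (fun w => u w i 0).
Proof.
case: (split_ordP i) => j ->.
  have -> : (fun w => u w (lshift _ j) 0) = (fun w => beta w j 0).
    by apply/funext => w; rewrite /u col_mxEu.
  by apply: sub_fam (sbeta j); rewrite eqxx.
have -> : (fun w => u w (rshift _ j) 0)
    = (fun w => col_mx (eps w) (const_mx (epsnew w) : 'cV[R]_1) j 0).
  by apply/funext => w; rewrite /u col_mxEd.
apply: sub_measurableS (snoise j).
by apply: sub_sigma_algebra2 => A [k /= hk FA]; exists k => //=; rewrite hk orbT.
Qed.

Let x1 w := col_mx (xnew w) (1%:M : 'cV[R]_1).
Let m1 : 'cV[R]_p := \col_i EE (fun w => xnew w i 0).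
Let Mx := block_mx Sigma m1 m1^T (1%:M : 'M[R]_1).

Let sx1 i : sub_measurable (\bigcup_(k in [set k | k == kx]) fam k) (fun w => x1 w i 0).
Proof.
case: (split_ordP i) => j ->.
  have -> : (fun w => x1 w (lshift _ j) 0) = (fun w => xnew w j 0).
    by apply/funext => w; rewrite /x1 col_mxEu.
  by apply: sub_fam (sx j); rewrite eqxx.
have -> : (fun w => x1 w (rshift _ j) 0) = (fun=> (1%:M : 'cV[R]_1) j 0).
  by apply/funext => w; rewrite /x1 col_mxEd.
exact: sub_measurable_cst.
Qed.

Let x1_moments i j : L1 (fun w => x1 w i 0 * x1 w j 0) /\
  EE (fun w => x1 w i 0 * x1 w j 0) = Mx i j.
Proof.
have e1 w k : x1 w (lshift 1 k) 0 = xnew w k 0 by rewrite /x1 col_mxEu.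
have e2 w (k : 'I_1) : x1 w (rshift p k) 0 = 1.
  by rewrite /x1 col_mxEd mxE ord1 eqxx.
case: (split_ordP i) => k ->; case: (split_ordP j) => l ->.
- under eq_fun do rewrite !e1; rewrite block_mxEul; exact: xnew_moments.
- under eq_fun do rewrite e1 e2 mulr1; rewrite block_mxEur mxE; split=> //.
- under eq_fun do rewrite e1 e2 mul1r; rewrite block_mxEdl !mxE; split=> //.
- under eq_fun do rewrite !e2 mulr1; rewrite block_mxEdr mxE !ord1 eqxx.
  by split; [exact: L1_cst|exact: EE_cst].
Qed.

Let mleft : sigma_mx X `|` sigma_mx Omegahat `<=` measurable.
Proof. by move=> A [FA|FA]; [exact: design_random|exact: (Omegahat_random M)]. Qed.

Let sX i j : sub_measurable (sigma_mx X `|` sigma_mx Omegahat) (fun w => X w i j).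
Proof.
by apply: (sub_measurableS _ (@sub_measurable_entry _ _ _ _ _ X i j)); apply: sub_sigma_algebra2; exact: subsetUl.
Qed.

Let sO i j : sub_measurable (sigma_mx X `|` sigma_mx Omegahat) (fun w => Omegahat w i j).
Proof.
by apply: (sub_measurableS _ (@sub_measurable_entry _ _ _ _ _ Omegahat i j)); apply: sub_sigma_algebra2; exact: subsetUr.
Qed.

Let sC i j : sub_measurable (sigma_mx X `|` sigma_mx Omegahat)
  (fun w => loss_coef lambda (Omegahat w) (X w) i j).
Proof.
set F := _ `|` _.
have mX : @mx_measurable R _ (g_sigma_algebraType F) _ _ X by exact: sX.
have mXt : @mx_measurable R _ (g_sigma_algebraType F) _ _ (fun w => (X w)^T) by exact: mx_measurable_tr.
have mOi : @mx_measurable R _ (g_sigma_algebraType F) _ _ (fun w => invmx (Omegahat w)).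
  apply: mx_measurable_inv; last exact: sO.
  by move=> w; exact: posdef_unitmx (Omegahat_posdef M w).
have mQ : @mx_measurable R _ (g_sigma_algebraType F) _ _
    (fun w => ridge_resolvent lambda (Omegahat w) (X w)).
  apply: mx_measurable_inv.
    by move=> w; exact: ridge_unitmx (Omegahat_posdef M w).
  apply: mx_measurableD; last exact: mx_measurableZ.
  by apply: mx_measurableZ; exact: mx_measurableM.
have mG1 : @mx_measurable R _ (g_sigma_algebraType F) _ _
    (fun w => - lambda *: (ridge_resolvent lambda (Omegahat w) (X w) *m invmx (Omegahat w))).
  by apply: mx_measurableZ; exact: mx_measurableM.
have mG2 : @mx_measurable R _ (g_sigma_algebraType F) _ _
    (fun w => n%:R^-1 *: (ridge_resolvent lambda (Omegahat w) (X w) *m (X w)^T)).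
  by apply: mx_measurableZ; exact: mx_measurableM.
rewrite /loss_coef.
case: (split_ordP i) => k ->; case: (split_ordP j) => l ->.
- under eq_fun do rewrite block_mxEul; exact: mG1.
- under eq_fun do rewrite block_mxEur; case: (split_ordP l) => l' ->.
    under eq_fun do rewrite row_mxEl; exact: mG2.
  by under eq_fun do rewrite row_mxEr; exact: sub_measurable_cst.
- by under eq_fun do rewrite block_mxEdl; exact: sub_measurable_cst.
- by under eq_fun do rewrite block_mxEdr; exact: sub_measurable_cst.
Qed.

(** The design and Omegahat are independent of the group (beta, eps, xnew, epsnew), and inside this
    group xnew is independent of the other three, so its second moments factor as
    [cond_expectation_bilinear] demands. *)
Lemma risk_formula_ae (risk : T -> R) e : (0 < p)%N ->
  is_predictive_risk P lambda Sigma Z beta eps xnew epsnew Omegahat risk -> 0 < e ->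
  measurable [set w | e < `|risk w - risk_formula lambda sigma Sigma Omega (Omegahat w) (X w)|] /\
  P [set w | e < `|risk w - risk_formula lambda sigma Sigma Omega (Omegahat w) (X w)|] = 0%E.
Proof.
move=> p0 hr e0.
pose G := \bigcup_(k in [set k | ~~ ((k == kX) || (k == kO))]) fam k.
have tS : Sigma^T = Sigma := pSigma.1.
have := @cond_expectation_bilinear _ _ _ P (sigma_mx X `|` sigma_mx Omegahat) G mleft (@mbig _) _ _ _
   (fun w => loss_coef lambda (Omegahat w) (X w)) x1 u Mx N sC _ _ _ risk e.
have rE w : risk_formula lambda sigma Sigma Omega (Omegahat w) (X w)
    = \tr (Mx^T *m (loss_coef lambda (Omegahat w) (X w) *m N *m (loss_coef lambda (Omegahat w) (X w))^T)).
  by rewrite trace_loss_coef //; [exact: Omegahat_posdef M w|exact: Omega_posdef M].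
under [X in _ -> measurable X /\ _]eq_fun do rewrite rE.
under [X in _ -> _ /\ P X = _]eq_fun do rewrite rE.
apply => //.
- apply: independent2S (@group (fun k => (k == kX) || (k == kO))) => //.
  apply: sub_sigma_algebra2 => A [FA|FA]; [exists kX|exists kO] => //=; rewrite ?eqxx ?orbT //.
    by rewrite /fam inordK.
  by rewrite /fam inordK.
- move=> i; apply: sub_measurableS (sx1 i); apply: sub_sigma_algebra2 => A [k /= /eqP -> FA].
  by exists kx => //=; rewrite negb_or !inord_neq.
- move=> i; apply: sub_measurableS (su i); apply: sub_sigma_algebra2 => A [k /= hk FA].
  exists k => //=; case/or3P: hk => /eqP ->; by rewrite negb_or !inord_neq.
- move=> i i' j j'; have [Lu _ uu] := momu; rewrite -(uu j j').2 -(x1_moments i i').2.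
  apply: (@independent2_EEM _ _ _ P (\bigcup_(k in [set k | k == kx]) fam k)
    (\bigcup_(k in [set k | [|| k == kb, k == ke | k == kn]]) fam k)).
  + exact: mbig.
  + exact: mbig.
  + apply: (independent2S _ _ (@group (pred1 kx))) => //.
    apply: sub_sigma_algebra2 => A [k /= hk FA].
    by exists k => //=; case/or3P: hk => /eqP ->; exact: inord_neq.
  + by apply: sub_measurableM; exact: sx1.
  + by apply: sub_measurableM; exact: su.
  + exact: (x1_moments i i').1.
  + exact: (uu j j').1.
have -> // : (fun w => ((x1 w)^T *m loss_coef lambda (Omegahat w) (X w) *m u w) 0 0 ^+ 2)
  = (fun w => prediction_loss lambda (X w) (beta w) (eps w) (xnew w) (epsnew w) (Omegahat w)).
by apply/funext => w; rewrite prediction_lossE //; exact: Omegahat_posdef M w.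
Qed.

End RiskVersion.

(** * Weak convergence and the Marchenko-Pastur equation *)

Section WeakConvergence.
Context {R : realType}.

(* Of the second and fourth fifths of an interval, one carries at most half of
   the increment of G; the nested closed intervals shrink to a point of
   continuity. *)
Lemma monotone_continuity_point (G : R -> R) u v :
  {homo G : x y / x <= y} -> (forall x, 0 <= G x <= 1) -> u < v ->
  exists x, [/\ u < x, x < v & {for x, continuous G}].
Proof.
move=> mG G01 uv.
pose lo (ab : R * R) k : R := ab.1 + (ab.2 - ab.1) * k%:R / 5.
pose next (ab : R * R) : R * R :=
  if G (lo ab 2) - G (lo ab 1) <= (G ab.2 - G ab.1) / 2 then (lo ab 1, lo ab 2)
  else (lo ab 3, lo ab 4).
pose s k := iter k next (u, v).
have slt k : (s k).1 < (s k).2.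
  elim: k => [|k IH] //=; rewrite -/(s k) /next /lo.
  by case: ifP => _ /=; lra.
have sin k : (s k).1 < (s k.+1).1 /\ (s k.+1).2 < (s k).2.
  by have := slt k; rewrite /= -/(s k) /next /lo; case: ifP => _ /=; lra.
have svar k : G (s k).2 - G (s k).1 <= 2^-1 ^+ k.
  elim: k => [|k IH] /=.
    by rewrite expr0; have /andP[_ ?] := G01 v; have /andP[? _] := G01 u; lra.
  rewrite -/(s k) exprS /next; case: ifPn => /= [h|].
    by apply: (le_trans h); lra.
  rewrite -ltNge => h.
  have h1 : G (s k).1 <= G (lo (s k) 1) by apply: mG; rewrite /lo; have := slt k; lra.
  have h2 : G (lo (s k) 2) <= G (lo (s k) 3) by apply: mG; rewrite /lo; have := slt k; lra.
  have h3 : G (lo (s k) 4) <= G (s k).2 by apply: mG; rewrite /lo; have := slt k; lra.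
  lra.
have incr k l : (k <= l)%N -> (s k).1 <= (s l).1 /\ (s l).2 <= (s k).2.
  elim: l => [|l IH]; first by rewrite leqn0 => /eqP->.
  rewrite leq_eqVlt => /orP[/eqP->//|]; rewrite ltnS => /IH[h1 h2].
  by have [h3 h4] := sin l; split; [exact: le_trans h1 (ltW h3)|exact: le_trans (ltW h4) h2].
have lr k l : (s k).1 < (s l).2.
  have [kl|lk] := leqP k l.
    by have [h1 _] := incr _ _ kl; exact: le_lt_trans (slt l).
  by have [_ h1] := incr _ _ (ltnW lk); exact: lt_le_trans (slt k) h1.
pose E := [set (s k).1 | k in [set: nat]].
have E0 : E !=set0 by exists (s 0).1, 0%N.
have Eub l : ubound E (s l).2 by move=> _ [k _ <-]; exact/ltW/lr.
pose x := sup E.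
have xlo k : (s k).1 < x.
  apply: lt_le_trans (sin k).1 _; apply: ub_le_sup; first by exists (s 0).2; exact: Eub.
  by exists k.+1.
have xhi k : x < (s k).2.
  apply: le_lt_trans (sin k).2; exact: ge_sup.
exists x; split; [exact: (xlo 0%N)|exact: (xhi 0%N)|].
apply/cvgrPdist_lt => e e0.
have [k hk] : exists k, 2^-1 ^+ k < e.
  have : (2^-1 : R) ^+ k @[k --> \oo] --> 0 by apply: cvg_expr; rewrite ger0_norm; lra.
  move/cvgrPdist_lt => /(_ e e0) [k _ /(_ k (leqnn k))] /=.
  by rewrite sub0r normrN ger0_norm ?exprn_ge0 // => ?; exists k.
near=> y.
have y1 : (s k).1 < y by near: y; exact: lt_nbhsr.
have y2 : y < (s k).2 by near: y; exact: lt_nbhsl.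
have b1 : G (s k).1 <= G y by apply/mG/ltW.
have b2 : G y <= G (s k).2 by apply/mG/ltW.
have b3 : G (s k).1 <= G x by apply/mG/ltW/xlo.
have b4 : G x <= G (s k).2 by apply/mG/ltW/xhi.
by have := svar k; rewrite ltr_norml; lra.
Unshelve. all: by end_near.
Qed.

Definition step_sum (f F : R -> R) (x : nat -> R) k : R :=
  \sum_(j < k) f (x j.+1) * (F (x j.+1) - F (x j)).

(* I is approximated by the Riemann-Stieltjes sums of f with respect to F over
   every subdivision of [0, x k], which may thus be chosen among the continuity
   points of the limiting distribution function. *)
Definition step_approx (f F : R -> R) (C L I : R) : Prop :=
  forall (x : nat -> R) k del, x 0%N = 0 -> (forall j, x j <= x j.+1) ->
    (forall j, x j.+1 - x j <= del) -> C <= x k ->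
    `|I - step_sum f F x k| <= L * del.

(** The indicator of tau <= y jumps in the one cell containing tau, so the sum collapses to the
    value of f at the right end of that cell, within del of tau. *)
Lemma step_pointwise (f : R -> R) (x : nat -> R) k del L tau :
  (forall a b, 0 <= a -> 0 <= b -> `|f a - f b| <= L * `|a - b|) -> 0 <= L ->
  x 0%N = 0 -> (forall j, x j <= x j.+1) -> (forall j, x j.+1 - x j <= del) ->
  0 < tau -> tau <= x k ->
  `|f tau - step_sum f (fun y => (tau <= y)%R%:R) x k| <= L * del.
Proof.
move=> fL L0 x0 xm xd tau0.
have x_ge0 j : 0 <= x j by elim: j => [|j IH]; [rewrite x0|exact: le_trans (xm j)].
elim: k => [|k IH]; first by rewrite x0 leNgt tau0.
move=> txk; rewrite /step_sum big_ord_recr /= -/(step_sum f _ x k) txk.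
have [h|h] := leP tau (x k); first by rewrite subrr mulr0 addr0; exact: IH.
rewrite subr0 mulr1 [\sum_(i < k) _]big1 ?add0r; last first.
  move=> j _.
  have lej i : (i <= k)%N -> x i <= x k.
    move=> ik; rewrite -(subnKC ik); elim: (k - i)%N => [|m IHm]; first by rewrite addn0.
    by rewrite addnS; exact: le_trans (xm _).
  have -> : tau <= x j.+1 = false by apply: lt_geF; exact: le_lt_trans (lej _ (ltn_ord j)) h.
  have -> : tau <= x j = false by apply: lt_geF; exact: le_lt_trans (lej _ (ltnW (ltn_ord j))) h.
  by rewrite subrr mulr0.
apply: (le_trans (fL _ _ (ltW tau0) (x_ge0 _))); rewrite ler_wpM2l // ler0_norm ?subr_le0 //.
by rewrite opprB; apply: le_trans (xd k); rewrite lerB // ltW.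
Qed.

Lemma step_approx_mean p (tau : 'I_p -> R) (f : R -> R) C L : (0 < p)%N ->
  (forall a b, 0 <= a -> 0 <= b -> `|f a - f b| <= L * `|a - b|) -> 0 <= L ->
  (forall i, 0 < tau i <= C) ->
  step_approx f (fun y => p%:R^-1 * \sum_i (tau i <= y)%R%:R) C L (p%:R^-1 * \sum_i f (tau i)).
Proof.
move=> p0 fL L0 tC x k del x0 xm xd Cx.
have pR : 0 < p%:R :> R by rewrite ltr0n.
have -> : step_sum f (fun y => p%:R^-1 * \sum_i (tau i <= y)%R%:R) x k
    = p%:R^-1 * \sum_i step_sum f (fun y => (tau i <= y)%R%:R) x k.
  rewrite /step_sum exchange_big /= mulr_sumr; apply: eq_bigr => j _.
  by rewrite -mulrBr -sumrB mulrCA mulr_sumr.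
rewrite -mulrBr -sumrB normrM ger0_norm ?invr_ge0 ?(ltW pR) // mulrC ler_pdivrMr //.
apply: (le_trans (ler_norm_sum _ _ _)).
apply: (@le_trans _ _ (\sum_(i < p) L * del)).
  apply: ler_sum => i _; have /andP[t0 tc] := tC i.
  by apply: step_pointwise => //; exact: le_trans Cx.
by rewrite sumr_const card_ord mulr_natr.
Qed.

(** Over a subdivision made of continuity points of G the finite sums converge, while the
    approximation error L del is the same for all k and for the limit. *)
Lemma step_approx_cvg (f : R -> R) (F : nat -> R -> R) (G : R -> R) (I : nat -> R)
    J C L a :
  {homo G : x y / x <= y} -> (forall x, 0 <= G x <= 1) -> 0 < a ->
  (forall x, x < a -> G x = 0) -> 0 <= L ->
  (\forall k \near \oo, step_approx f (F k) C L (I k)) -> step_approx f G C L J ->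
  cvg_in_distribution F G -> I k @[k --> \oo] --> J.
Proof.
move=> mG G01 a0 Ga L0 FI GJ FG; apply/cvgrPdist_lt => e e0.
pose del := e / (L + 1) / 8.
have L1 : 0 < L + 1 by rewrite ltr_wpDl.
have d0 : 0 < del by rewrite !divr_gt0.
(* One continuity point in each cell of length del, so that consecutive ones are less than 2 del
   apart. *)
have /choice[y hy] : forall j : nat, exists x, [/\ j.+1%:R * del < x, x < j.+2%:R * del & {for x, continuous G}].
  by move=> j; apply: monotone_continuity_point => //; rewrite ltr_pM2r // ltr_nat.
pose x j := if j is j'.+1 then y j' else 0.
(* The initial point 0 is also a continuity point, as G vanishes to the left of a > 0. *)
have xc j : {for x j, continuous G}.
  case: j => [|j] /=; last by case: (hy j).
  apply/cvgrPdist_lt => e' e'0; near=> z.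
  by rewrite !Ga // ?subrr ?normr0 //; near: z; exact: lt_nbhsl.
have xm j : x j <= x j.+1.
  case: j => [|j] /=; have [h1 h2 _] := hy 0%N.
    by apply: ltW; apply: lt_trans h1; rewrite mulr_gt0.
  by have [_ h3 _] := hy j; have [h4 _ _] := hy j.+1; exact/ltW/(lt_trans h3 h4).
have xd j : x j.+1 - x j <= del *+ 2.
  case: j => [|j] /=.
    by have [_ h2 _] := hy 0%N; rewrite subr0 -mulr_natl ltW.
  have [h3 _ _] := hy j; have [_ h4 _] := hy j.+1.
  have -> : del *+ 2 = j.+3%:R * del - j.+1%:R * del by rewrite (_ : j.+3%:R = j.+1%:R + 2 :> R) -?natrD ?addn2 //; ring.
  by apply/ltW/ltrB.
have [k Ck] : exists k, C <= x k.
  exists (Num.bound `|C / del|).+1 => /=.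
  have [h3 _ _] := hy (Num.bound `|C / del|); apply: le_trans (ltW h3).
  rewrite -ler_pdivrMr //; apply: (le_trans (ler_norm _)).
  apply: (le_trans (ltW (archi_boundP (normr_ge0 _)))).
  by rewrite ler_nat.
have cS : step_sum f (F m) x k @[m --> \oo] --> step_sum f G x k.
  elim: (k) => [|i IH]; rewrite /step_sum.
    by rewrite big_ord0; under eq_fun do rewrite big_ord0; exact: cvg_cst.
  rewrite big_ord_recr /=; under eq_fun do rewrite big_ord_recr /=.
  apply: cvgD; first exact: IH.
  apply: cvgM; first exact: cvg_cst.
  by apply: cvgB; apply: FG; [exact: (xc i.+1)|exact: (xc i)].
have b2 : L * (del *+ 2) <= e / 4.
  rewrite /del -mulr_natr; have -> : L * (e / (L + 1) / 8 * 2) = L / (L + 1) * (e / 4) by field; rewrite gt_eqF.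
  have h : L / (L + 1) <= 1 by rewrite ler_pdivrMr // mul1r lerDl.
  by rewrite -[leRHS]mul1r ler_wpM2r // divr_ge0 // ltW.
have GJ' := GJ x k _ erefl xm xd Ck.
move/cvgrPdist_lt : cS => /(_ (e / 4)) cS.
have e4 : 0 < e / 4 by rewrite divr_gt0.
near=> m.
have h1 : step_approx f (F m) C L (I m) by near: m.
have h1' := h1 x k _ erefl xm xd Ck.
have h2 : `|step_sum f G x k - step_sum f (F m) x k| < e / 4 by near: m; exact: cS.
have -> : J - I m = (J - step_sum f G x k) + (step_sum f G x k - step_sum f (F m) x k)
   - (I m - step_sum f (F m) x k) by ring.
apply: (le_lt_trans (ler_normB _ _)).
have := ler_normD (J - step_sum f G x k) (step_sum f G x k - step_sum f (F m) x k).
lra.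
Unshelve. all: by end_near.
Qed.

End WeakConvergence.

(** * Integrals against a law carried by a bounded interval *)

Section SupportedMeasure.
Context {R : realType}.
Variables (H : probability (measurableTypeR R) R) (C : R).
Hypothesis suppH : H `]0, C]%classic = 1%E.
Local Notation EE := (EE H).
Local Notation L1 := (L1 H).
Implicit Types (a b x y tau : R).

Lemma ae_support : {ae H, forall tau : measurableTypeR R, 0 < (tau : R) <= C}.
Proof.
exists (~` `]0, C]%classic); split.
- by apply: measurableC; exact: measurable_itv.
- by rewrite probability_setC ?suppH ?subee //; exact: measurable_itv.
- by move=> tau /= h; rewrite in_itv /=; exact: h.
Qed.

Lemma supp_EE_eq (f g : R -> R) :
  measurable_fun [set: measurableTypeR R] (f : measurableTypeR R -> R) ->
  measurable_fun [set: measurableTypeR R] (g : measurableTypeR R -> R) ->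
  (forall tau, 0 < tau <= C -> f tau = g tau) -> EE f = EE g.
Proof.
move=> mf mg fg; congr fine; apply: ae_eq_integral => //.
- exact/measurable_EFinP.
- exact/measurable_EFinP.
by apply: filterS ae_support => tau ht _ /=; rewrite fg.
Qed.

Lemma supp_L1 (f : R -> R) M :
  measurable_fun [set: measurableTypeR R] (f : measurableTypeR R -> R) ->
  (forall tau, 0 < tau <= C -> `|f tau| <= M) -> L1 f.
Proof.
move=> mf fM; apply/integrableP; split; first exact/measurable_EFinP.
apply: (@le_lt_trans _ _ (\int[H]__ M%:E)%E); last first.
  have -> : (\int[H]__ M%:E = M%:E * H [set: measurableTypeR R])%E by exact: integral_cst.
  by rewrite probability_setT mule1 ltry.
apply: ae_ge0_le_integral => //.
- by apply: measurableT_comp => //; exact/measurable_EFinP.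
(* M is nonnegative since []0, C]] has mass 1 and is therefore nonempty. *)
- move=> tau _; rewrite lee_fin; have [tau0|h] := pselect (exists tau : R, 0 < tau <= C).
    by have [x hx] := tau0; exact: le_trans (fM x hx).
  exfalso; move: suppH; rewrite (_ : `]0, C]%classic = set0) ?measure0.
    by move/eqP; rewrite eq_sym onee_eq0.
  by apply/seteqP; split=> // x /=; rewrite in_itv /= => hx; apply: h; exists x.
by apply: filterS ae_support => tau ht _ /=; rewrite lee_fin fM.
Qed.

Lemma supp_le_EE (f g : R -> R) : L1 f -> L1 g ->
  (forall tau, 0 < tau <= C -> f tau <= g tau) -> EE f <= EE g.
Proof.
move=> Lf Lg fg; rewrite -subr_ge0 -EEB //; apply: fine_ge0.
have Lfg := L1B Lg Lf.
have mfg := L1_measurable Lfg.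
have -> : (\int[H]_w (g w - f w)%:E = \int[H]_w (Num.max 0 (g w - f w))%:E)%E.
  apply: ae_eq_integral => //.
  - exact/measurable_EFinP.
  - by apply/measurable_EFinP; apply: measurable_maxr.
  - by apply: filterS ae_support => tau ht _ /=; rewrite max_r // subr_ge0 fg.
by apply: integral_ge0 => tau _; rewrite lee_fin le_max lexx.
Qed.

Lemma supp_EE_le (f : R -> R) M : L1 f ->
  (forall tau, 0 < tau <= C -> `|f tau| <= M) -> `|EE f| <= M.
Proof.
move=> Lf fM; rewrite ler_norml; apply/andP; split.
  rewrite -(EE_cst H (- M)); apply: supp_le_EE => //; first exact: L1_cst.
  by move=> tau /fM; rewrite ler_norml => /andP[].
rewrite -(EE_cst H M); apply: supp_le_EE => //; first exact: L1_cst.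
by move=> tau /fM; rewrite ler_norml => /andP[].
Qed.

Lemma law_cdfE x : law_cdf H x = EE (fun tau : R => (tau <= x)%R%:R).
Proof.
rewrite /law_cdf; congr fine.
have mI : measurable (`]-oo, x]%classic : set (measurableTypeR R)) by exact: measurable_itv.
transitivity (\int[H]_tau (\1_(`]-oo, x]%classic) tau)%:E)%E.
  by rewrite integral_indic // setIT.
by apply: eq_integral => tau _; rewrite indicE mem_setE in_itv.
Qed.

Lemma measurable_le_cst x :
  measurable_fun [set: measurableTypeR R] (fun tau : measurableTypeR R => ((tau : R) <= x)%R%:R : R).
Proof.
have -> : (fun tau : measurableTypeR R => ((tau : R) <= x)%R%:R : R) = \1_(`]-oo, x]%classic).
  by apply/funext => tau; rewrite indicE mem_setE in_itv.
exact: measurable_indic.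
Qed.

Lemma L1_le_cst x : L1 (fun tau : R => (tau <= x)%R%:R).
Proof.
apply: (@L1_bounded _ _ _ _ _ 1); first exact: measurable_le_cst.
by move=> tau; rewrite ger0_norm ?ler0n // lern1 leq_b1.
Qed.

Lemma law_cdf_mono : {homo law_cdf H : x y / x <= y}.
Proof.
move=> x y xy; rewrite !law_cdfE; apply: le_EE; [exact: L1_le_cst|exact: L1_le_cst|].
move=> tau; have [h|_] := leP tau x; first by rewrite (le_trans h xy).
by rewrite ler0n.
Qed.

Lemma law_cdf01 x : 0 <= law_cdf H x <= 1.
Proof.
rewrite law_cdfE EE_ge0; last by move=> tau; rewrite ler0n.
rewrite -[leRHS](EE_cst H); apply: le_EE; [exact: L1_le_cst|exact: L1_cst|].
by move=> tau; rewrite lern1; case: (_ <= _).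
Qed.

Lemma step_approx_EE (f : R -> R) L M :
  measurable_fun [set: measurableTypeR R] (f : measurableTypeR R -> R) ->
  (forall a b, 0 <= a -> 0 <= b -> `|f a - f b| <= L * `|a - b|) -> 0 <= L ->
  (forall tau, 0 < tau <= C -> `|f tau| <= M) ->
  step_approx f (law_cdf H) C L (EE f).
Proof.
move=> mf fL L0 fM x k del x0 xm xd Cx.
have Lf : L1 f by exact: supp_L1 mf fM.
have Lstep : L1 (fun tau : R => step_sum f (fun y => (tau <= y)%R%:R) x k).
  by apply: L1_sum => j _; apply: L1Z; apply: L1B; exact: L1_le_cst.
have -> : step_sum f (law_cdf H) x k = EE (fun tau : R => step_sum f (fun y => (tau <= y)%R%:R) x k).
  rewrite /step_sum EE_sum; last first.
    by move=> j _; apply: L1Z; apply: L1B; exact: L1_le_cst.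
  apply: eq_bigr => j _; rewrite EEZ; last by apply: L1B; exact: L1_le_cst.
  by rewrite EEB ?law_cdfE //; exact: L1_le_cst.
rewrite -EEB //; apply: supp_EE_le; first exact: L1B.
move=> tau /andP[t0 tC]; apply: step_pointwise => //; exact: le_trans Cx.
Qed.

End SupportedMeasure.

(** * The Marchenko-Pastur equation on the negative half-line *)

Section MarchenkoPastur.
Context {R : realType}.
Implicit Types (a b l t u tau x y : R).

(** The contribution of an eigenvalue tau of Lambda to the trace of Sigma (Sigma / (1 + t) + l
    Omega^-1)^-1. *)
Definition mp_fun (l t : R) (tau : R) : R := tau / (tau / (1 + t) + l).

Lemma mp_fun_lipschitz l t a b : 0 < l -> 0 <= t -> 0 <= a -> 0 <= b ->
  `|mp_fun l t a - mp_fun l t b| <= l^-1 * `|a - b|.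
Proof.
move=> l0 t0 a0 b0; have t1 : 0 < 1 + t by rewrite ltr_pwDl.
have da : 0 < a / (1 + t) + l by rewrite ltr_wpDl // divr_ge0 // ltW.
have db : 0 < b / (1 + t) + l by rewrite ltr_wpDl // divr_ge0 // ltW.
have -> : mp_fun l t a - mp_fun l t b
    = l / ((a / (1 + t) + l) * (b / (1 + t) + l)) * (a - b).
  have ea : 0 < a + l * (1 + t) by rewrite ltr_wpDl // mulr_gt0.
  have eb : 0 < b + l * (1 + t) by rewrite ltr_wpDl // mulr_gt0.
  by rewrite /mp_fun; field; rewrite !gt_eqF.
rewrite normrM ler_wpM2r // ger0_norm; last by rewrite divr_ge0 ?mulr_ge0 // ltW.
rewrite ler_pdivrMr ?mulr_gt0 // mulrC ler_pdivlMr //.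
by apply: ler_pM; rewrite ?(ltW l0) // lerDr divr_ge0 // ltW.
Qed.

Lemma mp_fun_bound l t tau : 0 < l -> 0 <= t -> 0 <= tau -> `|mp_fun l t tau| <= l^-1 * tau.
Proof.
move=> l0 t0 h; have := mp_fun_lipschitz l0 t0 h (lexx 0).
by rewrite {2}/mp_fun mul0r !subr0 (ger0_norm h).
Qed.

Lemma measurable_mp_fun l t :
  measurable_fun [set: measurableTypeR R] (mp_fun l t : measurableTypeR R -> R).
Proof.
apply: measurable_funM => //; apply: (measurableT_comp measurable_invr).
apply: measurable_funD; last exact: measurable_cst.
by apply: measurable_funM => //; exact: measurable_cst.
Qed.

Variables (g C : R) (H : probability (measurableTypeR R) R) (s : R -> R).
Hypotheses (g0 : 0 < g) (suppH : H `]0, C]%classic = 1%E) (mps : mp_solution g H s).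
Local Notation EE := (EE H).
Local Notation L1 := (L1 H).

Let C0 : 0 < C.
Proof.
rewrite ltNge; apply/negP => h; move: suppH; rewrite (_ : `]0, C]%classic = set0) ?measure0.
  by move/eqP; rewrite eq_sym onee_eq0.
by apply/seteqP; split=> // x /=; rewrite in_itv /= => /andP[x0 xC]; move: (lt_le_trans x0 (le_trans xC h)); rewrite ltxx.
Qed.

(* With v the companion transform of s, mp_u l = l v(-l) and mp_du is its
   derivative; the equation for s becomes u (1 + g E[tau / (tau u + l)]) = 1. *)
Definition mp_u (l : R) : R := 1 - g + g * l * s (- l).

Let fr (u l tau : R) := (tau * u + l)^-1.

Let mfr u l : measurable_fun [set: measurableTypeR R] (fr u l : measurableTypeR R -> R).
Proof.
apply: (measurableT_comp measurable_invr).
apply: measurable_funD; last exact: measurable_cst.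
by apply: measurable_funM => //; exact: measurable_cst.
Qed.

Let den u l tau : 0 < u -> 0 < l -> 0 < tau -> l <= tau * u + l.
Proof. by move=> u0 l0 t0; rewrite lerDr mulr_ge0 // ltW. Qed.

Let den0 u l tau : 0 < u -> 0 < l -> 0 < tau -> 0 < tau * u + l.
Proof. by move=> u0 l0 t0; exact: lt_le_trans l0 (den u0 l0 t0). Qed.

Let fr_le u l tau : 0 < u -> 0 < l -> 0 < tau <= C -> 0 <= fr u l tau <= l^-1.
Proof.
move=> u0 l0 /andP[t0 _]; have h := den u0 l0 t0; have h0 := den0 u0 l0 t0.
by rewrite /fr invr_ge0 (ltW h0) lef_pV2 ?posrE.
Qed.

Lemma mp_u_gt0 l : 0 < l -> 0 < mp_u l.
Proof.
move=> l0; have [] := @mps (- l); first by rewrite oppr_lt0.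
by rewrite mulrN opprK mulNr opprK.
Qed.

Let sE l : 0 < l -> s (- l) = EE (fr (mp_u l) l).
Proof.
move=> l0; have [] := @mps (- l); first by rewrite oppr_lt0.
rewrite mulrN mulNr opprK opprK -/(mp_u l) => _ h.
by apply: EFin_inj; rewrite h /EE fineK // -h.
Qed.

Let Lfr u l : 0 < u -> 0 < l -> L1 (fr u l).
Proof.
move=> u0 l0; apply: (supp_L1 suppH (M := l^-1)) => // tau ht.
by have /andP[h1 h2] := fr_le u0 l0 ht; rewrite ger0_norm.
Qed.

Let tf (u l tau : R) := tau * fr u l tau.

Let Ltf u l : 0 < u -> 0 < l -> L1 (tf u l).
Proof.
move=> u0 l0; apply: (supp_L1 suppH (M := C * l^-1)).
  exact: measurable_funM.
move=> tau ht; have /andP[h1 h2] := fr_le u0 l0 ht; have /andP[t0 tC] := ht.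
by rewrite ger0_norm ?mulr_ge0 ?(ltW t0) //; apply: ler_pM => //; exact: ltW.
Qed.

Let uE l : 0 < l -> mp_u l * (1 + g * EE (tf (mp_u l) l)) = 1.
Proof.
move=> l0; set u := mp_u l; have u0 : 0 < u := mp_u_gt0 l0.
(* Pointwise, l / (tau u + l) + u tau / (tau u + l) = 1. *)
have h : l * EE (fr u l) = 1 - u * EE (tf u l).
  rewrite -!EEZ; [|exact: Ltf|exact: Lfr].
  rewrite -[X in X - _](EE_cst H 1) -EEB; [|exact: L1_cst|by apply: L1Z; exact: Ltf].
  apply: (supp_EE_eq suppH).
  - by apply: measurable_funM => //; exact: measurable_cst.
  - apply: measurable_funB; first exact: measurable_cst.
    by apply: measurable_funM; [exact: measurable_cst|exact: measurable_funM].
  move=> tau /andP[t0 _]; have d0 := den0 u0 l0 t0.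
  by rewrite /tf /fr; field; rewrite gt_eqF.
have : u = 1 - g + g * (l * EE (fr u l)) by rewrite {1}/u /mp_u sE // mulrA.
rewrite h => e; have : g * (u * EE (tf u l)) = 1 - u by lra.
by move=> e2; rewrite mulrDr mulr1 mulrCA e2; ring.
Qed.

(** The change of unknown u = 1 / (1 + t), which brings the limiting equation to the form satisfied
    approximately by phi. *)
Definition mp_t (l : R) : R := (mp_u l)^-1 - 1.

Lemma mp_t_ge0 l : 0 < l -> 0 <= mp_t l.
Proof.
move=> l0; have u0 := mp_u_gt0 l0.
have : 0 <= EE (tf (mp_u l) l).
  rewrite -(EE_cst H 0); apply: (supp_le_EE suppH); [exact: L1_cst|exact: Ltf|].
  move=> tau ht; have /andP[h1 _] := fr_le u0 l0 ht; have /andP[t0 _] := ht.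
  by rewrite mulr_ge0 // ltW.
move=> h; have e := uE l0; rewrite /mp_t.
have -> : (mp_u l)^-1 = 1 + g * EE (tf (mp_u l) l).
  have un : mp_u l != 0 by rewrite gt_eqF.
  by apply: (mulfI un); rewrite divff // e.
by rewrite addrAC subrr add0r mulr_ge0 // ltW.
Qed.

Lemma mp_tE l : 0 < l -> mp_t l = g * EE (mp_fun l (mp_t l)).
Proof.
move=> l0; have u0 := mp_u_gt0 l0; have e := uE l0.
have un : mp_u l != 0 by rewrite gt_eqF.
have -> : EE (mp_fun l (mp_t l)) = EE (tf (mp_u l) l).
  apply: (supp_EE_eq suppH); first exact: measurable_mp_fun.
    exact: measurable_funM.
  by move=> tau _; rewrite /mp_fun /mp_t addrCA subrr addr0 invrK.
have -> : mp_t l = (mp_u l * (1 + g * EE (tf (mp_u l) l))) / mp_u l - 1.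
  by rewrite e mul1r.
by rewrite mulrAC divff // mul1r addrAC subrr add0r.
Qed.

(** The integral produced by differences of two values of the equation; on the diagonal it gives the
    derivative. *)
Let I2 (l1 l2 : R) := EE (fun tau => tau * (fr (mp_u l1) l1 tau * fr (mp_u l2) l2 tau)).

Let mI2 l1 l2 : measurable_fun [set: measurableTypeR R]
  ((fun tau => tau * (fr (mp_u l1) l1 tau * fr (mp_u l2) l2 tau)) : measurableTypeR R -> R).
Proof. by apply: measurable_funM => //; exact: measurable_funM. Qed.

Let I2_bound l1 l2 tau : 0 < l1 -> 0 < l2 -> 0 < tau <= C ->
  0 <= tau * (fr (mp_u l1) l1 tau * fr (mp_u l2) l2 tau) <= C * (l1^-1 * l2^-1).
Proof.
move=> l10 l20 ht; have /andP[t0 tC] := ht.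
have /andP[h1 h2] := fr_le (mp_u_gt0 l10) l10 ht.
have /andP[h3 h4] := fr_le (mp_u_gt0 l20) l20 ht.
rewrite !mulr_ge0 ?(ltW t0) //=; apply: ler_pM => //; first exact: ltW.
  exact: mulr_ge0.
exact: ler_pM.
Qed.

Let LI2 l1 l2 : 0 < l1 -> 0 < l2 ->
  L1 (fun tau => tau * (fr (mp_u l1) l1 tau * fr (mp_u l2) l2 tau)).
Proof.
move=> l10 l20; apply: (supp_L1 suppH (M := C * (l1^-1 * l2^-1))) => // tau ht.
by have /andP[h1 h2] := I2_bound l10 l20 ht; rewrite ger0_norm.
Qed.

Let I2_ge0 l1 l2 : 0 < l1 -> 0 < l2 -> 0 <= I2 l1 l2.
Proof.
move=> l10 l20; rewrite -(EE_cst H 0); apply: (supp_le_EE suppH).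
- exact: L1_cst.
- exact: LI2.
- by move=> tau ht; have /andP[] := I2_bound l10 l20 ht.
Qed.

Let I2_le l1 l2 : 0 < l1 -> 0 < l2 -> I2 l1 l2 <= C * (l1^-1 * l2^-1).
Proof.
move=> l10 l20; rewrite -[leRHS](EE_cst H); apply: (supp_le_EE suppH).
- exact: LI2.
- exact: L1_cst.
- by move=> tau ht; have /andP[] := I2_bound l10 l20 ht.
Qed.

(* An exact two-point identity, giving the Lipschitz continuity and then the
   differentiability of mp_u with no a priori regularity of s. *)
Let u_slope l1 l2 : 0 < l1 -> 0 < l2 ->
  (mp_u l1 - mp_u l2) * (1 + g * l2 * I2 l1 l2) = g * mp_u l2 * (l1 - l2) * I2 l1 l2.
Proof.
move=> l10 l20; have e1 := uE l10; have e2 := uE l20.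
set u1 := mp_u l1 in e1 *; set u2 := mp_u l2 in e2 *.
have u10 : 0 < u1 := mp_u_gt0 l10; have u20 : 0 < u2 := mp_u_gt0 l20.
have h : u1 * EE (tf u1 l1) - u2 * EE (tf u2 l2) = (u1 * l2 - u2 * l1) * I2 l1 l2.
  rewrite -!EEZ; [|exact: LI2|exact: Ltf|exact: Ltf].
  rewrite -EEB; [|by apply: L1Z; exact: Ltf|by apply: L1Z; exact: Ltf].
  apply: (supp_EE_eq suppH).
  - by apply: measurable_funB; apply: measurable_funM => //; exact: measurable_funM.
  - by apply: measurable_funM => //; exact: measurable_cst.
  move=> tau /andP[t0 _]; rewrite /tf /fr -/u1 -/u2.
  have d1 := den0 u10 l10 t0; have d2 := den0 u20 l20 t0.
  by field; rewrite !gt_eqF.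
have : u1 + g * (u1 * EE (tf u1 l1)) - (u2 + g * (u2 * EE (tf u2 l2))) = 0.
  have f1 : u1 + g * (u1 * EE (tf u1 l1)) = 1 by rewrite -e1; ring.
  have f2 : u2 + g * (u2 * EE (tf u2 l2)) = 1 by rewrite -e2; ring.
  by rewrite f1 f2 subrr.
move=> k; have : u1 - u2 + g * (u1 * EE (tf u1 l1) - u2 * EE (tf u2 l2)) = 0.
  by rewrite -k; ring.
by rewrite h => q; nra.
Qed.

Definition mp_du (l : R) : R := g * mp_u l * I2 l l / (1 + g * l * I2 l l).

Let u_cont l : 0 < l -> mp_u l' @[l' --> l] --> mp_u l.
Proof.
move=> l0; apply/cvgrPdist_le => e e0.
(* For l' > l / 2 this bounds the right side of [u_slope] per unit of |l' - l|, and the factor on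
   the left side is at least 1. *)
pose K := g * mp_u l * (C * ((l / 2)^-1 * l^-1)).
have K0 : 0 < K + 1.
  by rewrite ltr_wpDl // !mulr_ge0 ?invr_ge0 ?divr_ge0 ?(ltW (mp_u_gt0 l0)) // ltW.
near=> l'.
have h1 : l / 2 < l' by near: l'; apply: lt_nbhsr; lra.
have l'0 : 0 < l' by apply: lt_trans h1; rewrite divr_gt0.
have h2 : `|l - l'| <= e / (K + 1).
  by near: l'; apply: cvgr_dist_le; [exact: cvg_id|rewrite divr_gt0].
have := u_slope l'0 l0; have i0 := I2_ge0 l'0 l0; have i1 := I2_le l'0 l0.
set i := I2 l' l in i0 i1 *; move=> q.
have d1 : 1 <= 1 + g * l * i by rewrite lerDl !mulr_ge0 // ltW.
have : `|mp_u l - mp_u l'| <= K * `|l - l'|.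
  rewrite -normrN opprB; apply: (@le_trans _ _ (`|mp_u l' - mp_u l| * (1 + g * l * i))).
    by rewrite ler_peMr.
  rewrite -{1}(ger0_norm (le_trans ler01 d1)) -normrM q !normrM.
  rewrite (gtr0_norm g0) (gtr0_norm (mp_u_gt0 l0)) (ger0_norm i0).
  rewrite mulrAC [`|l' - l|]distrC ler_wpM2r //.
  rewrite ler_wpM2l ?mulr_ge0 ?(ltW g0) ?(ltW (mp_u_gt0 l0)) //.
  apply: (le_trans i1); rewrite ler_wpM2l ?(ltW C0) // ler_wpM2r ?invr_ge0 ?(ltW l0) //.
  by rewrite lef_pV2 ?posrE ?divr_gt0 // ltW.
move=> h3; apply: (le_trans h3); apply: (@le_trans _ _ ((K + 1) * `|l - l'|)).
  by rewrite ler_wpM2r // lerDl.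
by rewrite mulrC -ler_pdivlMr.
Unshelve. all: by end_near.
Qed.

Let I2_cont l : 0 < l -> I2 l' l @[l' --> l] --> I2 l l.
Proof.
move=> l0; apply/cvgrPdist_le => e e0.
have u0 := mp_u_gt0 l0.
(* The two integrands differ by a bounded factor times tau (u' - u) + (l' - l), where u' =
   [mp_u l']. K collects the bounds that multiply e / K once both increments are at most e / K. *)
pose K := C * ((l / 2)^-1 * l^-1) * l^-1 * (C + 1).
have K0 : 0 < K by rewrite /K !mulr_gt0 ?invr_gt0 ?divr_gt0 // ltr_wpDl // ltW.
near=> l'.
have h1 : l / 2 < l' by near: l'; apply: lt_nbhsr; lra.
have l'0 : 0 < l' by apply: lt_trans h1; rewrite divr_gt0.
have u'0 := mp_u_gt0 l'0.
have h2 : `|l - l'| <= e / K.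
  by near: l'; apply: cvgr_dist_le; [exact: cvg_id|rewrite divr_gt0].
have h3 : `|mp_u l - mp_u l'| <= e / K.
  by near: l'; apply: cvgr_dist_le; [exact: u_cont|rewrite divr_gt0].
rewrite /I2 -EEB; [|exact: LI2|exact: LI2].
apply: (supp_EE_le suppH); first by apply: L1B; exact: LI2.
move=> tau ht; have /andP[t0 tC] := ht.
have d0 := den0 u0 l0 t0; have d'0 := den0 u'0 l'0 t0.
have -> : tau * (fr (mp_u l) l tau * fr (mp_u l) l tau) - tau * (fr (mp_u l') l' tau * fr (mp_u l) l tau)
  = tau * (fr (mp_u l') l' tau * fr (mp_u l) l tau) * fr (mp_u l) l tau * (tau * (mp_u l' - mp_u l) + (l' - l)).
  by rewrite /fr; field; rewrite !gt_eqF.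
have /andP[b1 b2] := I2_bound l'0 l0 ht.
have /andP[b3 b4] := fr_le u0 l0 ht.
have b5 : `|tau * (mp_u l' - mp_u l) + (l' - l)| <= (C + 1) * (e / K).
  apply: (le_trans (ler_normD _ _)); rewrite normrM (gtr0_norm t0) mulrDl mul1r.
  by apply: lerD; [apply: ler_pM => //; [exact: ltW|rewrite distrC]|rewrite distrC].
have -> : e = C * ((l / 2)^-1 * l^-1) * l^-1 * ((C + 1) * (e / K)).
  by rewrite mulrA -/K mulrCA divff ?mulr1 // gt_eqF.
set A := _ * (_ * _) in b1 b2 *; set B := fr _ _ _ in b3 b4 *.
rewrite normrM (ger0_norm (mulr_ge0 b1 b3)); apply: ler_pM => //; first exact: mulr_ge0.
apply: ler_pM => //; apply: (le_trans b2); rewrite ler_wpM2l ?(ltW C0) // ler_wpM2r ?invr_ge0 ?(ltW l0) //.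
by rewrite lef_pV2 ?posrE ?divr_gt0 // ltW.
Unshelve. all: by end_near.
Qed.

Let line_cvg l (e : R) : l + e * h @[h --> (0 : R)^'] --> l.
Proof.
rewrite -[X in _ --> X]addr0; apply: cvgD; first exact: cvg_cst.
rewrite -[X in _ --> X](mulr0 e); apply: cvgM; first exact: cvg_cst.
exact: cvg_within.
Qed.

Let line_gt0 l (e : R) : 0 < l -> \forall h \near (0 : R)^', 0 < l + e * h.
Proof.
move=> l0; have h : l + e * h @[h --> (0 : R)^'] --> l by exact: line_cvg.
exact: cvgr_gt h _ l0.
Qed.

(** The direction e is 1 for the derivative of [mp_t], and -1 for that of s, whose argument is
    -l. *)
Lemma mp_u_slope_cvg l (e : R) : 0 < l -> e != 0 ->
  (mp_u (l + e * h) - mp_u l) / h @[h --> (0 : R)^'] --> e * mp_du l.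
Proof.
move=> l0 e0; have c1 : I2 (l + e * h) l @[h --> (0 : R)^'] --> I2 l l.
  apply: (@cvg_comp _ _ _ (fun h => l + e * h) (fun l' => I2 l' l) _ (nbhs l)).
    exact: line_cvg.
  exact: I2_cont.
have i0 := I2_ge0 l0 l0.
have cvg1 : e * (g * mp_u l * I2 (l + e * h) l / (1 + g * l * I2 (l + e * h) l))
    @[h --> (0 : R)^'] --> e * mp_du l.
  apply: cvgM; first exact: cvg_cst.
  apply: cvgM; first by apply: cvgM => //; exact: cvg_cst.
  apply: cvgV; first by rewrite gt_eqF // ltr_pwDl // !mulr_ge0 // ltW.
  by apply: cvgD; [exact: cvg_cst|apply: cvgM => //; exact: cvg_cst].
apply: cvg_trans cvg1; apply: near_eq_cvg; near=> h.
have l'0 : 0 < l + e * h by near: h; exact: line_gt0.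
have h0 : h != 0 by near: h; exact: nbhs_dnbhs_neq.
have := u_slope l'0 l0; have i1 := I2_ge0 l'0 l0; set i := I2 _ l in i1 *.
have d1 : 1 + g * l * i != 0 by rewrite gt_eqF // ltr_pwDl // !mulr_ge0 // ltW.
move=> q; apply: (mulIf d1); rewrite [RHS]mulrAC q; field.
by rewrite h0 d1.
Unshelve. all: by end_near.
Qed.

(** In [risk_limit], dn = u and nm = u - l u'. Thus 1 - nm / dn = l u' / u, and the outer factor 1 /
    u is 1 + t. *)
Lemma mp_risk_limit l sigma : 0 < l -> risk_limit l sigma g s
  = sigma ^+ 2 + sigma ^+ 2 * mp_t l + l * (l / g - sigma ^+ 2) * (mp_du l / mp_u l ^+ 2).
Proof.
move=> l0; have u0 := mp_u_gt0 l0; have ln : l != 0 by rewrite gt_eqF.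
have gn : g != 0 by rewrite gt_eqF.
have s_eq z : z != 0 -> s z = (1 - g - mp_u (- z)) / (g * z).
  by move=> z0; rewrite /mp_u opprK; field; rewrite z0 gn.
have cu : (mp_u (- (h + - l)) - mp_u l) / h @[h --> (0 : R)^'] --> - mp_du l.
  have := mp_u_slope_cvg l0 (_ : -1 != 0); rewrite oppr_eq0 oner_eq0 mulN1r => /(_ isT).
  have -> // : (fun h : R => (mp_u (l + -1 * h) - mp_u l) / h)
    = (fun h => (mp_u (- (h + - l)) - mp_u l) / h).
  by apply/funext => h; rewrite mulN1r opprB.
have ds : derive1 s (- l) = (g * l ^+ 2)^-1 * (mp_u l - l * mp_du l - (1 - g)).
  rewrite /derive1; apply: cvg_lim => //.
  (* The difference quotient of s at -l, rearranged so that the slope of [mp_u] is the only quotient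
     by h left. *)
  pose q (h : R) := - ((1 - g) / (g * (- l) * (h - l)))
     - ((mp_u (- (h + - l)) - mp_u l) / h * (h - l)^-1 - mp_u l / (- l * (h - l))) / g.
  have ch : (h : R) - l @[h --> 0^'] --> - l.
    rewrite -[X in _ --> X]add0r; apply: cvgB; last exact: cvg_cst.
    exact: cvg_within_filter cvg_id.
  have cq : q h @[h --> 0^'] --> (g * l ^+ 2)^-1 * (mp_u l - l * mp_du l - (1 - g)).
    have -> : (g * l ^+ 2)^-1 * (mp_u l - l * mp_du l - (1 - g))
      = - ((1 - g) / (g * (- l) * (- l))) - (- mp_du l * (- l)^-1 - mp_u l / (- l * (- l))) / g.
      by field; rewrite gn ln.
    apply: cvgB.
      apply: cvgN; apply: cvgM; first exact: cvg_cst.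
      apply: cvgV; first by rewrite !mulf_neq0 // oppr_eq0.
      by apply: cvgM => //; exact: cvg_cst.
    apply: cvgM; last exact: cvg_cst.
    apply: cvgB.
      by apply: cvgM => //; apply: cvgV => //; rewrite oppr_eq0.
    apply: cvgM; first exact: cvg_cst.
    apply: cvgV; first by rewrite !mulf_neq0 // oppr_eq0.
    by apply: cvgM => //; exact: cvg_cst.
  apply: cvg_trans cq; apply: near_eq_cvg; near=> h.
  have h0 : h != 0 by near: h; exact: nbhs_dnbhs_neq.
  have hl : h - l < 0.
    by rewrite subr_lt0; near: h; apply: nbhs_dnbhs; exact: lt_nbhsl.
  have hln : h - l != 0 by rewrite lt_eqF.
  rewrite /q /= !s_eq ?oppr_eq0 // ?opprK /GRing.scale /=.
  by field; rewrite h0 gn ln hln.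
rewrite /risk_limit ds /mp_t.
have -> : l * g * s (- l) + (1 - g) = mp_u l by rewrite /mp_u; ring.
by field; rewrite gn ln gt_eqF.
Unshelve. all: by end_near.
Qed.

Lemma mp_t_slope_cvg l : 0 < l ->
  (mp_t l - mp_t (l + h)) / h @[h --> (0 : R)^'] --> mp_du l / mp_u l ^+ 2.
Proof.
move=> l0; have u0 := mp_u_gt0 l0.
have c1 := mp_u_slope_cvg l0 (oner_neq0 R).
have c2 : mp_u (l + 1 * h) @[h --> (0 : R)^'] --> mp_u l.
  apply: (@cvg_comp _ _ _ (fun h => l + 1 * h) mp_u _ (nbhs l)).
    exact: line_cvg.
  exact: u_cont.
have c3 : (mp_u (l + 1 * h) - mp_u l) / h * (mp_u l * mp_u (l + 1 * h))^-1
    @[h --> (0 : R)^'] --> mp_du l / mp_u l ^+ 2.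
  rewrite expr2 -[mp_du l]mul1r; apply: cvgM => //.
  apply: cvgV; first by rewrite mulf_neq0 // gt_eqF.
  by apply: cvgM => //; exact: cvg_cst.
apply: cvg_trans c3; apply: near_eq_cvg; near=> h.
have l'0 : 0 < l + h by rewrite -[X in _ + X]mul1r; near: h; exact: line_gt0.
have h0 : h != 0 by near: h; exact: nbhs_dnbhs_neq.
rewrite mul1r /mp_t; have u'0 := mp_u_gt0 l'0.
by field; rewrite h0 !gt_eqF.
Unshelve. all: by end_near.
Qed.

End MarchenkoPastur.

(** * The deterministic trace as a linear spectral statistic *)

Section SpectralTrace.
Context {R : realType}.

(** Conjugated by Omega^{1/2}, the deterministic resolvent becomes a function of Lambda, so one
    diagonalization serves both the spectral distribution and the traces. An eigenvalue is the form
    of Sigma at Omega^{1/2} u with |u| = 1, hence the bound c s. *)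
Lemma spectral_twist p (Omega Sigma : 'M[R]_p) (c s : R) :
  posdefmx Omega -> posdefmx Sigma -> 0 <= c -> 0 <= s ->
  opbound Omega c -> opbound Sigma s ->
  exists tau : 'I_p -> R, [/\ forall i, 0 < tau i <= c * s,
    forall x, esd_cdf (twist Omega Sigma) x = p%:R^-1 * \sum_i (tau i <= x)%R%:R &
    forall l t, 0 < l -> 0 <= t ->
      \tr (Sigma *m det_resolvent t Sigma (l *: invmx Omega)) = \sum_i mp_fun l t (tau i)].
Proof.
move=> pO pS c0 s0 hO hS; set B := mxsqrt Omega; set La := twist Omega Sigma.
have pO' := posdef_psd pO; have pS' := posdef_psd pS.
have tB : B^T = B := tr_mxsqrt pO'.
have uB : B \in unitmx := mxsqrt_unitmx pO.
have sLa : La^T = La by rewrite /La /twist !trmx_mul tB pS'.1 mulmxA.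
have [U [d [UU UU' LE]]] := symmetric_spectral sLa.
have tauE i : d 0 i = dotv (B *m col i U) (Sigma *m (B *m col i U)).
  by rewrite (spectral_entry i UU LE) /La /twist -!mulmxA dotv_mull tB.
have nU i : dotv (col i U) (col i U) = 1 by exact: col_orth_norm.
exists (fun i => d 0 i); split.
- move=> i; apply/andP; split.
    rewrite tauE; apply: posdef_quad => //; apply/eqP => h.
    have : col i U = 0 by rewrite -[col i U](mulKmx uB) h mulmx0.
    by move=> h'; have := nU i; rewrite h' dotv0l => /eqP; rewrite eq_sym oner_eq0.
  rewrite tauE; apply: (le_trans (opbound_quad _ hS)).
  rewrite mulrC -[leRHS]mulr1 -(nU i) mulrAC ler_wpM2r //.
  rewrite dotv_mull tB mulmxA (mxsqrt_sq pO').
  exact: opbound_quad.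
- move=> x; rewrite /esd_cdf mulrC; congr (_ * _).
  have /permP -> := eigenvalues_spectral UU' LE.
  rewrite count_map -sum1_count natr_sum big_mkcond /= big_enum /=.
  by apply: eq_bigr => i _; case: ifP.
move=> l t l0 t0; have t1 : 0 < 1 + t by rewrite ltr_pwDl.
have pS1 : possemidefmx ((1 + t)^-1 *: Sigma) by apply: psdZ => //; rewrite invr_ge0 ltW.
rewrite /det_resolvent -(resolventE l0 pO pS1) -/B.
have -> : Sigma *m (B *m resolvent l Omega ((1 + t)^-1 *: Sigma) *m B)
    = (Sigma *m B *m resolvent l Omega ((1 + t)^-1 *: Sigma)) *m B by rewrite !mulmxA.
rewrite mxtrace_mulC !mulmxA -/(twist Omega Sigma) -/La.
pose e : 'rV[R]_p := \row_i (d 0 i / (1 + t) + l).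
pose e' : 'rV[R]_p := \row_i (d 0 i / (1 + t) + l)^-1.
have d0 i : 0 <= d 0 i by rewrite tauE; exact: psd_quad.
have en i : d 0 i / (1 + t) + l != 0.
  by rewrite gt_eqF // ltr_wpDl // divr_ge0 // ltW.
have ee : diag_mx e *m diag_mx e' = 1%:M.
  rewrite mulmx_diag; apply/matrixP => i j; rewrite !mxE; congr (_ *+ _).
  by rewrite divff.
have -> : resolvent l Omega ((1 + t)^-1 *: Sigma) = U *m diag_mx e' *m U^T.
  rewrite /resolvent; have -> : twist Omega ((1 + t)^-1 *: Sigma) + l%:M = U *m diag_mx e *m U^T.
    have -> : twist Omega ((1 + t)^-1 *: Sigma) = (1 + t)^-1 *: La.
      by rewrite /La /twist -scalemxAr -scalemxAl.
    have -> : diag_mx e = (1 + t)^-1 *: diag_mx d + l%:M.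
      by apply/matrixP => i j; rewrite !mxE; case: (i == j); rewrite ?mulr1n ?mulr0n ?mulr0 ?addr0 // mulrC.
    by rewrite mulmxDr mulmxDl -scalemxAr -scalemxAl -LE mul_mx_scalar -scalemxAl UU' scalemx1.
  have h : (U *m diag_mx e *m U^T) *m (U *m diag_mx e' *m U^T) = 1%:M.
    by rewrite !mulmxA -[_ *m U^T *m U]mulmxA UU mulmx1 -[U *m _ *m _]mulmxA ee mulmx1.
  have [uM _] := mulmx1_unit h.
  by rewrite -[RHS](mulKmx uM) h mulmx1.
rewrite LE mxtrace_mulC !mulmxA -[_ *m U^T *m U]mulmxA UU mulmx1.
rewrite -!mulmxA mxtrace_mulC -!mulmxA UU mulmx1 mulmx_diag mxtrace_diag.
by apply: eq_bigr => i _; rewrite !mxE /mp_fun mulrC.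
Qed.

End SpectralTrace.

(** * Supports of the limiting laws *)

Section LimitLaws.
Context {R : realType}.
Implicit Types (H : probability (measurableTypeR R) R) (a b C x y : R).

Lemma law_cdf_eq1 H C x : H `]0, C]%classic = 1%E -> C <= x -> law_cdf H x = 1.
Proof.
move=> hC Cx; apply: EFin_inj; rewrite /law_cdf fineK; last first.
  by apply: fin_num_measure; exact: measurable_itv.
apply/eqP; rewrite eq_le; apply/andP; split.
  by apply: probability_le1; exact: measurable_itv.
rewrite -hC; apply: le_measure; rewrite ?inE; try exact: measurable_itv.
by move=> y /=; rewrite !in_itv /= => /andP[_ yC]; exact: le_trans Cx.
Qed.

Lemma law_cdf_eq0 H a b x : H `[a, b]%classic = 1%E -> x < a -> law_cdf H x = 0.
Proof.
move=> hab xa; rewrite /law_cdf; suff -> : H `]-oo, x]%classic = 0%E by [].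
have mab : measurable (`[a, b]%classic : set (measurableTypeR R)) by exact: measurable_itv.
apply/eqP; rewrite -measure_le0 -[leRHS](subee (x := 1%E)) // -[in X in (_ <= _ - X)%E]hab.
rewrite -probability_setC //; apply: le_measure; rewrite ?inE.
- exact: measurable_itv.
- exact: measurableC.
move=> y /=; rewrite !in_itv /= => yx /andP[ay _].
by have := lt_le_trans (le_lt_trans yx xa) ay; rewrite ltxx.
Qed.

(** The interval [a, b] supplies positivity, while the upper bound comes from the approximating
    distribution functions: they are eventually 1 from C on, and so is the limit at a continuity
    point between C and C'. This gives a bound that does not vary with the law. *)
Lemma law_support (F : nat -> R -> R) H a b C C' : 0 < a -> H `[a, b]%classic = 1%E ->
  cvg_in_distribution F (law_cdf H) ->
  (forall x, C <= x -> \forall k \near \oo, F k x = 1) -> C < C' ->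
  H `]0, C']%classic = 1%E.
Proof.
move=> a0 hab FH F1 CC'.
have [x [Cx xC' cx]] := monotone_continuity_point (@law_cdf_mono _ H) (law_cdf01 H) CC'.
have hx : law_cdf H x = 1.
  rewrite -(cvg_lim _ (FH x cx)) //; apply: cvg_lim => //.
  by apply: cvg_near_cst; exact: F1 (ltW Cx).
have mab : measurable (`[a, b]%classic : set (measurableTypeR R)) by exact: measurable_itv.
have mx : measurable (`]-oo, x]%classic : set (measurableTypeR R)) by exact: measurable_itv.
have mC : measurable (`]0, C']%classic : set (measurableTypeR R)) by exact: measurable_itv.
have Hx : H `]-oo, x]%classic = 1%E.
  by rewrite -hx /law_cdf fineK //; exact: fin_num_measure.
have c0 A : measurable (A : set (measurableTypeR R)) -> H A = 1%E -> H (~` A) = 0%E.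
  by move=> mA hA; rewrite probability_setC // hA subee.
suff : H (~` `]0, C']%classic) = 0%E.
  by move=> h; rewrite -[X in H X]setCK probability_setC ?h ?sube0 //; exact: measurableC.
apply/eqP; rewrite -measure_le0.
apply: (@le_trans _ _ (H (~` `[a, b]%classic `|` ~` `]-oo, x]%classic))).
  apply: le_measure; rewrite ?inE.
  - exact: measurableC.
  - by apply: measurableU; exact: measurableC.
  move=> y /= hy; have [hy1|hy1] := leP a y; last first.
    by left; rewrite in_itv /= leNgt hy1.
  right; rewrite in_itv /= => yx; apply: hy; rewrite in_itv /= (lt_le_trans a0 hy1) /=.
  exact: le_trans yx (ltW xC').
apply: le_trans (measureU2 _ _ _) _; try exact: measurableC.
by rewrite [X in (X + _)%E](c0 _ mab hab) [X in (_ + X)%E](c0 _ mx Hx) adde0.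
Qed.

End LimitLaws.

(** * Iterated limits as a filter *)

Section IteratedLimit.

(* p -> oo for each fixed L, and then L -> oo. *)
Definition iter_oo : set_system (nat * nat) :=
  fun A => \forall L \near \oo, \forall p \near \oo, A (L, p).

Lemma iter_oo_filter : ProperFilter iter_oo.
Proof.
split.
  move=> [N _ h]; have [M _ h'] := h N (leqnn N).
  exact: h' M (leqnn M).
split.
- by apply: nearW => L; exact: nearW.
- move=> A B FA FB; apply: (@filterS2 _ \oo _ _ _ _ _ FA FB) => L hA hB; exact: filterI.
- move=> A B AB; apply: (@filterS _ \oo) => L; apply: filterS => p; exact: AB.
Qed.
#[export] Existing Instance iter_oo_filter.

Context {R : realType}.

Lemma iter_cvg (u : nat -> nat -> R) (v : nat -> R) (c : R) :
  (forall L, u L p @[p --> \oo] --> v L) -> v L @[L --> \oo] --> c ->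
  u x.1 x.2 @[x --> iter_oo] --> c.
Proof.
move=> uv vc; apply/cvgrPdist_lt => e e0.
have h1 : \forall L \near \oo, `|c - v L| < e / 2 by apply: cvgr_dist_lt => //; exact: divr_gt0.
apply: filterS h1 => L hL.
have h2 : \forall p \near \oo, `|v L - u L p| < e / 2 by apply: cvgr_dist_lt => //; exact: divr_gt0.
apply: filterS h2 => p hp /=.
rewrite (splitr e); apply: (le_lt_trans (ler_distD (v L) _ _)); exact: ltrD.
Qed.

Lemma near_iter (A : nat -> nat -> Prop) :
  (forall L, \forall p \near \oo, A L p) -> \forall x \near iter_oo, A x.1 x.2.
Proof.
move=> h; have : \forall L \near \oo, \forall p \near \oo, A L p by exact: nearW.
by [].
Qed.

End IteratedLimit.

(** * Limit of the deterministic trace *)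

Section SpectralLimit.
Context {R : realType}.
Variables (n : nat -> nat -> nat) (Omega : forall p, 'M[R]_p) (Sigma : forall L p : nat, 'M[R]_p).
Variables (gam : nat -> R) (g c s : R) (HL : nat -> probability (measurableTypeR R) R)
  (H : probability (measurableTypeR R) R).
Hypotheses (c0 : 0 <= c) (s0 : 0 <= s).
Hypothesis pO : forall p, posdefmx (Omega p).
Hypothesis pS : forall L p, posdefmx (Sigma L p).
Hypothesis Oc : forall p, (0 < p)%N -> opbound (Omega p) c.
Hypothesis Ss : forall L p, opbound (Sigma L p) s.
Hypothesis ratio_cvg : forall L, p%:R / (n L.+1 p)%:R @[p --> \oo] --> gam L.
Hypothesis gam_cvg : gam L @[L --> \oo] --> g.
Hypothesis esd_cvg : forall L,
  cvg_in_distribution (fun p => esd_cdf (twist (Omega p) (Sigma L p))) (law_cdf (HL L)) /\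
  exists a b : R, 0 < a /\ HL L `[a, b]%classic = 1%E.
Hypothesis law_cvg : cvg_in_distribution (fun L => law_cdf (HL L)) (law_cdf H).
Hypothesis Hab : exists a b : R, 0 < a /\ H `[a, b]%classic = 1%E.

Let tau L p : (0 < p)%N -> exists tau : 'I_p -> R, [/\ forall i, 0 < tau i <= c * s,
    forall x, esd_cdf (twist (Omega p) (Sigma L p)) x = p%:R^-1 * \sum_i (tau i <= x)%R%:R &
    forall l t, 0 < l -> 0 <= t ->
      \tr (Sigma L p *m det_resolvent t (Sigma L p) (l *: invmx (Omega p))) = \sum_i mp_fun l t (tau i)].
Proof. by move=> p0; apply: spectral_twist => //; exact: Oc. Qed.

Let HLsupp L C : c * s < C -> HL L `]0, C]%classic = 1%E.
Proof.
move=> hC; have [cvL [a [b [a0 hab]]]] := esd_cvg L.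
apply: (law_support a0 hab cvL _ hC) => x hx; near=> p.
have p0 : (0 < p)%N by near: p; exact: nbhs_infty_gt.
have [ta [h1 -> _]] := tau L p0.
have -> : \sum_i (ta i <= x)%R%:R = p%:R :> R.
  rewrite (eq_bigr (fun=> 1)) ?sumr_const ?card_ord // => i _.
  by have /andP[_ h] := h1 i; rewrite (le_trans h hx).
by rewrite mulVf // pnatr_eq0 -lt0n.
Unshelve. all: by end_near.
Qed.

(** Each passage to the limit requires some room on the right: c s bounds the eigenvalues, c s + 1
    serves for all the laws [HL L], and c s + 2 for their limit. *)
Lemma limit_law_support : H `]0, c * s + 2]%classic = 1%E.
Proof.
have [a [b [a0 hab]]] := Hab.
apply: (law_support (C := c * s + 1) a0 hab law_cvg); last by rewrite ltrD2l ltr1n.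
by move=> x hx; apply: nearW => L; apply: law_cdf_eq1 hx; apply: HLsupp; rewrite ltrDl.
Qed.

(** The trace over n is p / n times a spectral mean of [mp_fun l t]. Weak convergence is applied
    twice, in p and then in L, with the interval and the Lipschitz constant 1 / l common to all
    laws. *)
Lemma trace_det_resolvent_cvg l t : 0 < l -> 0 <= t ->
  (n x.1.+1 x.2)%:R^-1 * \tr (Sigma x.1 x.2 *m det_resolvent t (Sigma x.1 x.2) (l *: invmx (Omega x.2)))
   @[x --> iter_oo] --> g * EE H (mp_fun l t).
Proof.
move=> l0 t0; have C0 : 0 <= c * s by exact: mulr_ge0.
have lip := @mp_fun_lipschitz R l t; have li0 : 0 <= l^-1 by rewrite invr_ge0 ltW.
have bnd : forall x : R, 0 < x <= c * s + 2 -> `|mp_fun l t x| <= l^-1 * (c * s + 2).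
  move=> x /andP[x0 xC]; apply: (le_trans (mp_fun_bound l0 t0 (ltW x0))).
  by rewrite ler_wpM2l.
apply: (@iter_cvg _ (fun L p => (n L.+1 p)%:R^-1 * \tr (Sigma L p *m det_resolvent t (Sigma L p) (l *: invmx (Omega p))))
   (fun L => gam L * EE (HL L) (mp_fun l t))).
  move=> L; have [cvL [a [b [a0 hab]]]] := esd_cvg L.
  have cm : p%:R^-1 * \tr (Sigma L p *m det_resolvent t (Sigma L p) (l *: invmx (Omega p)))
      @[p --> \oo] --> EE (HL L) (mp_fun l t).
    apply: (@step_approx_cvg _ (mp_fun l t) (fun p => esd_cdf (twist (Omega p) (Sigma L p)))
      (law_cdf (HL L)) _ _ (c * s + 2) l^-1 a) => //.
    - exact: law_cdf_mono.
    - exact: law_cdf01.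
    - by move=> x; exact: law_cdf_eq0 hab.
    - near=> p; have p0 : (0 < p)%N by near: p; exact: nbhs_infty_gt.
      have [ta [h1 h2 h3]] := tau L p0.
      rewrite h3 //; have -> : esd_cdf (twist (Omega p) (Sigma L p)) = (fun y => p%:R^-1 * \sum_i (ta i <= y)%R%:R).
        by apply/funext.
      apply: step_approx_mean => //; first by move=> x y; exact: lip.
      move=> i; have /andP[-> h] := h1 i; apply: (le_trans h); by rewrite lerDl.
    - apply: step_approx_EE => //.
      + by apply: HLsupp; rewrite ltrDl.
      + exact: measurable_mp_fun.
      + by move=> x y; exact: lip.
      + exact: bnd.
  apply: cvg_trans (cvgM (ratio_cvg (L := L)) cm); apply: near_eq_cvg; near=> p.
  have p0 : (0 < p)%N by near: p; exact: nbhs_infty_gt.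
  by rewrite /= mulrACA divff ?mul1r // pnatr_eq0 -lt0n.
apply: cvgM => //.
have [a [b [a0 hab]]] := Hab.
apply: (@step_approx_cvg _ (mp_fun l t) (fun L => law_cdf (HL L))
      (law_cdf H) _ _ (c * s + 2) l^-1 a) => //.
- exact: law_cdf_mono.
- exact: law_cdf01.
- by move=> x; exact: law_cdf_eq0 hab.
- apply: nearW => L; apply: step_approx_EE => //.
  + by apply: HLsupp; rewrite ltrDl.
  + exact: measurable_mp_fun.
  + by move=> x y; exact: lip.
  + exact: bnd.
- apply: step_approx_EE => //.
  + exact: limit_law_support.
  + exact: measurable_mp_fun.
  + by move=> x y; exact: lip.
  + exact: bnd.
Unshelve. all: by end_near.
Qed.

End SpectralLimit.

(** * Convergence of the risk *)

Section ConvergenceInProbability.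
Context {R : realType} {d : measure_display} {T : measurableType d}.
Variables (P : probability T R) (F : set_system (nat * nat)).
Context {FF : Filter F}.

(** Phrased with a measurable exceptional set, so that deterministic implications act on Q pointwise
    without measurability questions. *)
Definition with_high_prob (Q : nat * nat -> T -> Prop) : Prop :=
  forall delta : R, 0 < delta -> \forall x \near F,
    exists E, [/\ measurable E, (P E <= delta%:E)%E & forall w, ~ E w -> Q x w].

Lemma whp_imp (Q Q' : nat * nat -> T -> Prop) :
  (\forall x \near F, forall w, Q x w -> Q' x w) ->
  with_high_prob Q -> with_high_prob Q'.
Proof.
move=> h hQ delta d0; apply: filterS2 h (hQ delta d0) => x QQ' [E [mE PE EQ]].
by exists E; split=> // w Ew; exact/QQ'/EQ.
Qed.

Lemma whp_near (Q : nat * nat -> Prop) : (\forall x \near F, Q x) ->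
  with_high_prob (fun x _ => Q x).
Proof.
move=> h delta d0; apply: filterS h => x Qx; exists set0; split => //.
by rewrite measure0 lee_fin ltW.
Qed.

Lemma whp_and (Q Q' : nat * nat -> T -> Prop) :
  with_high_prob Q -> with_high_prob Q' -> with_high_prob (fun x w => Q x w /\ Q' x w).
Proof.
move=> hQ hQ' delta d0; have d2 : 0 < delta / 2 by exact: divr_gt0.
apply: filterS2 (hQ _ d2) (hQ' _ d2) => x [E [mE PE EQ]] [E' [mE' PE' EQ']].
exists (E `|` E'); split; first exact: measurableU.
  by apply: (le_trans (measureU2 _ mE mE')); rewrite (splitr delta) EFinD leeD.
by move=> w /not_orP[h h']; split; [exact: EQ|exact: EQ'].
Qed.

Definition cvg_prob (V : nat * nat -> T -> R) (c : R) : Prop :=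
  forall e, 0 < e -> with_high_prob (fun x w => `|V x w - c| <= e).

Lemma cvg_prob_det (v : nat * nat -> R) c : v x @[x --> F] --> c ->
  cvg_prob (fun x _ => v x) c.
Proof.
move=> vc e e0; apply: whp_near.
by move/cvgr_distC_le : vc => /(_ _ e0).
Qed.

Lemma cvg_probD V W a b : cvg_prob V a -> cvg_prob W b ->
  cvg_prob (fun x w => V x w + W x w) (a + b).
Proof.
move=> hV hW e e0; have e2 : 0 < e / 2 by exact: divr_gt0.
apply: whp_imp (whp_and (hV _ e2) (hW _ e2)); apply: nearW => x w [h1 h2].
by rewrite opprD addrACA (splitr e); apply: (le_trans (ler_normD _ _)); exact: lerD.
Qed.

Lemma cvg_probM V W a b : cvg_prob V a -> cvg_prob W b ->
  cvg_prob (fun x w => V x w * W x w) (a * b).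
Proof.
move=> hV hW e e0; pose k := 1 + `|a| + `|b|.
have k0 : 0 < k by rewrite /k -addrA ltr_pwDl // addr_ge0.
(* Capping at 1 makes the product of the two deviations at most e' itself. *)
pose e' := Num.min 1 (e / k).
have e'0 : 0 < e' by rewrite lt_min ltr01 divr_gt0.
apply: whp_imp (whp_and (hV _ e'0) (hW _ e'0)); apply: nearW => x w [h1 h2].
have -> : V x w * W x w - a * b = (V x w - a) * (W x w - b) + (V x w - a) * b + a * (W x w - b).
  by ring.
have e'1 : e' <= 1 by rewrite ge_min lexx.
apply: (@le_trans _ _ (e' * 1 + e' * `|b| + `|a| * e')).
  apply: (le_trans (ler_normD _ _)); apply: lerD; last by rewrite normrM ler_wpM2l.
  apply: (le_trans (ler_normD _ _)); rewrite !normrM; apply: lerD.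
    by apply: ler_pM => //; exact: le_trans h2 e'1.
  by rewrite ler_wpM2r.
have -> : e' * 1 + e' * `|b| + `|a| * e' = e' * k by rewrite /k; ring.
by rewrite -ler_pdivlMr // ge_min lexx orbT.
Qed.

End ConvergenceInProbability.

(** * Convergence in probability in the model *)

Section RiskConvergence.
Context {R : realType} {d : measure_display} {T : measurableType d}.
Variable P : probability T R.
Variables (n : nat -> nat -> nat) (lambda sigma cm cop : R)
  (Omega : forall p : nat, 'M[R]_p) (Sigma : forall L p : nat, 'M[R]_p)
  (Z : forall L p : nat, T -> 'M[R]_(n L.+1 p, p))
  (beta : forall L p : nat, T -> 'cV[R]_p)
  (eps : forall L p : nat, T -> 'cV[R]_(n L.+1 p))
  (xnew : forall L p : nat, T -> 'cV[R]_p)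
  (epsnew : forall L p : nat, T -> R)
  (Omegahat : forall L p : nat, T -> 'M[R]_p).
Hypothesis l0 : 0 < lambda.
Hypothesis M : forall L p, test_task_model P cm cop sigma (Sigma L p) (Omega p) (Z L p)
     (beta L p) (eps L p) (xnew L p) (epsnew L p) (Omegahat L p).
Variables (c m s g : R) (gam : nat -> R) (HL : nat -> probability (measurableTypeR R) R)
     (H : probability (measurableTypeR R) R) (sH : R -> R)
     (risk : forall L p : nat, T -> R).
Hypotheses (c0 : 0 < c) (m0 : 0 < m) (s0 : 0 < s) (g0 : 0 < g).
Hypothesis n_cvg : forall l : nat, n l.+1 p @[p --> \oo] --> \oo.
Hypothesis ratio_cvg : forall L, p%:R / (n L.+1 p)%:R @[p --> \oo] --> gam L.
Hypothesis gam_cvg : gam L @[L --> \oo] --> g.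
Hypothesis esd_cvg : forall L,
  cvg_in_distribution (fun p => esd_cdf (twist (Omega p) (Sigma L p))) (law_cdf (HL L)) /\
  exists a b : R, 0 < a /\ HL L `[a, b]%classic = 1%E.
Hypothesis law_cvg : cvg_in_distribution (fun L => law_cdf (HL L)) (law_cdf H).
Hypothesis Hab : exists a b : R, 0 < a /\ H `[a, b]%classic = 1%E.
Hypothesis Omegahat_cvg :
  cvg_in_prob_pL P (fun L p w => opnorm (Omegahat L p w - Omega p)) 0.
Hypothesis Oc : forall p, (0 < p)%N -> opbound (Omega p) c.
Hypothesis Om : forall p, (0 < p)%N -> opbound (invmx (Omega p)) m.
Hypothesis Ss : forall L p, opbound (Sigma L p) s.
Hypothesis mps : mp_solution g H sH.
Hypothesis risk_version : forall L p, is_predictive_risk P lambda (Sigma L p) (Z L p) (beta L p)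
        (eps L p) (xnew L p) (epsnew L p) (Omegahat L p) (risk L p).

Local Notation N x := (n x.1.+1 x.2).
Local Notation O x := (Omega x.2).
Local Notation S x := (Sigma x.1 x.2).
Local Notation X x w := (design (Sigma x.1 x.2) (Z x.1 x.2) w).
Local Notation Oh x w := (Omegahat x.1 x.2 w).
Local Notation cvgp := (cvg_prob P iter_oo).
Local Notation whp := (with_high_prob P iter_oo).
Local Notation t l := (mp_t g sH l).

Let pO p : posdefmx (Omega p) := Omega_posdef (M 0 p).
Let pS L p : posdefmx (Sigma L p) := Sigma_posdef (M L p).
Let suppH := limit_law_support (ltW c0) (ltW s0) pO pS Oc Ss esd_cvg law_cvg Hab.

Let p_gt0 : \forall x \near iter_oo, (0 < x.2)%N.
Proof. by apply: (@near_iter (fun _ p => (0 < p)%N)) => L; exact: nbhs_infty_gt. Qed.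

Let n_gt0 : \forall x \near iter_oo, (0 < N x)%N.
Proof.
apply: (@near_iter (fun L p => (0 < n L.+1 p)%N)) => L.
by have /(_ [set k | (0 < k)%N]) := @n_cvg L; apply; exact: nbhs_infty_gt.
Qed.

Let ratioE : x.2%:R / (N x)%:R @[x --> iter_oo] --> g.
Proof. exact: (@iter_cvg _ (fun L p => p%:R / (n L.+1 p)%:R)) ratio_cvg gam_cvg. Qed.

Let inv_n : (N x)%:R^-1 @[x --> iter_oo] --> (0 : R).
Proof.
apply: (@iter_cvg _ (fun L p => (n L.+1 p)%:R^-1) (fun=> 0)); last exact: cvg_cst.
move=> L; apply: (@cvg_comp _ _ _ (fun p => n L.+1 p) (fun k => k%:R^-1 : R) _ \oo).
  exact: n_cvg.
have h : (fun k : nat => (k%:R : R)^-1) @ \oo --> (0 : R).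
  apply/gtr0_cvgV0; last exact: cvgr_idn.
  by near=> k; rewrite ltr0n; near: k; exact: nbhs_infty_gt.
exact: h.
Unshelve. all: by end_near.
Qed.

Lemma trace_Q_whp l : 0 < l -> cvgp (fun x w => trace_Q l (S x) (O x) (X x w)) (t l).
Proof.
move=> ll0 e e0 delta d0.
pose rho := l / c; have rho0 : 0 < rho by exact: divr_gt0.
pose tt := t l; have t0 : 0 <= tt := mp_t_ge0 g0 suppH mps ll0.
(* [A], [B1] and [B2] are the coefficients in [fixed_point_bound], with p / n replaced by its
   eventual bound g + 1. Each of its three error terms gets the share e / A / 3; for the last one
   this is B2 (2 ep), which explains the 6 in [ep]. *)
pose A := (s + rho) / rho; have A0 : 0 < A by rewrite divr_gt0 // addr_gt0.
pose B2 := 1 + (1 + tt) * ((g + 1) * (s / rho)).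
have B20 : 0 < B2 by rewrite /B2 ltr_pwDl //; nonneg.
pose ep := e / A / B2 / 6; have ep0 : 0 < ep by do 3 (apply: divr_gt0 => //).
pose B1 := (1 + tt) * (1 + (g + 1) * (s / rho)) * (s / rho).
pose kk := (8 + cm *+ 4) * ((s / rho) ^+ 2 + (s / rho) ^+ 4).
have r1 : (fun x => `|(N x)%:R^-1 * \tr (S x *m det_resolvent tt (S x) (l *: invmx (O x))) - tt|)
    @ iter_oo --> (0 : R).
  rewrite -(normr0 R); apply: cvg_norm; rewrite -(subrr tt); apply: cvgB; last exact: cvg_cst.
  rewrite [Y in _ --> Y](mp_tE suppH mps ll0).
  exact: (trace_det_resolvent_cvg (ltW c0) (ltW s0) pO pS Oc Ss ratio_cvg gam_cvg esd_cvg law_cvg Hab).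
have r2 : (fun x => B1 * (N x)%:R^-1) @ iter_oo --> (0 : R).
  by rewrite -(mulr0 B1); apply: cvgM => //; exact: cvg_cst.
have r3 : (fun x => kk * (x.2%:R / (N x)%:R) * (N x)%:R^-1 / ep ^+ 2) @ iter_oo --> (0 : R).
  have -> : 0 = kk * g * 0 / ep ^+ 2 :> R by rewrite mulr0 mul0r.
  apply: cvgM; last exact: cvg_cst.
  by apply: cvgM => //; apply: cvgM => //; exact: cvg_cst.
have e3 : 0 < e / A / 3 by do 2 (apply: divr_gt0 => //).
near=> x.
have p0 : (0 < x.2)%N by near: x.
have n0 : (0 < N x)%N by near: x.
have Mx := M x.1 x.2.
have P_ge v : rho * dotv v v <= dotv v ((l *: invmx (O x)) *m v).
  by apply: ridge_P_ge => // u; exact/opbound_quad/Oc.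
have S_le v : dotv v (S x *m v) <= s * dotv v v by exact: opbound_quad.
have pP : posdefmx (l *: invmx (O x)) by exact/posdefZ/posdef_inv.
have mZ12 i j : measurable_fun [set: T] (fun w => Z x.1 x.2 w i j ^+ 12).
  by apply: measurable_funX; exact: (random_mx_measurable (Z_random Mx)).
have LZ12 i j : L1 P (fun w => Z x.1 x.2 w i j ^+ 12).
  apply: expectation_L1 (Z_moment12 Mx i j) => // w.
  by rewrite (exprM _ 2 6) exprn_ge0 // sqr_ge0.
have EZ12 i j : EE P (fun w => Z x.1 x.2 w i j ^+ 12) <= cm.
  have := Z_moment12 Mx i j; rewrite unlock -lee_fin -EE_fin //.
have [mE PE] := quad_dev_prob n0 p0 (Z_random Mx) (Z_iid Mx)
  (fun i j => expectation_EE (Z_mean Mx i j)) (fun i j => expectation_EE (Z_variance Mx i j))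
  LZ12 EZ12 rho0 s0 t0 (posdef_psd (pS x.1 x.2)) pP S_le P_ge ep0.
exists [set w | ep ^+ 2 < quad_dev tt (S x) (l *: invmx (O x)) (X x w)]; split=> //.
  apply: (le_trans PE); rewrite lee_fin -/kk ltW //.
  by near: x; apply: (cvgr_lt (0 : R)) => //; exact: r3.
move=> w /= /negP; rewrite -leNgt => hw.
have q1 : x.2%:R / (N x)%:R <= g + 1.
  near: x; apply: cvgr_le; [exact: ratioE|by rewrite ltrDl].
have q0 : 0 <= x.2%:R / (N x)%:R :> R by rewrite divr_ge0.
have fp := fixed_point_bound rho0 s0 t0 (posdef_psd (pS x.1 x.2)) pP S_le P_ge n0 ep0 hw.
apply: (le_trans fp).
have h1 : `|(N x)%:R^-1 * \tr (S x *m det_resolvent tt (S x) (l *: invmx (O x))) - tt| <= e / A / 3.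
  by near: x; apply: (cvgr_le (0 : R)) => //; exact: r1.
have h2 : B1 * (N x)%:R^-1 <= e / A / 3.
  by near: x; apply: (cvgr_le (0 : R)) => //; exact: r2.
have sr0 : 0 <= s / rho by rewrite divr_ge0 // ltW.
have tt1 : 0 <= 1 + tt by rewrite addr_ge0.
have h2' : (1 + tt) * (1 + x.2%:R / (N x)%:R * (s / rho)) * (s / rho) / (N x)%:R <= B1 * (N x)%:R^-1.
  rewrite ler_wpM2r ?invr_ge0 // ler_wpM2r // ler_wpM2l // lerD2l ler_wpM2r //.
have h3 : (1 + (1 + tt) * (x.2%:R / (N x)%:R * (s / rho))) * (ep *+ 2) <= e / A / 3.
  apply: (@le_trans _ _ (B2 * (ep *+ 2))).
    rewrite ler_wpM2r ?mulrn_wge0 ?(ltW ep0) // lerD2l ler_wpM2l // ler_wpM2r //.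
  rewrite le_eqVlt; apply/orP; left; apply/eqP; rewrite /ep; field.
  by rewrite !gt_eqF.
have : e = A * (e / A / 3 + e / A / 3 + e / A / 3) by field; rewrite gt_eqF.
move=> ->; rewrite ler_wpM2l ?(ltW A0) //.
by apply: lerD => //; apply: lerD => //; exact: le_trans h2' h2.
Unshelve. all: by end_near.
Qed.

(** The increment h is fixed before the dimensions: small enough for the difference quotient of the
    limit, and for the finite-dimensional error, which is linear in h with a uniform constant. Then
    [trace_Q_whp] is used at lambda and lambda + h only. *)
Lemma trace_QAQ_whp :
  cvgp (fun x w => trace_QAQ lambda (S x) (O x) (X x w)) (mp_du g H sH lambda / mp_u g sH lambda ^+ 2).
Proof.
move=> e e0; set D := _ / _.
pose K := s * (c / lambda * m * (1 * (c / lambda * m * (c / lambda)))).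
have K0 : 0 <= K by rewrite /K; nonneg.
have e3 : 0 < e / 3 by exact: divr_gt0.
have [h [h0 hD hK]] : exists h : R, [/\ 0 < h, `|(t lambda - t (lambda + h)) / h - D| <= e / 3 &
    (g + 1) * (K * h) <= e / 3].
  have cD := mp_t_slope_cvg g0 suppH mps l0.
  have b1 : \forall h \near (0 : R)^', `|(t lambda - t (lambda + h)) / h - D| <= e / 3.
    by move/cvgr_distC_le : cD => /(_ _ e3).
  have b2 : \forall h \near (0 : R)^'+, `|(t lambda - t (lambda + h)) / h - D| <= e / 3.
    move: b1; rewrite !near_withinE; apply: filterS => h hh h0; apply: hh.
    by rewrite /= gt_eqF.
  near (0 : R)^'+ => h.
  exists h; split; [by near: h; exact: nbhs_right_gt|by near: h; exact: b2|].
  have hK : h <= (e / 3) / ((g + 1) * (K + 1)).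
    near: h; apply: nbhs_right_le; rewrite divr_gt0 //.
    by apply: mulr_gt0; [rewrite addr_gt0|rewrite ltr_wpDl].
  have h0 : 0 < h by near: h; exact: nbhs_right_gt.
  have gK : 0 < (g + 1) * (K + 1) by apply: mulr_gt0; [rewrite addr_gt0|rewrite ltr_wpDl].
  rewrite mulrA; move: hK; rewrite ler_pdivlMr // mulrC; apply: le_trans.
  by rewrite ler_wpM2r ?(ltW h0) // ler_wpM2l ?addr_ge0 ?(ltW g0) // lerDl.
(* Two deviations of size h e / 6, divided by h, amount to e / 3. *)
have b0 : 0 < h * e / 6 by rewrite divr_gt0 // mulr_gt0.
have lh0 : 0 < lambda + h by exact: addr_gt0.
apply: whp_imp (whp_and (trace_Q_whp l0 b0) (trace_Q_whp lh0 b0)).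
near=> x; move=> w [h1 h2].
have p0 : (0 < x.2)%N by near: x.
have q1 : x.2%:R / (N x)%:R <= g + 1.
  by near: x; apply: cvgr_le; [exact: ratioE|rewrite ltrDl].
have hA v : dotv v (O x *m v) <= c * dotv v v by exact/opbound_quad/Oc.
have := trace_Q_diff (X x w) l0 h0 c0 (pO x.2) hA (Om p0) (Ss x.1 x.2).
set psi := trace_QAQ _ _ _ _; set f1 := trace_Q lambda _ _ _ in h1 *; set f2 := trace_Q _ _ _ _ in h2 * => h3.
have {}h3 : `|psi - (f1 - f2) / h| <= e / 3.
  apply: (le_trans h3); apply: le_trans hK; rewrite [Y in _ * Y <= _](_ : _ = K * h); last by rewrite /K; ring.
  by rewrite ler_wpM2r // mulr_ge0 // ltW.
have h4 : `|((f1 - t lambda) - (f2 - t (lambda + h))) / h| <= e / 3.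
  rewrite normrM [`|h^-1|]gtr0_norm ?invr_gt0 // ler_pdivrMr //.
  apply: (le_trans (ler_normB _ _)); apply: (le_trans (lerD h1 h2)).
  by rewrite le_eqVlt; apply/orP; left; apply/eqP; field.
have -> : psi - D = (psi - (f1 - f2) / h) + ((f1 - t lambda) - (f2 - t (lambda + h))) / h
   + ((t lambda - t (lambda + h)) / h - D) by field; rewrite gt_eqF.
have -> : e = e / 3 + e / 3 + e / 3 by field.
by apply: (le_trans (ler_normD _ _)); apply: lerD => //; apply: (le_trans (ler_normD _ _)); exact: lerD.
Unshelve. all: by end_near.
Qed.

Lemma risk_formula_Omega_whp :
  cvgp (fun x w => risk_formula lambda sigma (S x) (O x) (O x) (X x w)) (risk_limit lambda sigma g sH).
Proof.
rewrite (mp_risk_limit g0 suppH mps) //.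
have iq : (N x)%:R / x.2%:R @[x --> iter_oo] --> g^-1.
  have -> : (fun x : nat * nat => (N x)%:R / x.2%:R : R) = (fun x => (x.2%:R / (N x)%:R)^-1).
    by apply/funext => x; rewrite invfM invrK mulrC.
  by apply: cvgV; [rewrite gt_eqF|exact: ratioE].
have c1 : lambda * (lambda * ((N x)%:R / x.2%:R) - sigma ^+ 2) @[x --> iter_oo]
    --> lambda * (lambda / g - sigma ^+ 2).
  apply: cvgM; first exact: cvg_cst.
  by apply: cvgB; [apply: cvgM => //; exact: cvg_cst|exact: cvg_cst].
have cs a : cvgp (fun _ _ => a) a by apply: cvg_prob_det; exact: cvg_cst.
have h : cvgp (fun x w => sigma ^+ 2 + sigma ^+ 2 * trace_Q lambda (S x) (O x) (X x w)
   + lambda * (lambda * ((N x)%:R / x.2%:R) - sigma ^+ 2) * trace_QAQ lambda (S x) (O x) (X x w))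
   (sigma ^+ 2 + sigma ^+ 2 * t lambda + lambda * (lambda / g - sigma ^+ 2)
     * (mp_du g H sH lambda / mp_u g sH lambda ^+ 2)).
  apply: cvg_probD.
    by apply: cvg_probD; [exact: cs|apply: cvg_probM; [exact: cs|exact: trace_Q_whp]].
  by apply: cvg_probM; [exact: cvg_prob_det|exact: trace_QAQ_whp].
move=> e e0; apply: whp_imp (h e e0); near=> x; move=> w.
by rewrite risk_formula_Omega //; near: x.
Unshelve. all: by end_near.
Qed.

Lemma risk_whp : cvgp (fun x w => risk x.1 x.2 w) (risk_limit lambda sigma g sH).
Proof.
have [kappa k0 hk] := @risk_formula_perturb R lambda sigma m c s l0 m0 c0 (ltW s0).
have d1 : cvgp (fun x w => risk_formula lambda sigma (S x) (O x) (Oh x w) (X x w)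
   - risk_formula lambda sigma (S x) (O x) (O x) (X x w)) 0.
  move=> e e0.
  (* The first two terms are the smallness conditions of [risk_formula_perturb]; the third makes its
     bound at most e, as 1 + p / n is eventually at most g + 2. *)
  pose eta := Num.min (Num.min c (m^-1 / 2)) (e / ((kappa + 1) * (g + 2))).
  have kg : 0 < (kappa + 1) * (g + 2) by apply: mulr_gt0; [rewrite ltr_wpDl|rewrite addr_gt0].
  have eta0 : 0 < eta by rewrite !lt_min c0 !divr_gt0 ?invr_gt0.
  have w1 : whp (fun x w => opnorm (Oh x w - O x) < eta).
    move=> delta dl0; have h := Omegahat_cvg eta0 dl0.
    apply: (@filterS _ \oo) h => L; apply: (@filterS _ \oo) => p /= hp.
    exists [set w | eta <= opnorm (Omegahat L p w - Omega p)]; split.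
    - apply: measurable_opnorm => //; apply: mx_measurableD.
        exact: (random_mx_measurable (Omegahat_random (M L p))).
      exact: mx_measurable_cst.
    - apply/ltW; apply: le_lt_trans hp; rewrite le_eqVlt; apply/orP; left; apply/eqP.
      congr (P _); apply/funext => w /=; rewrite subr0 ger0_norm //.
      by case: (opnorm_opbound (Omegahat L p w - Omega p)).
    - by move=> w /= /negP; rewrite -ltNge.
  apply: whp_imp w1; near=> x; move=> w ho; rewrite subr0.
  have p0 : (0 < x.2)%N by near: x.
  have q1 : x.2%:R / (N x)%:R <= g + 1.
    by near: x; apply: cvgr_le; [exact: ratioE|rewrite ltrDl].
  have hE : opbound (Oh x w - O x) eta by apply: opbound_le (opnorm_opbound _) (ltW ho).
  have e1 : eta <= c by rewrite !ge_min lexx.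
  have e2 : eta * m <= 2^-1.
    rewrite -ler_pdivlMr // mulrC ge_min; apply/orP; left; by rewrite ge_min lexx orbT.
  apply: (le_trans (hk _ _ _ _ _ _ _ (Ss x.1 x.2) (pO x.2) (Omegahat_posdef (M x.1 x.2) w) (Oc p0) (Om p0) hE e2 e1)).
  have e3 : eta <= e / ((kappa + 1) * (g + 2)) by rewrite ge_min lexx orbT.
  move: e3; rewrite ler_pdivlMr // mulrC; apply: le_trans.
  rewrite ler_wpM2r ?(ltW eta0) //; have q0 : 0 <= 1 + x.2%:R / (N x)%:R :> R by rewrite addr_ge0 // divr_ge0.
  have q2 : 1 + x.2%:R / (N x)%:R <= g + 2 by move: q1; lra.
  by apply: ler_pM => //; rewrite lerDl.
have d2 : cvgp (fun x w => risk x.1 x.2 w - risk_formula lambda sigma (S x) (O x) (Oh x w) (X x w)) 0.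
  move=> e e0 delta dl0; near=> x.
  have p0 : (0 < x.2)%N by near: x.
  have n0 : (0 < N x)%N by near: x.
  have [mE PE] := risk_formula_ae (M x.1 x.2) n0 l0 p0 (@risk_version x.1 x.2) e0.
  exists [set w | e < `|risk x.1 x.2 w - risk_formula lambda sigma (S x) (O x) (Oh x w) (X x w)|].
  split=> //; first by rewrite PE lee_fin ltW.
  by move=> w /= /negP; rewrite -leNgt subr0.
have h : cvgp (fun x w => (risk x.1 x.2 w - risk_formula lambda sigma (S x) (O x) (Oh x w) (X x w))
  + (risk_formula lambda sigma (S x) (O x) (Oh x w) (X x w)
    - risk_formula lambda sigma (S x) (O x) (O x) (X x w)
    + risk_formula lambda sigma (S x) (O x) (O x) (X x w))) (0 + (0 + risk_limit lambda sigma g sH)).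
  by apply: cvg_probD => //; apply: cvg_probD => //; exact: risk_formula_Omega_whp.
rewrite !add0r in h; move=> e e0.
apply: whp_imp (h e e0); apply: nearW => x w.
move: (risk _ _ _) (risk_formula _ _ _ _ _ _) (risk_formula _ _ _ _ _ _) => a c' b.
by have -> : a - b + (b - c' + c') - risk_limit lambda sigma g sH = a - risk_limit lambda sigma g sH by ring.
Unshelve. all: by end_near.
Qed.

Lemma risk_cvg_in_prob : cvg_in_prob_pL P risk (risk_limit lambda sigma g sH).
Proof.
move=> eta delta eta0 dl0.
(* Halving passes from the large inequalities of [with_high_prob] to the strict ones of
   [cvg_in_prob_pL]. *)
have e2 : 0 < eta / 2 by exact: divr_gt0.
have d2 : 0 < delta / 2 by exact: divr_gt0.
have h : \forall x \near iter_oo, (0 < N x)%N /\ exists E : set T,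
    [/\ measurable E, (P E <= (delta / 2)%:E)%E & forall w, ~ E w -> `|risk x.1 x.2 w - risk_limit lambda sigma g sH| <= eta / 2].
  by apply: filterI; [exact: n_gt0|exact: risk_whp].
apply: (@filterS _ \oo) h => L; apply: (@filterS _ \oo) => p /= [n0 [E [mE PE hE]]].
apply: (@le_lt_trans _ _ (P E)); last first.
  by apply: (le_lt_trans PE); rewrite lte_fin ltr_pdivrMr // ltr_pMr // ltr1n.
have mr : measurable_fun [set: T] (risk L p).
  have [sr _ _] := risk_version L p.
  apply: sub_measurable_fun (_ : sub_measurable (sigma_mx (design (Sigma L p) (Z L p)) `|` sigma_mx (Omegahat L p)) _).
    by move=> A [FA|FA]; [exact: design_random (M L p) _ FA|exact: (Omegahat_random (M L p))].
  exact/sub_measurableP.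
apply: le_measure; rewrite ?inE //.
  have -> : [set w | eta <= `|risk L p w - risk_limit lambda sigma g sH|]
    = ~` [set w | `|risk L p w - risk_limit lambda sigma g sH| < eta].
    by apply/seteqP; split => w /=; rewrite leNgt => /negP.
  apply: measurableC.
  rewrite (_ : [set w | _] = [set: T] `&` (fun w => `|risk L p w - risk_limit lambda sigma g sH|) @^-1` `]-oo, eta[%classic); last first.
    by rewrite setTI; apply/seteqP; split => w /=; rewrite in_itv.
  apply: (measurableT_comp (@normr_measurable R setT)); last exact: measurable_itv.
    by apply: measurable_funB => //; exact: measurable_cst.
  exact: measurableT.
move=> w /= hw; apply: contrapT => /hE h; move: (le_trans hw h).
by rewrite leNgt ltr_pdivrMr // ltr_pMr // ltr1n.
Qed.

End RiskConvergence.

(* L is the number of training tasks, l = 1, ..., L index the training tasks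
   and L.+1 is the test task; n l p is the sample size of task l in dimension
   p.  Test-task objects are indexed by L: Sigma L p is Sigma^(L+1), gam L is
   gamma_(L+1), HL L is H_(Lambda^(L+1)), and so on.
   The last two factors in the trace are taken at Omega: with Omegahat in their
   place the identity already fails for p = 1. *)
Theorem theorem2p4 (R : realType) (d : measure_display) (T : measurableType d)
  (P : probability T R)
  (n : nat -> nat -> nat)
  (lambda sigma cm cop : R)
  (Omega : forall p : nat, 'M[R]_p)
  (Sigma : forall L p : nat, 'M[R]_p)
  (Z : forall L p : nat, T -> 'M[R]_(n L.+1 p, p))
  (beta : forall L p : nat, T -> 'cV[R]_p)
  (eps : forall L p : nat, T -> 'cV[R]_(n L.+1 p))
  (xnew : forall L p : nat, T -> 'cV[R]_p)
  (epsnew : forall L p : nat, T -> R)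
  (Xtr : forall (L p : nat) (l : 'I_L), T -> 'M[R]_(n l.+1 p, p))
  (ytr : forall (L p : nat) (l : 'I_L), T -> 'cV[R]_(n l.+1 p))
  (Omegahat : forall L p : nat, T -> 'M[R]_p) :
  0 < lambda ->
  (forall L p, test_task_model P cm cop sigma (Sigma L p) (Omega p) (Z L p)
     (beta L p) (eps L p) (xnew L p) (epsnew L p) (Omegahat L p)) ->
  (forall L p l, random_mx (Xtr L p l) /\ random_mx (ytr L p l)) ->
  (forall L p, computed_from (Xtr L p) (ytr L p) (Omegahat L p)) ->
  (forall (L p : nat) (w : T),
     let X := design (Sigma L p) (Z L p) w in
     let Oh := Omegahat L p w in
     variance_term sigma lambda (Sigma L p) X Oh
       - variance_term sigma lambda (Sigma L p) X (Omega p)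
     = - (lambda * sigma ^+ 2) / (n L.+1 p)%:R *
       \tr (mxsqrt (Omega p) *m Sigma L p *m mxsqrt Oh
              *m resolvent lambda Oh (sample_cov X)
              *m mxsqrt Oh *m (invmx Oh - invmx (Omega p))
              *m mxsqrt (Omega p)
              *m resolvent lambda (Omega p) (sample_cov X)))
  /\
  (forall (c1 c2 cOmega gamstar : R) (gam : nat -> R)
     (HL : nat -> probability (measurableTypeR R) R)
     (H : probability (measurableTypeR R) R) (s : R -> R)
     (risk : forall L p : nat, T -> R),
     (forall l : nat, n l.+1 p @[p --> \oo] --> \oo) ->
     (forall L : nat, p%:R / (n L.+1 p)%:R @[p --> \oo] --> gam L) ->
     gam L @[L --> \oo] --> gamstar ->
     1 < gamstar ->
     (forall L : nat,
        cvg_in_distribution (fun p => esd_cdf (twist (Omega p) (Sigma L p)))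
          (law_cdf (HL L)) /\
        exists a b : R, 0 < a /\ HL L `[a, b]%classic = 1%E) ->
     cvg_in_prob_pL P (fun L p w => opnorm (Omegahat L p w - Omega p)) 0 ->
     0 < c1 ->
     (forall p : nat, (0 < p)%N ->
        c1 <= opnorm (Omega p) <= c2 /\
        opnorm (invmx (Omega p)) * opnorm (Omega p) <= cOmega) ->
     cvg_in_distribution (fun L => law_cdf (HL L)) (law_cdf H) ->
     (exists a b : R, 0 < a /\ H `[a, b]%classic = 1%E) ->
     mp_solution gamstar H s ->
     (forall L p, is_predictive_risk P lambda (Sigma L p) (Z L p) (beta L p)
        (eps L p) (xnew L p) (epsnew L p) (Omegahat L p) (risk L p)) ->
     cvg_in_prob_pL P risk (risk_limit lambda sigma gamstar s)).
Proof.
move=> l0 M _ _; split.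
  move=> L p w X Oh; apply: variance_term_diff => //.
  - exact: Omegahat_posdef (M L p) w.
  - exact: Omega_posdef (M L p).
move=> c1 c2 cO g gam HL H s risk n_cvg ratio_cvg gam_cvg g1 esd_cvg Oh_cvg c10 hO law_cvg Hab mps hrisk.
(* The added 1, here and for the inverse of Omega, makes the bounds strictly positive. *)
have Sop L p : opbound (Sigma L p) (`|cop| + 1).
  apply: opbound_le (opnorm_opbound _) _; apply: (le_trans (Sigma_opnorm (M L p))).
  by apply: (le_trans (ler_norm _)); rewrite lerDl.
have Oop p : (0 < p)%N -> opbound (Omega p) c2.
  by move=> p0; have [/andP[_ h] _] := hO p p0; exact: opbound_le (opnorm_opbound _) h.
(* Read off in dimension 1. *)
have c20 : 0 < c2.
  have [/andP[h h'] _] := hO 1%N isT; exact: lt_le_trans c10 (le_trans h h').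
have Iop p : (0 < p)%N -> opbound (invmx (Omega p)) (`|cO| / c1 + 1).
  move=> p0; have [/andP[h _] h'] := hO p p0; apply: opbound_le (opnorm_opbound _) _.
  have i0 : 0 <= opnorm (invmx (Omega p)) by case: (opnorm_opbound (invmx (Omega p))).
  apply: (@le_trans _ _ (`|cO| / c1)); last by rewrite lerDl.
  rewrite ler_pdivlMr //; apply: le_trans (le_trans h' (ler_norm _)).
  by rewrite ler_wpM2l.
apply: (risk_cvg_in_prob l0 M c20 _ _ _ n_cvg ratio_cvg gam_cvg esd_cvg law_cvg Hab Oh_cvg Oop Iop Sop mps hrisk).
- by rewrite ltr_wpDl // divr_ge0 // ltW.
- by rewrite ltr_wpDl.
- exact: lt_trans g1.
Qed.
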